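(* Let $h\colon[n]\to[n]$ be a Hessenberg function, let $\lambda_1<\cdots<\lambda_n$ be real numbers, and put $d=\sum_{i=1}^n(h(i)-i)$. Then: (a) The space $X_h$ of Hermitian staircase matrices of type $h$ with spectrum $\lambda$ is a smooth $2d$-dimensional manifold, whose smooth type (diffeomorphism class) is independent of the choice of the simple spectrum $\lambda$. (b) The space $X_h^{\mathbb{R}}$ of real symmetric staircase matrices of type $h$ with spectrum $\lambda$ is a smooth $d$-dimensional manifold, whose smooth type is independent of the choice of the simple spectrum $\lambda$. (c) The odd degree cohomology of $X_h$ vanishes: $H^{j}(X_h;\mathbb{Z})=0$ for all odd $j$.
   Context: $[n]=\{1,\ldots,n\}$. A Hessenberg function is a function $h\colon[n]\to[n]$ with $h(i)\ge i$ for all $i$ and $h(i+1)\ge h(i)$ for $1\le i\le n-1$. $M_h$ is the real vector space of Hermitian $n\times n$ matrices $A=(a_{ij})$ with $a_{ij}=0$ whenever $j>h(i)$ or $i>h(j)$. $M_\lambda$ is the set of all Hermitian $n\times n$ matrices with spectrum $\lambda=\{\lambda_1,\ldots,\lambda_n\}$. $X_h=M_h\cap M_\lambda$, and $X_h^{\mathbb{R}}$ is the set of matrices in $X_h$ with real entries. The manifold structures are those of smooth submanifolds of the vector space of Hermitian (resp. real symmetric) matrices of staircase form $h$. Cohomology is with integer coefficients. *)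

(* Defs.v *)
From HB Require Import structures.
From mathcomp Require Import all_boot all_order all_algebra.
From mathcomp Require Import complex.
From mathcomp Require Import all_classical all_reals all_analysis.
Set Implicit Arguments.
Unset Strict Implicit.
Unset Printing Implicit Defensive.
Import Order.TTheory GRing.Theory Num.Theory numFieldNormedType.Exports.
Local Open Scope classical_set_scope.
Local Open Scope complex_scope.
Local Open Scope ring_scope.

(* The usual class C^k, provided [U] is open and [V] is finite-dimensional
   (only directional derivatives are iterated). *)
Fixpoint Ck_on (R : realType) (V W : normedModType R) (k : nat)
    (U : set V) (f : V -> W) : Prop :=
  match k with
  | 0 => forall x, U x -> {for x, continuous f}
  | k'.+1 => (forall x, U x -> differentiable f x) /\
             (forall v : V, Ck_on k' U (fun x => 'D_v f x))
  end.

(* Smoothness on an arbitrary subset: local extendability to a smooth map on an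
   open set of the ambient space.  Values of [f] outside [A] are irrelevant. *)
Definition smooth_on (R : realType) (V W : normedModType R)
    (A : set V) (f : V -> W) : Prop :=
  forall x, A x -> exists (U : set V) (F : V -> W),
    [/\ open U, U x, forall k, Ck_on k U F & {in U `&` A, F =1 f}].

Definition diffeomorphic (R : realType) (V W : normedModType R)
    (A : set V) (B : set W) : Prop :=
  exists (f : V -> W) (g : W -> V),
    [/\ f @` A `<=` B, g @` B `<=` A, {in A, cancel f g} & {in B, cancel g f}] /\
    smooth_on A f /\ smooth_on B g.

(* [M] is an embedded [m]-dimensional C^oo submanifold without boundary of [V].
   For a linear subspace of [V] containing [M], being a submanifold of the
   subspace or of [V] is the same, with the same smooth structure. *)
Definition smooth_submanifold (R : realType) (V : normedModType R) (m : nat)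
    (M : set V) : Prop :=
  forall x, M x -> exists (U : set V) (D : set 'rV[R]_m),
    [/\ open U, U x, open D & diffeomorphic (M `&` U) D].

Section SingularCohomology.
Variable R : realType.

Definition std_simplex (p : nat) : set 'rV[R]_p.+1 :=
  [set t | (forall i, 0 <= t ord0 i) /\ \sum_i t ord0 i = 1].
Arguments std_simplex : clear implicits.

(* Insertion of a zero at position [i]. *)
Definition face_row (p : nat) (i : 'I_p.+2) (t : 'rV[R]_p.+1) : 'rV[R]_p.+2 :=
  \row_k oapp (t ord0) 0 (unlift i k).

Lemma face_row_std (p : nat) (i : 'I_p.+2) (t : 'rV[R]_p.+1) :
  std_simplex p t -> std_simplex p.+1 (face_row i t).
Proof.
move=> [t0 t1]; split=> [k|].
  by rewrite mxE; case: unliftP => [j|] _ /=.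
rewrite (bigD1_ord i)//= mxE unlift_none /= add0r -[RHS]t1.
by apply: eq_bigr => j _; rewrite mxE liftK.
Qed.

Definition face (p : nat) (i : 'I_p.+2) (t : std_simplex p) : std_simplex p.+1 :=
  exist _ (face_row i (set_val t)) (mem_set (face_row_std i (set_valP t))).

Lemma face_continuous (p : nat) (i : 'I_p.+2) : continuous (@face p i).
Proof.
apply: continuous_comp_initial => t.
have cs : {for t, continuous (set_val : std_simplex p -> _)}.
  exact: initial_continuous.
apply: (@continuous_comp _ _ _ _ (face_row i) t cs).
move=> A /nbhs_ballP[e /= e0 eA]; apply/nbhs_ballP; exists e => //= u tu.
apply: eA; split=> // r k; rewrite !mxE; case: unliftP => [j|] _ /=.
  by case: tu => _; exact.
exact: ballxx.
Qed.

Variable X : topologicalType.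

Definition singular_simplex (p : nat) : Type :=
  {s : std_simplex p -> X | continuous s}.

Lemma simplex_face_continuous (p : nat) (i : 'I_p.+2)
    (s : singular_simplex p.+1) : continuous (sval s \o face i).
Proof.
by move=> t; apply: continuous_comp; [exact: face_continuous|exact: (svalP s)].
Qed.

Definition simplex_face (p : nat) (i : 'I_p.+2) (s : singular_simplex p.+1) :
    singular_simplex p :=
  exist (fun f : std_simplex p -> X => continuous f) (sval s \o face i)
    (@simplex_face_continuous p i s).

Definition cochain (p : nat) : Type := singular_simplex p -> int.
HB.instance Definition _ (p : nat) := GRing.Zmodule.on (cochain p).

Definition coboundary (p : nat) (c : cochain p) : cochain p.+1 :=
  fun s => \sum_(i < p.+2) (-1) ^+ i * c (simplex_face i s).

Lemma coboundaryB (p : nat) : {morph @coboundary p : a b / a - b}.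
Proof.
move=> a b; apply/funext => s; rewrite /coboundary !fctE /= -sumrB.
by apply: eq_bigr => i _; rewrite -mulrBr.
Qed.

Lemma coboundary0 (p : nat) : @coboundary p 0 = 0.
Proof. by rewrite -(subrr 0) coboundaryB subrr. Qed.

Definition is_cocycle (p : nat) : {pred cochain p} :=
  fun c => `[< coboundary c = 0 >].

Lemma is_cocycle_zmod_closed (p : nat) : zmod_closed (@is_cocycle p).
Proof.
split; first exact/asboolP/coboundary0.
by move=> a b /asboolP a0 /asboolP b0; apply/asboolP; rewrite coboundaryB a0 b0 subrr.
Qed.
HB.instance Definition _ (p : nat) :=
  GRing.isZmodClosed.Build (cochain p) (@is_cocycle p) (@is_cocycle_zmod_closed p).

Record cocycle (p : nat) : Type :=
  Cocycle { cochain_of :> cochain p; _ : cochain_of \in @is_cocycle p }.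
HB.instance Definition _ (p : nat) := [isSub for @cochain_of p].
HB.instance Definition _ (p : nat) := [Choice of cocycle p by <:].
HB.instance Definition _ (p : nat) := [SubChoice_isSubZmodule of cocycle p by <:].

Definition coboundaries (p : nat) : set (cochain p) :=
  match p with
  | 0 => [set 0]
  | q.+1 => range (@coboundary q)
  end.

Definition is_coboundary (p : nat) : {pred cocycle p} :=
  fun z => `[< coboundaries (z : cochain p) >].

Lemma is_coboundary_zmod_closed (p : nat) : zmod_closed (@is_coboundary p).
Proof.
split.
  apply/asboolP; case: p => [|p] //=; exists 0 => //; exact: coboundary0.
move=> a b /asboolP Ba /asboolP Bb; apply/asboolP; rewrite GRing.valB.
case: p a b Ba Bb => [|p] a b /=; first by move=> -> ->; rewrite subrr.
move=> [a' _ <-] [b' _ <-]; exists (a' - b') => //; exact: coboundaryB.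
Qed.
HB.instance Definition _ (p : nat) :=
  GRing.isZmodClosed.Build (cocycle p) (@is_coboundary p)
    (@is_coboundary_zmod_closed p).

Definition singular_cohomology (p : nat) : zmodType :=
  Quotient.quot (@is_coboundary p).

End SingularCohomology.

(* ['I_n] is [{0,...,n-1}]; shifting all indices by one recovers [{1,...,n}] and
   leaves both conditions, and [\sum_i (h i - i)], unchanged. *)
Definition hessenberg_function (n : nat) (h : 'I_n -> 'I_n) : Prop :=
  (forall i : 'I_n, (i <= h i)%N) /\
  (forall i j : 'I_n, (j = i.+1 :> nat) -> (h i <= h j)%N).

(* The subtraction is on [nat], but never truncates for a Hessenberg function. *)
Definition staircase_dim (n : nat) (h : 'I_n -> 'I_n) : nat :=
  (\sum_(i < n) (h i - i))%N.

Definition simple_spectrum (R : realType) (n : nat) (lam : 'I_n -> R) : Prop :=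
  forall i j : 'I_n, (i < j)%N -> lam i < lam j.

Section StaircaseMatrices.
Variables (R : realType) (n : nat).

Definition staircase_hermitian (h : 'I_n -> 'I_n) : set 'M[R[i]]_n :=
  [set A | A \is hermsymmx /\
           forall i j : 'I_n, (h i < j)%N || (h j < i)%N -> A i j = 0].

(* The spectrum as a set; for [n] distinct values every eigenvalue is simple. *)
Definition hermitian_with_spectrum (lam : 'I_n -> R) : set 'M[R[i]]_n :=
  [set A | A \is hermsymmx /\ [set a | eigenvalue A a] = [set (lam i)%:C | i in setT]].

Definition real_entries : set 'M[R[i]]_n :=
  [set A : 'M[R[i]]_n | forall i j, A i j \is Num.real].

(* [R[i]] carries no real normed module structure in the library: the real
   vector space of complex matrices is modelled by pairs (real part, imaginary
   part). *)
Definition re_im (A : 'M[R[i]]_n) : 'M[R]_n * 'M[R]_n :=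
  (map_mx (@complex.Re R) A, map_mx (@complex.Im R) A).

Definition X_herm (h : 'I_n -> 'I_n) (lam : 'I_n -> R) : set ('M[R]_n * 'M[R]_n) :=
  re_im @` (staircase_hermitian h `&` hermitian_with_spectrum lam).

Definition X_real (h : 'I_n -> 'I_n) (lam : 'I_n -> R) : set ('M[R]_n * 'M[R]_n) :=
  re_im @` (staircase_hermitian h `&` hermitian_with_spectrum lam `&` real_entries).

End StaircaseMatrices.

(* Main.v *)
(* Parts (a) and (b).  Staircase matrices are parametrized linearly by their free real
   coordinates, and by Newton's identities X_h is a common level set of the functions tr A^k,
   1 <= k <= n.  The level is regular: if a linear combination B of powers of A is orthogonal to
   all staircase matrices, then B = N + N^* with N supported below the staircase; [A, N] is
   strictly lower triangular and [A, N^*] strictly upper triangular, so N commutes with A, and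
   N = 0 since it is nilpotent and A has simple spectrum.  Levels over a segment of spectra are
   uniformly bounded, and two nearby levels are identified by joining the two ends of short
   segments that are normal, at their midpoints, to the level of the midpoint.

   Part (c).  For a permutation w let V_w be the open set of those A in X_h for which the
   standard flag is transverse to the eigenspaces taken in the order w.  On V_w a canonical upper
   triangular change of basis makes A lower triangular with diagonal lam o w, and the entries
   below the diagonal and inside the staircase identify V_w with a complex affine space.  Adding
   the sets V_w in lexicographic order, V_w meets the union of the previous ones exactly where
   one of the entries (i, j) with j < i and w j < w i is nonzero, that is, in the complement of
   a linear subspace of even real codimension.  Its reduced cohomology lives in one odd degree,
   so Mayer-Vietoris propagates the vanishing of odd cohomology. *)

From HB Require Import structures.
Require Import Defs.
From mathcomp Require Import all_boot all_order all_algebra all_fingroup.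
From mathcomp Require Import complex.
From mathcomp Require Import all_classical all_reals all_analysis.
From mathcomp Require Import ring lra zify generic_quotient.
Set Implicit Arguments.
Unset Strict Implicit.
Unset Printing Implicit Defensive.
Import Order.TTheory GRing.Theory Num.Theory numFieldNormedType.Exports.
Local Open Scope classical_set_scope.
Local Open Scope ring_scope.

(** * Calculus of C^k maps *)

(** Nearby levels are compared by the inverse function theorem and compactness alone, without
    integrating a vector field. The comparison is symmetric in its two ends, so its inverse has the
    same form and is smooth for the same reason. Cochains are functions on all simplices of the
    ambient space, and a subset enters only through the simplices that are tested; charts, unions
    and intersections thus live in one type. Acyclicity is reduced, so that contractible charts and
    homotopy spheres, possibly empty, are treated alike. Charts are built from spectral projectors,
    which are polynomials in A, rather than from eigenvectors: no phase is chosen and continuity is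
    visible. The order on charts works because the positions (i, j) with j <= i and w i <= w j form
    a partial order: the matrices supported on it are an algebra, stable under inverses and spectral
    projectors. Support therefore passes between a triangular matrix and its unipotent eigenbasis,
    and the linear condition in the chart becomes degeneracy for all smaller permutations. *)

Module Export MatrixCoordinate.

Definition mx_coord (R : realType) m n (i : 'I_m) (j : 'I_n) (x : 'M[R]_(m, n)) : R^o := x i j.

Lemma mx_coord_is_linear (R : realType) m n i j : linear (@mx_coord R m n i j).
Proof. by move=> a x y; rewrite /mx_coord !mxE. Qed.

HB.instance Definition _ (R : realType) m n i j :=
  GRing.isLinear.Build R 'M[R]_(m, n) R^o *:%R _ (@mx_coord_is_linear R m n i j).

End MatrixCoordinate.

Section CkCalculus.
Context {R : realType}.
Implicit Types (U V W : normedModType R).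

(** [g - f] vanishes near [x], so the zero map is its differential, and [g] is [(g - f) + f]. *)
Lemma near_eq_differentiable V W (f g : V -> W) (x : V) :
  (\near x, f x = g x) -> differentiable f x -> differentiable g x.
Proof.
move=> fg df.
have fgx : f x = g x by exact: nbhs_singleton fg.
suff dh : differentiable (g - f) x.
  by rewrite -[g](subrK f); exact: differentiableD.
have h0 : (g - f) \o shift x = cst ((g - f) x) + ((\0 : V -> W) : {linear V -> W}) +o_ (0 : V) id.
  apply/eqaddoP => _/posnumP[e].
  near=> y; rewrite /= !fctE /= fgx subrr addr0 subr0.
  have -> : f (y + x) = g (y + x).
    near: y; move: fg; rewrite (near_shift 0 x) /=.
    by rewrite subr0.
  by rewrite subrr normr0 mulr_ge0.
have c0 : continuous ((\0 : V -> W) : {linear V -> W}) by exact: cst_continuous.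
by apply/diff_locallyP; rewrite (diff_unique c0 h0).
Unshelve. all: by end_near. Qed.

(** Openness of [U] matters: a derivative at [x] sees a neighbourhood of [x], so equality on [U]
    passes to derivatives only at interior points. *)
Lemma Ck_on_eq V W k (U : set V) (f g : V -> W) : open U ->
  (forall x, U x -> f x = g x) -> Ck_on k U f -> Ck_on k U g.
Proof.
move=> oU; elim: k f g => [|k IH] f g fg /=.
  move=> cf x Ux; have := cf x Ux; rewrite /prop_for /continuous_at (fg x Ux).
  apply: cvg_trans; apply: near_eq_cvg; near=> y; apply: fg; near: y.
  exact: open_nbhs_nbhs.
have nfg x : U x -> \near x, f x = g x.
  by move=> Ux; near=> y; apply: fg; near: y; exact: open_nbhs_nbhs.
move=> [df Df]; split.
  by move=> x Ux; apply: near_eq_differentiable (df x Ux); exact: nfg.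
move=> v; apply: IH (Df v) => x Ux; exact/near_eq_derive/nfg.
Unshelve. all: by end_near. Qed.

Lemma Ck_onW V W k (U U' : set V) (f : V -> W) : U' `<=` U ->
  Ck_on k U f -> Ck_on k U' f.
Proof.
move=> U'U; elim: k f => [|k IH] f /=; first by move=> cf x /U'U; exact: cf.
by move=> [df Df]; split=> [x /U'U|v]; [exact: df|exact: IH].
Qed.

Lemma Ck_onS V W k (U : set V) (f : V -> W) : Ck_on k.+1 U f -> Ck_on k U f.
Proof.
elim: k f => [|k IH] f; last by move=> [df Df]; split=> // v; exact/IH/Df.
by move=> [df _] x Ux; apply: differentiable_continuous; exact: df.
Qed.

Lemma Ck_on_cst V W k (U : set V) (w : W) : Ck_on k U (fun=> w).
Proof.
elim: k w => [|k IH] w /=; first by move=> x _; exact: cst_continuous.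
split=> [x _|v]; first exact: differentiable_cst.
rewrite (_ : 'D_v _ = fun=> 0)//.
by apply: funext => x; rewrite derive_cst.
Qed.

Lemma linear_derive V W (f : {linear V -> W}) (x v : V) : continuous f ->
  'D_v f x = f v.
Proof.
by move=> cf; rewrite deriveE ?diff_lin//; exact: linear_differentiable.
Qed.

Lemma Ck_on_linear V W k (U : set V) (f : {linear V -> W}) :
  continuous f -> Ck_on k U f.
Proof.
move=> cf; case: k => [|k] /=; first by move=> x _; exact: cf.
split=> [x _|v]; first exact: linear_differentiable.
rewrite (_ : 'D_v _ = fun=> f v); first exact: Ck_on_cst.
by apply: funext => x; rewrite linear_derive.
Qed.

Lemma Ck_onD V W k (U : set V) (f g : V -> W) : open U ->
  Ck_on k U f -> Ck_on k U g -> Ck_on k U (fun x => f x + g x).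
Proof.
move=> oU; elim: k f g => [|k IH] f g /=.
  by move=> cf cg x Ux; apply: cvgD; [exact: cf|exact: cg].
move=> [df Df] [dg Dg]; split=> [x Ux|v].
  by apply: differentiableD; [exact: df|exact: dg].
apply: Ck_on_eq (IH _ _ (Df v) (Dg v)) => // x Ux.
by rewrite deriveD//; apply: diff_derivable; [exact: df|exact: dg].
Qed.

Lemma Ck_on_sum V W k (U : set V) (I : Type) (r : seq I) (f : I -> V -> W) :
  open U -> (forall i, Ck_on k U (f i)) -> Ck_on k U (fun x => \sum_(i <- r) f i x).
Proof.
move=> oU cf; elim: r => [|i r IH].
  by under eq_fun do rewrite big_nil; exact: Ck_on_cst.
by under eq_fun do rewrite big_cons; exact: Ck_onD.
Qed.

Lemma scaler_is_bilinear W :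
  bilinear_for
    (GRing.Scale.Law.clone _ _ ( *:%R : R -> W -> W) _)
    (GRing.Scale.Law.clone _ _ ( *:%R : R -> W -> W) _)
    (fun (a : R) (w : W) => a *: w).
Proof.
split=> [u'|u] a x y /=; first by rewrite scalerDl scalerA.
by rewrite scalerDr !scalerA mulrC.
Qed.

Lemma is_diff_scale V W (f : V -> R) (g : V -> W) x :
  differentiable f x -> differentiable g x ->
  is_diff x (fun y => f y *: g y) (fun v => f x *: 'd g x v + 'd f x v *: g x).
Proof.
move=> df dg.
(* Scaling is packed as a bilinear map, so that the product rule is the differential of a bilinear
   map composed with a pair. *)
pose s := (fun (a : R) (w : W) => a *: w).
pose sM := bilinear_isBilinear.Build R R W W _ _ s (scaler_is_bilinear W).
pose sL : {bilinear R -> W -> W} := HB.pack s sM.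
have sc : continuous (fun p : R * W => s p.1 p.2) by exact: scale_continuous.
have ds p : is_diff p (fun p : R * W => s p.1 p.2)
    (fun q => p.1 *: q.2 + q.1 *: p.2).
  by apply: DiffDef; [exact: (differentiable_bilin (f := sL))|rewrite (diff_bilin (f := sL))].
have d1 := differentiableP (differentiable_pair df dg).
have -> : (fun y => f y *: g y) = (fun p : R * W => s p.1 p.2) \o (fun y => (f y, g y)) by [].
apply: is_diff_eq (is_diff_comp d1 (ds _)) _.
by rewrite diff_pair.
Qed.

Lemma Ck_on_scale V W k (U : set V) (f : V -> R) (g : V -> W) : open U ->
  Ck_on k U (f : V -> R^o) -> Ck_on k U g -> Ck_on k U (fun x => f x *: g x).
Proof.
move=> oU; elim: k f g => [|k IH] f g /=.
  by move=> cf cg x Ux; apply: cvgZ; [exact: cf|exact: cg].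
move=> Cf Cg; have [df Df] := Cf; have [dg Dg] := Cg.
split=> [x Ux|v]; first by have [] := is_diff_scale (df x Ux) (dg x Ux).
apply: (@Ck_on_eq _ _ _ _ (fun x => f x *: 'D_v g x + 'D_v f x *: g x)) => //.
  move=> x Ux; have [dfg fg] := is_diff_scale (df x Ux) (dg x Ux).
  by rewrite [RHS]deriveE// fg (deriveE _ (df x Ux)) (deriveE _ (dg x Ux)).
by apply: Ck_onD => //; apply: IH => //; exact: Ck_onS.
Qed.

Lemma Ck_onM V k (U : set V) (f g : V -> R) : open U ->
  Ck_on k U (f : V -> R^o) -> Ck_on k U (g : V -> R^o) ->
  Ck_on k U ((fun x => f x * g x) : V -> R^o).
Proof. by move=> oU cf cg; exact: (@Ck_on_scale _ R^o). Qed.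

Lemma Ck_on_prod V k (U : set V) (I : Type) (r : seq I) (f : I -> V -> R) :
  open U -> (forall i, Ck_on k U (f i : V -> R^o)) ->
  Ck_on k U ((fun x => \prod_(i <- r) f i x) : V -> R^o).
Proof.
move=> oU cf; elim: r => [|i r IH].
  by under eq_fun do rewrite big_nil; exact: Ck_on_cst.
by under eq_fun do rewrite big_cons; exact: Ck_onM.
Qed.

Lemma Ck_onV V k (U : set V) (f : V -> R) : open U -> (forall x, U x -> f x != 0) ->
  Ck_on k U (f : V -> R^o) -> Ck_on k U ((fun x => (f x)^-1) : V -> R^o).
Proof.
move=> oU f0; elim: k f f0 => [|k IH] f f0 /=.
  by move=> cf x Ux; apply: cvgV; [exact: f0|exact: cf].
move=> Cf; have [df Df] := Cf.
split=> [x Ux|v]; first by apply: differentiableV; [exact: df|exact: f0].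
have Cf' := IH _ f0 (Ck_onS Cf).
apply: (@Ck_on_eq _ _ _ _ ((fun x => (-1) * ((f x)^-1 * (f x)^-1) * 'D_v f x) : V -> R^o)) => //.
  move=> x Ux; rewrite deriveV ?f0//; last exact/diff_derivable/df.
  by rewrite /GRing.scale/= expr2 invfM mulN1r.
by do ?[apply: Ck_onM => //]; exact: Ck_on_cst.
Qed.

Lemma derive_linear_comp V W (W' : normedModType R) (L : {linear W -> W'}) (f : V -> W) x v :
  continuous L -> differentiable f x -> 'D_v (fun y => L (f y)) x = L ('D_v f x).
Proof.
move=> cL df; have dL := linear_differentiable (f x) cL.
rewrite deriveE; last exact: (differentiable_comp df dL).
rewrite (_ : (fun y => _) = L \o f)//.
by rewrite (diff_comp df dL) /= diff_lin// deriveE.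
Qed.

Lemma Ck_on_linear_comp V W (W' : normedModType R) k (U : set V)
    (L : {linear W -> W'}) (f : V -> W) : open U -> continuous L ->
  Ck_on k U f -> Ck_on k U (fun x => L (f x)).
Proof.
move=> oU cL; elim: k f => [|k IH] f /=.
  by move=> cf x Ux; apply: (cvg_comp _ _ (cf x Ux)); exact: cL.
move=> [df Df]; split=> [x Ux|v].
  apply: (@differentiable_comp _ _ _ _ f L); first exact: df.
  exact: linear_differentiable.
by apply: Ck_on_eq (IH _ (Df v)) => // x Ux; rewrite derive_linear_comp//; exact: df.
Qed.

(** Deriving along [v] turns [f] into its derivative along the fixed vector [L v]; no coordinates
    are needed, so the source and middle spaces are arbitrary. *)
Lemma Ck_on_comp_linear V W (V' : normedModType R) k (U : set V) (L : {linear V' -> V})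
    (f : V -> W) : continuous L ->
  Ck_on k U f -> Ck_on k (L @^-1` U) (fun x => f (L x)).
Proof.
move=> cL; elim: k f => [|k IH] f /=.
  by move=> cf x Ux; apply: (cvg_comp _ _ (cL x)); exact: cf.
move=> [df Df]; split=> [x Ux|v].
  apply: (@differentiable_comp _ _ _ _ L f); last exact: df.
  exact: linear_differentiable.
rewrite (_ : 'D_v _ = fun x => 'D_(L v) f (L x)); first exact: (IH ('D_(L v) f) (Df (L v))).
apply: funext => x; rewrite /derive.
have E (a : R) : L (a *: v + x) = a *: L v + L x by rewrite linearP.
by under eq_fun => a do rewrite /= E.
Qed.

Lemma rV_norm_coord m n (x : 'M[R]_(m, n)) i j : `|x i j| <= `|x|.
Proof. by rewrite [leRHS]/Num.Def.normr/= mx_normrE; exact: (le_bigmax _ _ (i, j)). Qed.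

Lemma rV_norm_le m n (x : 'M[R]_(m, n)) e : 0 <= e ->
  (forall i j, `|x i j| <= e) -> `|x| <= e.
Proof.
by move=> e0 xe; rewrite /Num.Def.normr/= mx_normrE; apply: bigmax_le => //= i _; exact: xe.
Qed.

Lemma linear_rV_continuous m (W : normedModType R) (f : {linear 'rV[R]_m -> W}) : continuous f.
Proof.
rewrite (_ : (f : _ -> _) = fun x => \sum_i x 0 i *: f (delta_mx 0 i)); last first.
  apply: funext => x; rewrite {1}[x]row_sum_delta linear_sum.
  by apply: eq_bigr => i _; rewrite linearZ.
suff : Ck_on 0 [set: 'rV[R]_m] (fun x => \sum_i x 0 i *: f (delta_mx 0 i)) by move=> + x; exact.
apply: Ck_on_sum; first exact: openT.
move=> i x _; apply: (@cvgZr_tmp _ _ _ (nbhs x)); exact: (@coord_continuous _ 1 m 0 i).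
Qed.

Lemma Ck_on_coord V m n k (U : set V) (f : V -> 'M[R]_(m, n)) : open U ->
  Ck_on k U f <-> forall i j, Ck_on k U ((fun x => f x i j) : V -> R^o).
Proof.
move=> oU; split=> [cf i j|cf].
  by apply: (@Ck_on_linear_comp _ _ _ k U (@mx_coord R m n i j)) => //; exact: coord_continuous.
rewrite (_ : f = fun x => \sum_i \sum_j f x i j *: delta_mx i j); last first.
  by apply: funext => x; exact: matrix_sum_delta.
apply: Ck_on_sum => // i; apply: Ck_on_sum => // j.
by apply: Ck_on_scale => //; exact: Ck_on_cst.
Qed.

Lemma derive_rV_sum m W (g : 'rV[R]_m -> W) y w : differentiable g y ->
  'D_w g y = \sum_i w 0 i *: 'D_(delta_mx 0 i) g y.
Proof.
move=> dg; rewrite deriveE// {1}[w]row_sum_delta linear_sum.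
by apply: eq_bigr => i _; rewrite linearZ deriveE.
Qed.

Lemma derive_comp V W (W' : normedModType R) (f : V -> W) (g : W -> W') x v :
  differentiable f x -> differentiable g (f x) ->
  'D_v (fun y => g (f y)) x = 'D_('D_v f x) g (f x).
Proof.
move=> df dg; rewrite deriveE; last exact: (differentiable_comp df dg).
rewrite (_ : (fun y => _) = g \o f)//.
by rewrite (diff_comp df dg) /= deriveE// deriveE.
Qed.

(** The middle space consists of rows because the induction writes the derivative of the composite
    as a finite sum of coordinates of ['D_v f] times partial derivatives of [g]. *)
Lemma Ck_on_comp V W m k (U : set V) (U' : set 'rV[R]_m) (f : V -> 'rV[R]_m)
    (g : 'rV[R]_m -> W) : open U -> (forall x, U x -> U' (f x)) ->
  Ck_on k U f -> Ck_on k U' g -> Ck_on k U (fun x => g (f x)).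
Proof.
move=> oU fU; elim: k f g fU => [|k IH] f g fU /=.
  by move=> cf cg x Ux; apply: (cvg_comp _ _ (cf x Ux)); exact/cg/fU.
move=> Cf Cg; have [df Df] := Cf; have [dg Dg] := Cg.
split=> [x Ux|v].
  by apply: (@differentiable_comp _ _ _ _ f g); [exact: df|exact/dg/fU].
apply: (@Ck_on_eq _ _ _ _
  (fun x => \sum_i ('D_v f x) 0 i *: 'D_(delta_mx 0 i) g (f x))) => //.
  move=> x Ux; rewrite (derive_comp _ (df x Ux) (dg _ (fU x Ux))).
  by rewrite -(derive_rV_sum _ (dg _ (fU x Ux))).
apply: Ck_on_sum => // i; apply: Ck_on_scale => //.
  by move/Ck_on_coord : (Df v); exact.
exact: (IH f ('D_(delta_mx 0 i) g) fU (Ck_onS Cf) (Dg _)).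
Qed.

Lemma Ck_on_mulmx V m n p k (U : set V) (f : V -> 'M[R]_(m, n)) (g : V -> 'M[R]_(n, p)) :
  open U -> Ck_on k U f -> Ck_on k U g -> Ck_on k U (fun x => f x *m g x).
Proof.
move=> oU /Ck_on_coord cf /Ck_on_coord cg; apply/Ck_on_coord => // i j.
under eq_fun do rewrite mxE.
by apply: (@Ck_on_sum _ R^o) => // l; apply: Ck_onM => //; [exact: cf|exact: cg].
Qed.

Lemma Ck_on_det V n k (U : set V) (f : V -> 'M[R]_n) :
  open U -> Ck_on k U f -> Ck_on k U ((fun x => \det (f x)) : V -> R^o).
Proof.
move=> oU /Ck_on_coord cf; apply: (@Ck_on_sum _ R^o) => // s.
apply: Ck_onM => //; first exact: Ck_on_cst.
by apply: Ck_on_prod => // i; exact: cf.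
Qed.

Lemma Ck_on_adj V n k (U : set V) (f : V -> 'M[R]_n) :
  open U -> Ck_on k U f -> Ck_on k U (fun x => \adj (f x)).
Proof.
move=> oU /Ck_on_coord cf; apply/Ck_on_coord => // i j.
under eq_fun do rewrite mxE /cofactor.
apply: Ck_onM => //; first exact: Ck_on_cst.
apply: Ck_on_det => //; apply/Ck_on_coord => // a b.
by under eq_fun do rewrite !mxE; exact: cf.
Qed.

Lemma Ck_on_invmx V n k (U : set V) (f : V -> 'M[R]_n) : open U ->
  (forall x, U x -> f x \in unitmx) ->
  Ck_on k U f -> Ck_on k U (fun x => invmx (f x)).
Proof.
move=> oU fu cf.
apply: (@Ck_on_eq _ _ _ _ (fun x => (\det (f x))^-1 *: \adj (f x))) => //.
  by move=> x Ux; rewrite /invmx fu.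
apply: Ck_on_scale => //; last exact: Ck_on_adj.
apply: Ck_onV => //; last exact: Ck_on_det.
by move=> x Ux; rewrite -unitfE -unitmxE; exact: fu.
Qed.

End CkCalculus.

(** * Inverse function theorem *)

HB.instance Definition _ (R : realType) (m n : nat) := Complete.on 'M[R]_(m, n).

Section InverseFunction.
Context {R : realType}.

Lemma is_derive_line (V W : normedModType R) (f : V -> W) (y v : V) (t : R) :
  differentiable f (t *: v + y) ->
  is_derive t 1 ((fun s => f (s *: v + y)) : R -> W) ('D_v f (t *: v + y)).
Proof.
move=> df; have dv := @diff_derivable _ _ _ f _ v df; move: dv; rewrite /derivable => dv.
have E : (fun h : R => h^-1 *: (((fun s => f (s *: v + y)) \o shift t) (h *: (1 : R)) - f (t *: v + y)))
       = (fun h : R => h^-1 *: ((f \o shift (t *: v + y)) (h *: v) - f (t *: v + y))).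
  apply: funext => h /=; congr (_ *: (f _ - _)).
  by rewrite (_ : h *: (1 : R) = h) ?scalerDl ?addrA//; exact: mulr1.
by apply: DeriveDef; rewrite /derivable /derive E.
Qed.

Lemma mean_value_unit_interval (g dg : R -> R) :
  (forall t : R, t \in `[0, 1]%R -> is_derive t (1 : R) g (dg t)) ->
  exists2 t : R, t \in `[0, 1]%R & g 1 - g 0 = dg t.
Proof.
move=> gd.
have gd' (t : R) : t \in `]0, 1[%R -> is_derive t (1 : R) g (dg t).
  by move=> t01; apply: gd; exact: subset_itvW t01.
have gc : {within `[0, 1], continuous g}.
  apply: derivable_within_continuous => t t01.
  by have [] := gd t t01.
have [t t01 E] := MVT_segment (ler01 : (0 : R) <= 1) gd' gc.
by exists t => //; rewrite E subr0 mulr1.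
Qed.

(** Continuity of the finitely many partial derivatives bounds them near [x0]; the mean value
    theorem on segments, coordinate by coordinate in the sup norm, turns this into a Lipschitz
    bound. *)
Lemma C1_small_lipschitz N M (U : set 'rV[R]_N) (f : 'rV[R]_N -> 'rV[R]_M) (x0 : 'rV[R]_N)
    (e : R) : open U -> U x0 -> Ck_on 1 U f -> (forall v, 'D_v f x0 = 0) -> 0 < e ->
  exists2 r, 0 < r & [/\ ball x0 r `<=` U,
    forall x y, ball x0 r x -> ball x0 r y -> `|f x - f y| <= e * `|x - y| &
    forall x v, ball x0 r x -> `|'D_v f x| <= e * `|v|].
Proof.
move=> oU Ux0 [df Df] D0 e0.
(* Each of the [N] partial derivatives gets the share [e / N.+1%:R], which is meaningful for [N = 0]
   too. *)
have N0 : 0 < (N.+1%:R : R) by rewrite ltr0n.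
have : \forall x \near x0, U x /\ forall i : 'I_N, `|'D_(delta_mx 0 i) f x| <= e / N.+1%:R.
  apply: filterI; first exact: open_nbhs_nbhs.
  apply: (@filter_forall _ _ (fun i x => `|'D_(delta_mx 0 i) f x| <= e / N.+1%:R) (nbhs x0)) => i; have /= ci := Df (delta_mx 0 i) x0 Ux0.
  have /cvgrPdist_le/(_ (e / N.+1%:R)) := ci.
  rewrite divr_gt0// => /(_ isT); apply: filterS => x.
  by rewrite D0 sub0r normrN.
move=> /nbhs_ballP[r /= r0 rP]; exists r => //.
have bd x v : ball x0 r x -> `|'D_v f x| <= e * `|v|.
  move=> /rP[Ux /= Dx]; rewrite derive_rV_sum; last exact: df.
  apply: le_trans (ler_norm_sum _ _ _) _.
  apply: (@le_trans _ _ (\sum_(i < N) e / N.+1%:R * `|v|)).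
    apply: ler_sum => i _; rewrite normrZ mulrC ler_pM//.
    exact: rV_norm_coord.
  rewrite -mulr_suml sumr_const card_ord ler_wpM2r//.
  by rewrite -[leLHS]mulr_natl mulrCA -[leRHS]mulr1 ler_pM2l// ler_pdivrMr// mul1r ler_nat.
split=> //; first by move=> x /rP[].
move=> x y xr yr; apply: rV_norm_le => [|i j]; first by rewrite mulr_ge0// ltW.
rewrite (ord1 i) {i}.
pose l (t : R) := t *: (x - y) + y.
have lb t : t \in `[0, 1]%R -> ball x0 r (l t).
  rewrite in_itv/= => /andP[t0 t1]; move: xr yr.
  rewrite -!ball_normE /ball_/= => xr yr.
  have -> : x0 - l t = t *: (x0 - x) + (1 - t) *: (x0 - y).
    rewrite /l !scalerBr !scalerBl !scale1r.
    by apply/matrixP => a b; rewrite !mxE; ring.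
  apply: le_lt_trans (ler_normD _ _) _.
  rewrite !normrZ (ger0_norm t0) ger0_norm ?subr_ge0//.
  have [->|tn0] := eqVneq t 0; first by rewrite mul0r add0r subr0 mul1r.
  have tp : 0 < t by rewrite lt0r tn0.
  by move: `|x0 - x| `|x0 - y| xr yr => a b xr yr; nra.
have ld (t : R) : t \in `[0, 1]%R -> is_derive t 1 (fun s : R => f (l s) 0 j : R) (('D_(x - y) f (l t)) 0 j).
  move=> /lb /rP[Ul _]; have dl := df _ Ul.
  have [d1 d2] := @is_derive_line _ _ f y (x - y) t dl.
  apply: DeriveDef; first by move/derivable_mxP : d1; exact.
  have := derive_mx d1; rewrite d2 => /matrixP/(_ 0 j).
  by rewrite [RHS]mxE => ->.
have [t t01] := mean_value_unit_interval ld.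
rewrite {1 2}/l scale1r subrK scale0r add0r => E.
rewrite !mxE E; apply: le_trans (rV_norm_coord _ _ _) _.
by apply: bd; exact: lb.
Qed.

Lemma mulmx_norm_bound N M (A : 'M[R]_(N, M)) :
  exists2 c : R, 0 < c & forall v : 'rV[R]_N, `|v *m A| <= c * `|v|.
Proof.
by apply: (linear_lipschitz (f := mulmxr A)); exact: linear_rV_continuous.
Qed.

Definition local_inverse N (f : 'rV[R]_N -> 'rV[R]_N) (U V : set 'rV[R]_N)
    (g : 'rV[R]_N -> 'rV[R]_N) : Prop :=
  [/\ forall x, U x -> V (f x), forall y, V y -> U (g y),
      forall x, U x -> g (f x) = x & forall y, V y -> f (g y) = y].

(** With [K] as an approximate inverse differential, [f x = y] says that [x] is a fixed point of
    [y *m K + (x - f x *m K)]. *)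
Lemma contraction_inverse N (U : set 'rV[R]_N) (f : 'rV[R]_N -> 'rV[R]_N) (x0 : 'rV[R]_N)
    (K : 'M[R]_N) (r : R) :
  (forall x, U x -> {for x, continuous f}) -> 0 < r -> ball x0 r `<=` U ->
  K \in unitmx ->
  (forall x y, ball x0 r x -> ball x0 r y ->
    `|(x - f x *m K) - (y - f y *m K)| <= 2^-1 * `|x - y|) ->
  exists (U' V : set 'rV[R]_N) (g : 'rV[R]_N -> 'rV[R]_N),
    [/\ open U', U' x0, U' `<=` ball x0 r, open V & local_inverse f U' V g].
Proof.
move=> cf r0 rU uK lip.
pose psi x := x - f x *m K.
pose V := [set y | ball (f x0 *m K) (r / 4) (y *m K)].
pose U' := ball x0 r `&` f @^-1` V.
have r4 : 0 < r / 4 by rewrite divr_gt0.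
have oV : open V.
  apply: (@open_comp _ _ (mulmxr K)); last exact: ball_open.
  by move=> x _; exact: linear_rV_continuous.
have oU' : open U'.
  rewrite openE => x [xr Vx]; rewrite /interior; apply: filterI.
    by apply: open_nbhs_nbhs; split=> //; exact: ball_open.
  apply: (cf x (rU _ xr)); exact: open_nbhs_nbhs.
have cx0 : ball x0 r x0 by exact: ballxx.
have sur y : V y -> exists2 x, U' x & f x = y.
  move=> Vy.
  pose T x := y *m K + psi x.
  have bT x : closed_ball_ Num.norm x0 (r / 2) x -> closed_ball_ Num.norm x0 (r / 2) (T x).
    rewrite /closed_ball_/= => xr.
    have bx : ball x0 r x.
      by rewrite -ball_normE/= (le_lt_trans xr)// ltr_pdivrMr// ltr_pMr// ltr1n.
    have -> : x0 - T x = (f x0 *m K - y *m K) + (psi x0 - psi x).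
      rewrite /T /psi; move: (f x *m K) (f x0 *m K) (y *m K) => p q s.
      by apply/matrixP => a b; rewrite !mxE; ring.
    apply: le_trans (ler_normD _ _) _.
    have l1 : `|f x0 *m K - y *m K| < r / 4 by move: Vy; rewrite /V/= -ball_normE.
    have l2 := lip _ _ cx0 bx; rewrite -/(psi x0) -/(psi x) in l2.
    by move: xr l1 l2; move: `|x0 - x| `|psi x0 - psi x| `|_| => a b c; lra.
  pose cB := closed_ball_ Num.norm x0 (r / 2).
  have fT : {homo T : x / cB x >-> cB x} by move=> x; exact: bT.
  pose Tf : {fun cB >-> cB} := mkfun fT.
  have ctr : is_contraction Tf.
    have q0 : (0 : R) <= 2^-1 by rewrite invr_ge0.
    exists (NngNum q0); split; first by rewrite /= invf_lt1// ltr1n.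
    move=> [x z] [/= xB zB]; rewrite /T.
    rewrite [_ - _](_ : _ = psi x - psi z); last by rewrite opprD addrACA subrr add0r.
    have hb u : cB u -> ball x0 r u.
      rewrite /cB /closed_ball_/= => ur.
      by rewrite -ball_normE/= (le_lt_trans ur)// ltr_pdivrMr// ltr_pMr// ltr1n.
    by apply: lip; exact: hb.
  have [||x xB xE] := @banach_fixed_point R 'rV[R]_N cB Tf ctr.
  - exact: closed_closed_ball_.
  - by exists x0; rewrite /cB /closed_ball_/= subrr normr0 divr_ge0// ltW.
  have fxy : f x = y.
    have xE' : x = y *m K + (x - f x *m K) := xE.
    have : f x *m K = y *m K by apply: (addrI x); rewrite {1}xE' addrA subrK addrC.
    by move=> /(congr1 (mulmx^~ (invmx K))); rewrite /= !mulmxK.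
  exists x => //; split; last by rewrite /= fxy.
  by move: xB; rewrite /cB /closed_ball_/= -ball_normE/= => xr; rewrite (le_lt_trans xr)// ltr_pdivrMr// ltr_pMr// ltr1n.
have inj x z : ball x0 r x -> ball x0 r z -> f x = f z -> x = z.
  move=> xr zr E; have := lip x z xr zr.
  rewrite E; move: (f z *m K) => q.
  rewrite (_ : x - q - (z - q) = x - z); last first.
    by apply/matrixP => a b; rewrite !mxE; ring.
  have [//|xz] := eqVneq x z.
  have : 0 < `|x - z| by rewrite normr_gt0 subr_eq0.
  by move=> H1 H2; exfalso; move: H1 H2; move: `|x - z| => a; lra.
exists U', V, (fun y => xget x0 [set x | U' x /\ f x = y]).
have gP y : V y -> U' (xget x0 [set x | U' x /\ f x = y]) /\
    f (xget x0 [set x | U' x /\ f x = y]) = y.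
  move=> /sur[x U'x fx].
  by case: xgetP => [z _ //|/(_ x)]; case.
split=> //.
- by split=> //; rewrite /V/= -/(V _); apply: ballxx.
- by move=> x [].
- split.
  + by move=> x [].
  + by move=> y /gP[].
  + move=> x U'x; have [[b1 _] E] := gP (f x) U'x.2.
    by apply: inj => //; exact: U'x.1.
  + by move=> y /gP[].
Qed.

(** The Lipschitz bound on [g] at [y] converts a remainder of [f] small relative to [g z - g y] into
    one small relative to [z - y]. *)
Lemma derive_jacobian_inverse N (U V : set 'rV[R]_N) (f g : 'rV[R]_N -> 'rV[R]_N) (y : 'rV[R]_N)
    (A : 'M[R]_N) (c : R) : open V -> V y -> local_inverse f U V g ->
  differentiable f (g y) -> (forall v, 'D_v f (g y) = v *m A) -> A \in unitmx ->
  (forall z, V z -> `|g z - g y| <= c * `|z - y|) ->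
  differentiable g y /\ forall v, 'D_v g y = v *m invmx A.
Proof.
move=> oV Vy [UV VU gf fg] df DfA uA lip.
have [cA cA0 cAP] := mulmx_norm_bound (invmx A).
have key : g \o shift y = cst (g y) + (mulmxr (invmx A) : {linear _ -> _}) +o_ (0 : 'rV[R]_N) id.
  apply/eqaddoP => e e0.
  have c1 : 0 < `|c| + 1 by rewrite ltr_wpDl.
  (* Chosen so that the two factors met below, [cA] and the absolute value of [c] plus one, multiply
     it back to [e]. *)
  pose e' := e / (cA * (`|c| + 1)).
  have e'0 : 0 < e' by rewrite divr_gt0// mulr_gt0.
  have : \forall h \near (0 : 'rV[R]_N), `|f (h + g y) - f (g y) - h *m A| <= e' * `|h|.
    have := diff_locally df; move/eqaddoP/(_ _ e'0); apply: filterS => h.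
    by rewrite /= !fctE /= -deriveE// DfA opprD addrA.
  move=> /nbhs_ballP[d /= d0 dP].
  near=> k.
  rewrite /= !fctE /= opprD addrA.
  have Vk : V (k + y).
    near: k; have : \forall z \near y, V z by exact: open_nbhs_nbhs.
    by rewrite (near_shift 0 y)/= subr0.
  pose h := g (k + y) - g y.
  have hk : `|h| <= (`|c| + 1) * `|k|.
    apply: le_trans (lip _ Vk) _; rewrite addrK ler_wpM2r//.
    by rewrite (le_trans (ler_norm _))// lerDl.
  have fh : f (h + g y) = k + y by rewrite subrK fg.
  have hd : ball 0 d h.
    rewrite -ball_normE/= sub0r normrN (le_lt_trans hk)// mulrC -ltr_pdivlMr//.
    near: k; apply/nbhs_ballP; exists (d / (`|c| + 1)) => /=; first exact: divr_gt0.
    by move=> k; rewrite -ball_normE/= sub0r normrN.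
  have := dP _ hd; rewrite fh (fg y Vy) addrK => bd.
  rewrite -/h.
  have -> : h - k *m invmx A = - ((k - h *m A) *m invmx A).
    by rewrite mulmxBl mulmxK// opprB.
  rewrite normrN (le_trans (cAP _))//.
  apply: (@le_trans _ _ (cA * (e' * ((`|c| + 1) * `|k|)))).
    rewrite ler_wpM2l//; first exact: ltW.
    by rewrite (le_trans bd)// ler_wpM2l// ltW.
  rewrite le_eqVlt; apply/orP; left; apply/eqP; rewrite /e'.
  by field; rewrite !gt_eqF.
have cl : continuous (mulmxr (invmx A) : {linear 'rV[R]_N -> 'rV[R]_N}).
  exact: linear_rV_continuous.
have dgE := diff_unique cl key.
have dg : differentiable g y.
  by apply/diff_locallyP; rewrite dgE; split.
by split=> // v; rewrite deriveE// dgE.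
Unshelve. all: by end_near. Qed.

Theorem inverse_function N (U : set 'rV[R]_N) (f : 'rV[R]_N -> 'rV[R]_N) (x0 : 'rV[R]_N) :
  open U -> U x0 -> (forall k, Ck_on k U f) -> (forall v, 'D_v f x0 = 0 -> v = 0) ->
  exists (U' V : set 'rV[R]_N) (g : 'rV[R]_N -> 'rV[R]_N),
    [/\ open U', U' x0, U' `<=` U, open V & local_inverse f U' V g /\ forall k, Ck_on k V g].
Proof.
move=> oU Ux0 Cf inj.
have df x : U x -> differentiable f x by case: (Cf 1%N) => + _; exact.
pose J x : 'M[R]_N := \matrix_(i, j) ('D_(delta_mx 0 i) f x) 0 j.
have DJ x v : U x -> 'D_v f x = v *m J x.
  move=> Ux; rewrite derive_rV_sum; last exact: df.
  apply/rowP => j; rewrite summxE mxE; apply: eq_bigr => i _.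
  by rewrite !mxE.
have CJ k : Ck_on k U J.
  apply/Ck_on_coord => // i j; under eq_fun do rewrite mxE.
  by have [_ /(_ (delta_mx 0 i))/Ck_on_coord] := Cf k.+1; exact.
have uJ x : U x -> (forall v, 'D_v f x = 0 -> v = 0) -> J x \in unitmx.
  move=> Ux injx; rewrite unitmxE unitfE; apply/negP => /det0P[v v0 vJ].
  by move/negP: v0; apply; apply/eqP; apply: injx; rewrite DJ.
(* Differentials act on rows from the right; this [K] makes the derivative of [psi] vanish at
   [x0]. *)
pose K := invmx (J x0).
have uK : K \in unitmx by rewrite unitmx_inv; exact: uJ.
pose psi x := x - f x *m K.
have Cpsi k : Ck_on k U psi.
  apply: Ck_onD => //; first by apply: (@Ck_on_linear _ _ _ _ _ idfun) => x; exact: cvg_id.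
  apply: (@Ck_on_linear_comp _ _ _ _ _ _ (-%R)) => //; first exact: opp_continuous.
  apply: (@Ck_on_linear_comp _ _ _ _ _ _ (mulmxr K)) => //; exact: linear_rV_continuous.
have Dpsi x v : U x -> 'D_v psi x = v - 'D_v f x *m K.
  move=> Ux; have cK := @linear_rV_continuous _ _ _ (mulmxr K : {linear 'rV[R]_N -> 'rV[R]_N}).
  rewrite deriveB ?derive_id; last 2 first.
  - exact: derivable_id.
  - apply: diff_derivable.
    by apply: (@differentiable_comp _ _ _ _ f (mulmxr K)); [exact: df|exact: linear_differentiable].
  by rewrite (derive_linear_comp v cK (df _ Ux)).
have D0 v : 'D_v psi x0 = 0.
  by rewrite Dpsi// DJ// /K mulmxK ?subrr//; exact: uJ.
have h0 : (0 : R) < 2^-1 by rewrite invr_gt0.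
have [r r0 [rU lip bd]] := C1_small_lipschitz oU Ux0 (Cpsi 1%N) D0 h0.
have cf x : U x -> {for x, continuous f} by move=> Ux; exact/differentiable_continuous/df.
have [U' [V [g [oU' U'x0 U'r oV fg]]]] := contraction_inverse cf r0 rU uK lip.
have U'U : U' `<=` U by move=> x /U'r/rU.
exists U', V, g; split=> //; split=> //.
have [UV VU gfK fgK] := fg.
(* If ['D_v f x = 0] then ['D_v psi x = v], which the bound [bd], with constant 1/2, allows only for
   [v = 0]. *)
have uJ' x : U' x -> J x \in unitmx.
  move=> U'x; apply: uJ; first exact: U'U.
  move=> v Dv0; have := bd x v (U'r _ U'x); rewrite Dpsi; last exact: U'U.
  rewrite Dv0 mul0mx subr0 => vle; apply/eqP; rewrite -normr_le0.
  by move: vle; move: `|v| => a; lra.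
have [cK cK0 cKP] := mulmx_norm_bound K.
have Dg y : V y -> differentiable g y /\ forall v, 'D_v g y = v *m invmx (J (g y)).
  move=> Vy; have U'g := VU _ Vy; have Ug := U'U _ U'g.
  (* The factor 2 arises because the Lipschitz bound on [psi] leaves half of the distance from [g z]
     to [g y] to be absorbed on the left. *)
  apply: (@derive_jacobian_inverse _ _ _ _ _ _ _ (2 * cK) oV Vy fg) => //.
  - exact: df.
  - by move=> v; exact: DJ.
  - exact: uJ'.
  move=> z Vz; have := lip (g z) (g y) (U'r _ (VU _ Vz)) (U'r _ U'g).
  rewrite /psi !fgK// => l1; have l2 := cKP (z - y).
  have l3 : `|g z - g y| <= `|g z - z *m K - (g y - y *m K)| + `|(z - y) *m K|.
    apply: le_trans (ler_normD _ _); rewrite mulmxBl le_eqVlt; apply/orP; left.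
    apply/eqP; congr (`|_|); move: (g z) (g y) (z *m K) (y *m K) => p q s t.
    by apply/matrixP => a b; rewrite !mxE; ring.
  by move: l1 l2 l3; move: `|_ - _| `|_ - _| `|_ *m _| (`|_|) => a b c d; lra.
(* Bootstrap: the derivative of [g] is given by [invmx (J (g y))], so it is of class C^k as soon as
   [g] is. *)
elim=> [|k IH] /=.
  by move=> y /Dg[dg _]; exact: differentiable_continuous.
split=> [y /Dg[]//|v].
apply: (@Ck_on_eq _ _ _ _ _ (fun y => v *m invmx (J (g y)))) => //.
  by move=> y /Dg[_ ->].
apply: Ck_on_mulmx => //; first exact: Ck_on_cst.
apply: (@Ck_on_comp _ _ _ _ _ V U' g (fun x => invmx (J x))) => //.
apply: Ck_on_invmx => //; exact: Ck_onW U'U (CJ k).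
Qed.

End InverseFunction.

(** * Levels of regular values *)

Section Diffeomorphisms.
Context {R : realType}.
Implicit Types (V W : normedModType R).

Lemma diffeomorphic_refl V (A : set V) : diffeomorphic A A.
Proof.
exists id, id; split; first by split=> //; rewrite image_id.
by split=> x Ax; exists setT, id; split=> //; try exact: openT;
  move=> k; apply: (@Ck_on_linear _ _ _ _ _ idfun) => y; exact: cvg_id.
Qed.

Lemma open_preimage_in V W (U : set V) (U' : set W) (F : V -> W) : open U -> open U' ->
  (forall x, U x -> {for x, continuous F}) -> open (U `&` F @^-1` U').
Proof.
move=> oU oU' cF; rewrite openE => y [Uy U'Fy]; apply: filterI; first exact: open_nbhs_nbhs.
by apply: (cF y Uy); exact: open_nbhs_nbhs.
Qed.

Lemma Ck1_differentiable V W (f : V -> W) x : Ck_on 1 setT f -> differentiable f x.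
Proof. by case=> + _; exact. Qed.

Lemma smooth_on_comp V W m (A : set V) (B : set 'rV[R]_m) (f : V -> 'rV[R]_m)
    (g : 'rV[R]_m -> W) : f @` A `<=` B ->
  smooth_on A f -> smooth_on B g -> smooth_on A (g \o f).
Proof.
move=> fAB sf sg x Ax; have [U [F [oU Ux CF fF]]] := sf x Ax.
have Bfx : B (f x) by apply: fAB; exists x.
have [U' [G [oU' U'fx CG gG]]] := sg _ Bfx.
have oUF := open_preimage_in oU oU' (CF 0%N).
exists (U `&` F @^-1` U'), (G \o F); split.
- exact: oUF.
- by split=> //=; rewrite fF// inE.
- move=> k; apply: (@Ck_on_comp _ _ _ _ _ _ U') => //.
  + by move=> y [].
  + by apply: Ck_onW (CF k) => y [].
- move=> y /set_mem[[Uy U'Fy] Ay] /=; have E : F y = f y by apply: fF; rewrite inE.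
  by rewrite E; apply: gG; rewrite inE; split; [rewrite /= -E|apply: fAB; exists y].
Qed.

Lemma diffeomorphic_trans p m q (A : set 'rV[R]_p) (B : set 'rV[R]_m) (C : set 'rV[R]_q) :
  diffeomorphic A B -> diffeomorphic B C -> diffeomorphic A C.
Proof.
move=> [f [g [[fA gB fK gK] [sf sg]]]] [f' [g' [[fB gC fK' gK'] [sf' sg']]]].
have fAB x : A x -> B (f x) by move=> Ax; apply: fA; exists x.
have gCB x : C x -> B (g' x) by move=> Cx; apply: gC; exists x.
exists (f' \o f), (g \o g'); split; last first.
  by split; [exact: smooth_on_comp sf sf'|exact: smooth_on_comp sg' sg].
split.
- by move=> _ [x Ax <-]; apply: fB; exists (f x) => //; exact: fAB.
- by move=> _ [x Cx <-]; apply: gB; exists (g' x) => //; exact: gCB.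
- by move=> x; rewrite inE => Ax /=; rewrite fK' ?fK// inE//; exact: fAB.
- by move=> x; rewrite inE => Cx /=; rewrite gK ?gK'// inE//; exact: gCB.
Qed.

Section LinearEmbedding.
Context {V : normedModType R} {N : nat}.
Variables (L : {linear 'rV[R]_N -> V}) (L' : {linear V -> 'rV[R]_N}).
Hypotheses (cL' : continuous L') (LK : cancel L L').

(** A local extension off the image is obtained by precomposing with the left inverse [L']. *)
Lemma smooth_on_linear_embedding (W : normedModType R) (A : set 'rV[R]_N) (f : 'rV[R]_N -> W) :
  smooth_on A f -> smooth_on (L @` A) (f \o L').
Proof.
move=> sf _ [x Ax <-]; have [U [F [oU Ux CF fF]]] := sf x Ax.
exists (L' @^-1` U), (F \o L'); split.
- by apply: open_comp => // y _; exact: cL'.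
- by rewrite /= LK.
- by move=> k; exact: Ck_on_comp_linear.
- move=> z /set_mem[/= Uz [y Ay yE]]; rewrite -yE LK in Uz; rewrite /= -yE LK.
  by apply: fF; rewrite inE.
Qed.

Lemma smooth_on_comp_linear (W : normedModType R) (A : set W) (f : W -> 'rV[R]_N) :
  smooth_on A f -> smooth_on A (L \o f).
Proof.
move=> sf x Ax; have [U [F [oU Ux CF fF]]] := sf x Ax.
exists U, (L \o F); split=> //; last by move=> y yU /=; rewrite fF.
move=> k; apply: Ck_on_linear_comp => //; exact: linear_rV_continuous.
Qed.

Lemma diffeomorphic_linear_embedding (A B : set 'rV[R]_N) :
  diffeomorphic A B -> diffeomorphic (L @` A) (L @` B).
Proof.
move=> [f [g [[fA gB fK gK] [sf sg]]]].
exists (L \o (f \o L')), (L \o (g \o L')); split; last first.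
  by split; apply: smooth_on_comp_linear; exact: smooth_on_linear_embedding.
split.
- by move=> _ [_ [x Ax <-] <-] /=; rewrite LK; exists (f x) => //; apply: fA; exists x.
- by move=> _ [_ [x Ax <-] <-] /=; rewrite LK; exists (g x) => //; apply: gB; exists x.
- by move=> _ /set_mem[x Ax <-] /=; rewrite !LK fK// inE.
- by move=> _ /set_mem[x Ax <-] /=; rewrite !LK gK// inE.
Qed.

Lemma smooth_submanifold_linear_embedding m (A : set 'rV[R]_N) :
  smooth_submanifold m A -> smooth_submanifold m (L @` A).
Proof.
move=> sA _ [x Ax <-]; have [U [D [oU Ux oD [f [g [[fA gD fK gK] [sf sg]]]]]]] := sA x Ax.
have E : (L @` A) `&` L' @^-1` U = L @` (A `&` U).
  apply/seteqP; split=> z; first by move=> [[y Ay <-]]; rewrite /= LK => Uy; exists y.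
  by move=> [y [Ay Uy] <-]; split; [exists y|rewrite /= LK].
exists (L' @^-1` U), D; split=> //; first by apply: open_comp => // y _; exact: cL'.
  by rewrite /= LK.
rewrite E; exists (f \o L'), (L \o g); split; last first.
  by split; [exact: smooth_on_linear_embedding|exact: smooth_on_comp_linear].
split.
- by move=> _ [_ [y Ay <-] <-] /=; rewrite LK; apply: fA; exists y.
- by move=> _ [y Dy <-] /=; exists (g y) => //; apply: gD; exists y.
- by move=> _ /set_mem[y Ay <-] /=; rewrite !LK fK// inE.
- by move=> y yD /=; rewrite !LK gK.
Qed.

End LinearEmbedding.
End Diffeomorphisms.

(** * Charts of a regular level and comparison of nearby levels *)

Section LevelSets.
Context {R : realType} {N n : nat}.
Variable F : 'rV[R]_N -> 'rV[R]_n.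
Hypothesis CF : forall k, Ck_on k setT F.
Implicit Types (x v : 'rV[R]_N) (c b : 'rV[R]_n).

(** Rows are partial derivatives: the differential acts on row vectors from the right, and
    [row_full] says that it is onto. *)
Definition jacobian_mx x : 'M[R]_(N, n) := \matrix_(i, j) ('D_(delta_mx 0 i) F x) 0 j.

Lemma smooth_differentiable x : differentiable F x.
Proof. exact: Ck1_differentiable (CF 1). Qed.

Lemma jacobian_mxE x v : 'D_v F x = v *m jacobian_mx x.
Proof.
rewrite derive_rV_sum; last exact: smooth_differentiable.
by apply/rowP => j; rewrite summxE mxE; apply: eq_bigr => i _; rewrite !mxE.
Qed.

Lemma Ck_on_jacobian_mx k : Ck_on k setT jacobian_mx.
Proof.
apply/Ck_on_coord => [|i j]; first exact: openT.
under eq_fun do rewrite mxE.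
by have [_ /(_ (delta_mx 0 i))/Ck_on_coord] := CF k.+1; apply; exact: openT.
Qed.

Lemma row_norm_eq0 m (u : 'rV[R]_m) : u *m u^T = 0 -> u = 0.
Proof.
move=> /(congr1 (fun M : 'M[R]_1 => M 0 0)); rewrite !mxE => /psumr_eq0P u0.
have u1 (i : 'I_m) : true -> 0 <= u 0 i * u^T i 0 by move=> _; rewrite mxE -expr2 sqr_ge0.
by apply/rowP => i; have /eqP := u0 u1 i isT; rewrite !mxE mulf_eq0 orbb => /eqP.
Qed.

(** The Gram matrix of the gradients is invertible at a regular point; this is what makes normal
    components vanish below. *)
Lemma gram_row_eq0 x b : row_full (jacobian_mx x) -> b *m (jacobian_mx x)^T *m jacobian_mx x = 0 -> b = 0.
Proof.
move=> fJ bJ; have : b *m (jacobian_mx x)^T = 0.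
  by apply: row_norm_eq0; rewrite trmx_mul trmxK mulmxA bJ mul0mx.
move/eqP; rewrite mulmx_free_eq0; first by move/eqP.
by rewrite /row_free mxrank_tr; move: fJ; rewrite /row_full.
Qed.

Lemma derive_comp_affine (V W : normedModType R) (M : normedModType R) (f : V -> W)
    (L : {linear W -> M}) (a : M) (x v : V) :
  continuous L -> differentiable f x -> 'D_v (fun y => L (f y) - a) x = L ('D_v f x).
Proof.
move=> cL df; have dLf : differentiable (L \o f) x.
  by apply: differentiable_comp => //; exact: linear_differentiable.
rewrite deriveB; last 2 first.
- exact: diff_derivable.
- exact: derivable_cst.
by rewrite derive_cst subr0 -(derive_linear_comp v cL df).
Qed.

Lemma mulmxr_continuous m p (A : 'M[R]_(m, p)) : continuous (mulmxr A : 'rV[R]_m -> 'rV[R]_p).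
Proof. exact: linear_rV_continuous. Qed.

Theorem regular_level_chart m x0 : row_full (jacobian_mx x0) -> N = (m + n)%N ->
  exists (U : set 'rV[R]_N) (D : set 'rV[R]_m), [/\ open U, U x0, open D &
    diffeomorphic ([set x | F x = F x0] `&` U) D].
Proof.
move=> fJ Nmn; set J := jacobian_mx x0.
(* The rows of [K] are a basis of the tangent space of the level, the kernel of [J]. *)
have [K [fK KJ kJ]] : exists K : 'M[R]_(m, N), [/\ row_free K, K *m J = 0 &
    forall v, v *m J = 0 -> exists u, v = u *m K].
  have Em : \rank (kermx J) = m.
    by rewrite mxrank_ker; move: fJ; rewrite /row_full => /eqP ->; rewrite Nmn addnK.
  move: Em (row_base (kermx J)) (eq_row_base (kermx J)) (row_base_free (kermx J)) => <- K EK fK.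
  exists K; split=> //; first by apply/sub_kermxP; rewrite EK.
  move=> v /sub_kermxP; rewrite -EK => /submxP[u ->]; by exists u.
have KKinj (u : 'rV[R]_m) : u *m (K *m K^T) = 0 -> u = 0.
  move=> uK; have : u *m K = 0.
    by apply: row_norm_eq0; rewrite trmx_mul mulmxA -(mulmxA u) uK mul0mx.
  by move/eqP; rewrite mulmx_free_eq0// => /eqP.
have JK : J^T *m K^T = 0 by rewrite -trmx_mul KJ trmx0.
pose f x : 'rV[R]_m := (x - x0) *m K^T.
(* Tangential part along [K] plus displacement along the gradients: [Psi] straightens the level of
   [x0] to the row space of [K], and [f] is the chart. *)
pose Psi x : 'rV[R]_N := f x *m K + (F x - F x0) *m J^T.
have Cf k : Ck_on k setT f.
  apply: (@Ck_on_linear_comp _ _ _ _ _ _ (mulmxr K^T)); [exact: openT|exact: mulmxr_continuous|].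
  apply: Ck_onD; [exact: openT| |exact: Ck_on_cst].
  by apply: (@Ck_on_linear _ _ _ _ _ idfun) => x; exact: cvg_id.
have CPsi k : Ck_on k setT Psi.
  apply: Ck_onD; first exact: openT.
    by apply: (@Ck_on_linear_comp _ _ _ _ _ _ (mulmxr K)); [exact: openT|exact: mulmxr_continuous|].
  apply: (@Ck_on_linear_comp _ _ _ _ _ _ (mulmxr J^T)); [exact: openT|exact: mulmxr_continuous|].
  by apply: Ck_onD; [exact: openT| |exact: Ck_on_cst].
have DPsi v : 'D_v Psi x0 = v *m K^T *m K + v *m J *m J^T.
  have E : Psi = (fun x => mulmxr (K^T *m K) x - x0 *m K^T *m K) +
      (fun x => mulmxr J^T (F x) - F x0 *m J^T).
    apply/funext => x; rewrite /Psi /f fctE /= !mulmxBl !mulmxA.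
    by [].
  have dF := smooth_differentiable x0.
  have d1 : differentiable (fun x => mulmxr (K^T *m K) x - x0 *m K^T *m K) x0.
    apply: differentiableB => //; apply: linear_differentiable; exact: mulmxr_continuous.
  have d2 : differentiable (fun x => mulmxr J^T (F x) - F x0 *m J^T) x0.
    apply: differentiableB => //; apply: (@differentiable_comp _ _ _ _ F (mulmxr J^T)) => //.
    by apply: linear_differentiable; exact: mulmxr_continuous.
  rewrite E deriveD; [|exact: diff_derivable|exact: diff_derivable].
  rewrite (@derive_comp_affine _ _ _ F (mulmxr J^T))//; last exact: mulmxr_continuous.
  rewrite (@derive_comp_affine _ _ _ id (mulmxr (K^T *m K)))//; last exact: mulmxr_continuous.
  by rewrite derive_id /= jacobian_mxE !mulmxA.
have injPsi v : 'D_v Psi x0 = 0 -> v = 0.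
  rewrite DPsi => E.
  have /(congr1 (mulmxr J)) := E; rewrite /= mul0mx mulmxDl -2!mulmxA KJ !mulmx0 add0r.
  move=> /(gram_row_eq0 fJ) vJ; have [u vu] := kJ _ vJ.
  have /(congr1 (mulmxr K^T)) := E; rewrite /= mul0mx mulmxDl vJ !mul0mx addr0.
  rewrite vu => /eqP; rewrite -!mulmxA (mulmxA K) mulmxA => /eqP/KKinj uKK.
  by rewrite (KKinj u)// mul0mx.
have [U [V [g [oU Ux0 _ oV [[UV VU gK gK'] Cg]]]]] := inverse_function openT I CPsi injPsi.
have cK : continuous (mulmxr K : 'rV[R]_m -> 'rV[R]_N) by exact: mulmxr_continuous.
exists U, (mulmxr K @^-1` V); split=> //; first by apply: open_comp => // y _; exact: cK.
exists f, (g \o mulmxr K); split; last first.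
  split=> x Ax.
    by exists setT, f; split=> //; exact: openT.
  exists (mulmxr K @^-1` V), (g \o mulmxr K); split=> //.
    by apply: open_comp => // y _; exact: cK.
  by move=> k; exact: Ck_on_comp_linear.
(* Multiplication by [J] kills the tangential part of [Psi] and leaves [(F x - F x0) *m J^T *m J];
   hence points sent into the row space of [K] lie on the level. *)
have gF (u : 'rV[R]_m) : V (u *m K) -> F (g (u *m K)) = F x0 /\ f (g (u *m K)) = u.
  move=> Vu; have E := gK' _ Vu.
  have FE : F (g (u *m K)) = F x0.
    apply/eqP; rewrite -subr_eq0; apply/eqP/(gram_row_eq0 fJ).
    have /(congr1 (mulmxr J)) := E; rewrite /= /Psi mulmxDl -!mulmxA KJ !mulmx0 add0r mulmxA.
    by [].
  split=> //; move: E; rewrite /Psi FE subrr mul0mx addr0 => /eqP.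
  by rewrite -subr_eq0 -mulmxBl mulmx_free_eq0// subr_eq0 => /eqP.
split.
- move=> _ [x [Fx Ux] <-] /=; have := UV _ Ux.
  by rewrite /Psi Fx subrr mul0mx addr0.
- by move=> _ [u Vu <-]; split=> /=; [have [] := gF _ Vu|exact: VU].
- move=> x /set_mem[Fx Ux] /=; rewrite -[RHS]gK//; congr (g _).
  by rewrite /Psi Fx subrr mul0mx addr0.
- by move=> u /set_mem Vu; have [] := gF _ Vu.
Qed.

(** The normal space of a level is spanned by the gradients: [lsubmx z] is a point and [rsubmx z]
    holds the coefficients of a normal vector there. *)
Definition normal_shift (z : 'rV[R]_(N + n)) : 'rV[R]_N :=
  rsubmx z *m (jacobian_mx (lsubmx z))^T.

(* The two ends of the segment centred at [lsubmx z] and normal to the level of [lsubmx z],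
   the second one through its value: reversing the segment exchanges the roles of two levels. *)
Definition segment_ends (z : 'rV[R]_(N + n)) : 'rV[R]_(N + n) :=
  row_mx (lsubmx z - normal_shift z) (F (lsubmx z + normal_shift z)).

Lemma Ck_on_lsubmx k : Ck_on k setT (lsubmx : 'rV[R]_(N + n) -> 'rV[R]_N).
Proof. by apply: Ck_on_linear; exact: linear_rV_continuous. Qed.

Lemma Ck_on_rsubmx k : Ck_on k setT (rsubmx : 'rV[R]_(N + n) -> 'rV[R]_n).
Proof. by apply: Ck_on_linear; exact: linear_rV_continuous. Qed.

Lemma Ck_on_normal_shift k : Ck_on k setT normal_shift.
Proof.
apply: Ck_on_mulmx; [exact: openT|exact: Ck_on_rsubmx|].
have CJ : Ck_on k setT (fun z : 'rV[R]_(N + n) => jacobian_mx (lsubmx z)).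
  by apply: (Ck_on_comp openT _ (Ck_on_lsubmx k) (Ck_on_jacobian_mx k)).
apply/Ck_on_coord => [|i j]; first exact: openT.
under eq_fun do rewrite mxE.
by move/Ck_on_coord : CJ; apply; exact: openT.
Qed.

Lemma Ck_on_segment_sum k : Ck_on k setT (fun z => F (lsubmx z + normal_shift z)).
Proof.
apply: (Ck_on_comp openT _ _ (CF k)) => //.
by apply: Ck_onD; [exact: openT|exact: Ck_on_lsubmx|exact: Ck_on_normal_shift].
Qed.

Lemma Ck_on_segment_diff k : Ck_on k setT (fun z => lsubmx z - normal_shift z).
Proof.
apply: Ck_onD; [exact: openT|exact: Ck_on_lsubmx|].
apply: (@Ck_on_linear_comp _ _ _ _ _ _ (-%R)); [exact: openT|exact: opp_continuous|].
exact: Ck_on_normal_shift.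
Qed.

Lemma segment_endsE : segment_ends = (fun z => mulmxr (row_mx 1%:M 0) (lsubmx z - normal_shift z)) +
  (fun z => mulmxr (row_mx 0 1%:M) (F (lsubmx z + normal_shift z))).
Proof.
apply/funext => z; rewrite fctE /segment_ends /= !mul_mx_row !mulmx0 !mulmx1.
by rewrite add_row_mx addr0 add0r.
Qed.

Lemma Ck_on_segment_ends k : Ck_on k setT segment_ends.
Proof.
rewrite segment_endsE; apply: Ck_onD; first exact: openT.
  by apply: Ck_on_linear_comp; [exact: openT|exact: mulmxr_continuous|exact: Ck_on_segment_diff].
by apply: Ck_on_linear_comp; [exact: openT|exact: mulmxr_continuous|exact: Ck_on_segment_sum].
Qed.

(** At zero normal coefficients the variation of the Jacobian contributes nothing. *)
Lemma derive_normal_shift x w :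
  'D_w normal_shift (row_mx x 0) = rsubmx w *m (jacobian_mx x)^T.
Proof.
set z0 : 'rV[R]_(N + n) := row_mx x 0.
pose f k (z : 'rV[R]_(N + n)) : R^o := rsubmx z 0 k.
pose g k (z : 'rV[R]_(N + n)) : 'rV[R]_N := row k (jacobian_mx (lsubmx z))^T.
have E : normal_shift = \sum_(k < n) (fun z => f k z *: g k z).
  by apply/funext => z; rewrite fct_sumE /normal_shift mulmx_sum_row.
have cr : continuous (rsubmx : 'rV[R]_(N + n) -> 'rV[R]_n) by exact: linear_rV_continuous.
have df k : differentiable (f k) z0.
  have := Ck_on_rsubmx 1; move/Ck_on_coord => /(_ openT 0 k)[+ _]; exact.
have dg k : differentiable (g k) z0.
  have CJ : Ck_on 1 setT (fun z : 'rV[R]_(N + n) => jacobian_mx (lsubmx z)).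
    by apply: (Ck_on_comp openT _ (Ck_on_lsubmx 1) (Ck_on_jacobian_mx 1)).
  suff : Ck_on 1 setT (g k) by case=> + _; exact.
  apply/Ck_on_coord => [|i j]; first exact: openT.
  under eq_fun do rewrite mxE mxE.
  by move/Ck_on_coord : CJ; apply; exact: openT.
have dfg k : is_diff z0 (fun z => f k z *: g k z) _ := is_diff_scale (df k) (dg k).
rewrite E derive_sum; last by move=> k; apply: diff_derivable; have [] := dfg k.
rewrite mulmx_sum_row; apply: eq_bigr => k _.
rewrite deriveE; last by have [] := dfg k.
rewrite diff_val /= {1}/f row_mxKr mxE scale0r add0r /g row_mxKl.
congr (_ *: _); rewrite -deriveE//.
have -> : f k = (fun z => mx_coord 0 k (rsubmx z)) by [].
rewrite derive_linear_comp; last 2 first.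
- exact: linear_rV_continuous.
- exact: Ck1_differentiable (Ck_on_rsubmx 1).
by rewrite linear_derive.
Qed.

(** For a kernel vector the first end gives [lsubmx v = q], the normal vector with coefficients
    [rsubmx v]. The second end then says that the differential annihilates [2 q], and the Gram
    matrix forces [rsubmx v = 0]. *)
Lemma segment_ends_regular x (v : 'rV[R]_(N + n)) : row_full (jacobian_mx x) ->
  'D_v segment_ends (row_mx x 0) = 0 -> v = 0.
Proof.
move=> fJ; set z0 : 'rV[R]_(N + n) := row_mx x 0.
have dl : differentiable (lsubmx : 'rV[R]_(N + n) -> 'rV[R]_N) z0.
  exact: Ck1_differentiable (Ck_on_lsubmx 1).
have dq : differentiable normal_shift z0 by exact: Ck1_differentiable (Ck_on_normal_shift 1).
have dd : differentiable (fun z => lsubmx z - normal_shift z) z0.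
  exact: Ck1_differentiable (Ck_on_segment_diff 1).
have ds : differentiable (fun z => F (lsubmx z + normal_shift z)) z0.
  exact: Ck1_differentiable (Ck_on_segment_sum 1).
have q0 : normal_shift z0 = 0 by rewrite /normal_shift row_mxKr mul0mx.
have Dl w : 'D_w (lsubmx : 'rV[R]_(N + n) -> 'rV[R]_N) z0 = lsubmx w.
  by rewrite linear_derive//; exact: linear_rV_continuous.
have Dd : 'D_v (fun z => lsubmx z - normal_shift z) z0 = lsubmx v - rsubmx v *m (jacobian_mx x)^T.
  have -> : (fun z => lsubmx z - normal_shift z) = lsubmx - normal_shift by [].
  rewrite deriveB; [|exact: diff_derivable|exact: diff_derivable].
  by rewrite Dl derive_normal_shift.
have Ds : 'D_v (fun z => F (lsubmx z + normal_shift z)) z0 =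
    (lsubmx v + rsubmx v *m (jacobian_mx x)^T) *m jacobian_mx x.
  have dlq : differentiable (fun z => lsubmx z + normal_shift z) z0 by exact: differentiableD.
  rewrite (derive_comp v dlq (smooth_differentiable _)) q0 addr0 row_mxKl jacobian_mxE.
  have -> : (fun z => lsubmx z + normal_shift z) = lsubmx + normal_shift by [].
  rewrite deriveD; [|exact: diff_derivable|exact: diff_derivable].
  by rewrite Dl derive_normal_shift.
have dL (A : 'M[R]_(N, N + n)) : differentiable (fun z => mulmxr A (lsubmx z - normal_shift z)) z0.
  apply: (@differentiable_comp _ _ _ _ (fun z => lsubmx z - normal_shift z) (mulmxr A)) => //.
  by apply: linear_differentiable; exact: mulmxr_continuous.
have dR (A : 'M[R]_(n, N + n)) : differentiable (fun z => mulmxr A (F (lsubmx z + normal_shift z))) z0.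
  apply: (@differentiable_comp _ _ _ _ (fun z => F (lsubmx z + normal_shift z)) (mulmxr A)) => //.
  by apply: linear_differentiable; exact: mulmxr_continuous.
rewrite segment_endsE deriveD; [|exact: diff_derivable|exact: diff_derivable].
rewrite (derive_linear_comp v _ dd); last exact: mulmxr_continuous.
rewrite (derive_linear_comp v _ ds); last exact: mulmxr_continuous.
rewrite Dd Ds /= !mul_mx_row !mulmx0 !mulmx1 add_row_mx addr0 add0r => E.
have /(congr1 lsubmx) := E; rewrite row_mxKl linear0 => /eqP.
rewrite subr_eq0 => /eqP lE.
have /(congr1 rsubmx) := E; rewrite row_mxKr linear0 lE -mulr2n -scaler_nat -scalemxAl => /eqP.
rewrite scaler_eq0 pnatr_eq0 /= => /eqP/(gram_row_eq0 fJ) r0.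
by rewrite -[v]hsubmxK lE r0 mul0mx row_mx0.
Qed.

Definition in_tube (x : 'rV[R]_N) (d : R) (z : 'rV[R]_(N + n)) :=
  `|lsubmx z - x| < d /\ `|rsubmx z| < d.

Lemma row_mx_norm_lt m p (a : 'rV[R]_m) (b : 'rV[R]_p) (e : R) :
  `|row_mx a b| < e <-> `|a| < e /\ `|b| < e.
Proof.
split=> [lt|[la lb]].
  have e0 : 0 <= `|row_mx a b| by [].
  split; apply: le_lt_trans lt; apply: rV_norm_le => // i j.
    by have := rV_norm_coord (row_mx a b) i (lshift p j); rewrite row_mxEl.
  by have := rV_norm_coord (row_mx a b) i (rshift m j); rewrite row_mxEr.
apply: (@le_lt_trans _ _ (Num.max `|a| `|b|)); last by rewrite gt_max la lb.
apply: rV_norm_le => [|i j]; first by rewrite le_max normr_ge0.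
case: (split_ordP j) => k ->; rewrite ?row_mxEl ?row_mxEr le_max rV_norm_coord ?orbT//.
Qed.

Lemma in_tubeP x d z : in_tube x d z <-> ball (row_mx x 0) d z.
Proof.
rewrite -ball_normE /ball_ /= -[z in `|_ - z|]hsubmxK opp_row_mx add_row_mx sub0r.
by rewrite row_mx_norm_lt normrN distrC.
Qed.

Lemma segment_ends_local x : row_full (jacobian_mx x) -> exists U V g,
  [/\ open U, U (row_mx x 0), open V, local_inverse segment_ends U V g & forall k, Ck_on k V g].
Proof.
move=> fJ.
have [U [V [g [oU Ux _ oV [lg Cg]]]]] :=
  @inverse_function R (N + n) setT segment_ends (row_mx x 0) openT I Ck_on_segment_ends
    (fun v : 'rV[R]_(N + n) => segment_ends_regular fJ).
by exists U, V, g.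
Qed.

Section RegularCompact.
Variable W : set 'rV[R]_N.
Hypotheses (cW : compact W) (fW : forall x, W x -> row_full (jacobian_mx x)).

(** Each [row_mx x 0] has a neighbourhood on which the ends determine the segment; compactness of
    [W] makes its radius uniform. *)
Lemma segment_ends_unique : exists2 d : R, 0 < d & forall x, W x -> forall z1 z2,
  in_tube x d z1 -> in_tube x d z2 -> segment_ends z1 = segment_ends z2 -> z1 = z2.
Proof.
pose P (d : R) x := forall z1 z2, in_tube x d z1 -> in_tube x d z2 ->
  segment_ends z1 = segment_ends z2 -> z1 = z2.
suff : \forall d \near (0 : R)^'+, W `<=` P d.
  move=> H; have [d [d0 dP]] := filter_ex (filterI (nbhs_right_gt (0 : R)) H).
  by exists d.
move/compact_near_coveringP : cW; apply => x /fW fJ.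
have [U [V [g [oU Ux oV [UV VU gK gK'] _]]]] := segment_ends_local fJ.
have /nbhs_ballP[r /= r0 rU] : nbhs (row_mx x 0) U by exact: open_nbhs_nbhs.
have r20 : 0 < r / 2 by rewrite divr_gt0.
exists ([set x' | `|x - x'| < r / 2], [set d | d < r / 2]).
  split; first by apply/nbhs_ballP; exists (r / 2) => // y; rewrite -ball_normE.
  exact: nbhs_right_lt.
move=> [x' d] /= [xx' dr] z1 z2 z1t z2t E.
have inU z : in_tube x' d z -> U z.
  move=> [l1 l2]; apply: rU; apply/in_tubeP; split; last by move: l2 dr; move: `|_| => a; lra.
  have := ler_normD (lsubmx z - x') (x' - x); rewrite addrA subrK [`|x' - x|]distrC.
  by move: l1 xx' dr; move: `|_| `|_| `|_| => a b c; lra.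
have E1 := gK z1 (inU _ z1t); have E2 := gK z2 (inU _ z2t).
by rewrite -E1 E; exact: E2.
Qed.

(** The local inverses give segments that depend smoothly on their ends and stay in a prescribed
    tube, with a tolerance on the target value uniform over [W]. *)
Lemma segment_ends_exists (d : R) : 0 < d -> exists2 e : R, 0 < e & forall x, W x -> forall mu,
  `|mu - F x| < e -> exists V g, [/\ open V, V (row_mx x mu), forall k, Ck_on k V g &
    forall y, V y -> segment_ends (g y) = y /\ in_tube x d (g y)].
Proof.
move=> d0; pose P (e : R) x := forall mu, `|mu - F x| < e ->
  exists V g, [/\ open V, V (row_mx x mu), forall k, Ck_on k V g &
    forall y, V y -> segment_ends (g y) = y /\ in_tube x d (g y)].
suff : \forall e \near (0 : R)^'+, W `<=` P e.
  move=> H; have [e [e0 eP]] := filter_ex (filterI (nbhs_right_gt (0 : R)) H).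
  by exists e.
move/compact_near_coveringP : cW; apply => x /fW fJ.
have [U [V [g [oU Ux oV [UV VU gK gK'] Cg]]]] := segment_ends_local fJ.
have d20 : 0 < d / 2 by rewrite divr_gt0.
have oV1 := open_preimage_in oV (ball_open (row_mx x (0 : 'rV[R]_n)) (d / 2)) (Cg 0%N).
have E0 : segment_ends (row_mx x 0) = row_mx x (F x).
  by rewrite /segment_ends /normal_shift row_mxKr mul0mx row_mxKl subr0 addr0.
have V1x : (V `&` g @^-1` ball (row_mx x 0) (d / 2)) (row_mx x (F x)).
  rewrite -E0; split; first exact: UV.
  by rewrite /= gK//; exact: ballxx.
have /nbhs_ballP[r /= r0 rV] := open_nbhs_nbhs (conj oV1 V1x).
have r20 : 0 < r / 2 by rewrite divr_gt0.
have m0 : 0 < Num.min r (d / 2) by rewrite lt_min r0.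
exists ([set x' | `|x - x'| < Num.min r (d / 2) /\ `|F x - F x'| < r / 2], [set e | e < r / 2]).
  split; last exact: nbhs_right_lt.
  apply: filterI; first by apply/nbhs_ballP; exists (Num.min r (d / 2)) => // y; rewrite -ball_normE.
  by have /cvgrPdist_lt := differentiable_continuous (smooth_differentiable x); apply.
move=> [x' e] /= [[xx' FF'] er] mu mue.
have xr : `|x - x'| < r by move: xx'; rewrite lt_min => /andP[].
have xd : `|x - x'| < d / 2 by move: xx'; rewrite lt_min => /andP[].
exists (V `&` g @^-1` ball (row_mx x 0) (d / 2)), g; split=> //.
- apply: rV; rewrite -ball_normE /ball_ /= opp_row_mx add_row_mx; apply/row_mx_norm_lt; split=> //.
  have := ler_normD (F x - F x') (F x' - mu); rewrite addrA subrK [`|F x' - mu|]distrC.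
  by move: FF' er mue; move: `|_| `|_| `|_| => a b c; lra.
- by move=> k; apply: Ck_onW (Cg k) => y [].
move=> y [Vy /in_tubeP[l1 l2]]; split; first exact: gK'.
split; last by move: l2; move: `|_| => a; lra.
have := ler_normD (lsubmx (g y) - x) (x - x'); rewrite addrA subrK.
by move: l1 xd; move: `|_| `|_| `|_| => a b c; lra.
Qed.

Lemma nearby_levels_diffeomorphic : exists2 e : R, 0 < e & forall c b,
  F @^-1` [set c] `<=` W -> F @^-1` [set b] `<=` W -> `|c - b| < e ->
  diffeomorphic (F @^-1` [set c]) (F @^-1` [set b]).
Proof.
have [d d0 duniq] := segment_ends_unique.
have d20 : 0 < d / 2 by rewrite divr_gt0.
(* A solution in a tube of radius [d / 2] lies in the tube of radius [d] around every point at
   distance below [d / 2], where uniqueness holds; this glues local solutions into a smooth map. *)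
have [e e0 eP] := segment_ends_exists d20.
exists e => //.
have shift_map c b : F @^-1` [set c] `<=` W -> `|c - b| < e -> exists f : 'rV[R]_N -> 'rV[R]_N,
    (forall x, F x = c -> exists z, [/\ in_tube x d z, segment_ends z = row_mx x b &
       f x = lsubmx z + normal_shift z]) /\ smooth_on (F @^-1` [set c]) f.
  move=> cW' cb.
  have loc x : F x = c -> exists V g, [/\ open V, V (row_mx x b), forall k, Ck_on k V g &
      forall y, V y -> segment_ends (g y) = y /\ in_tube x (d / 2) (g y)].
    by move=> Fx; apply: eP; [exact: cW'|rewrite Fx distrC].
  have /choice[h hP] : forall x, exists z, F x = c -> in_tube x d z /\ segment_ends z = row_mx x b.
    move=> x; have [Fx|nFx] := pselect (F x = c); last by exists 0.
    have [V [g [_ Vx _ /(_ _ Vx)[gE [t1 t2]]]]] := loc _ Fx.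
    exists (g (row_mx x b)) => _; split=> //.
    by split; [move: t1|move: t2]; move: `|_| => a; lra.
  exists (fun x => lsubmx (h x) + normal_shift (h x)); split.
    by move=> x Fx; have [h1 h2] := hP _ Fx; exists (h x).
  move=> x Fx; have [V [g [oV Vx Cg gP]]] := loc _ Fx.
  pose iota (x' : 'rV[R]_N) : 'rV[R]_(N + n) := row_mx x' b.
  have Ciota k : Ck_on k setT iota.
    have -> : iota = (fun x' => mulmxr (row_mx 1%:M 0) x' + row_mx 0 b).
      by apply/funext => x'; rewrite /= mul_mx_row mulmx1 mulmx0 add_row_mx addr0 add0r.
    apply: Ck_onD; [exact: openT| |exact: Ck_on_cst].
    by apply: Ck_on_linear; exact: mulmxr_continuous.
  have oVi : open (iota @^-1` V) by apply: open_comp => // y _; exact: (Ciota 0%N).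
  exists (ball x (d / 2) `&` iota @^-1` V), (fun x' => lsubmx (g (iota x')) + normal_shift (g (iota x'))).
  have oB : open (ball x (d / 2) `&` iota @^-1` V) by apply: openI => //; exact: ball_open.
  split; [exact: oB|by split; [exact: ballxx|exact: Vx]|move=> k|].
    have Cgi : Ck_on k (ball x (d / 2) `&` iota @^-1` V) (fun x' => g (iota x')).
      by apply: (@Ck_on_comp _ _ _ _ _ _ V iota g) => //; [move=> y []|exact: Ck_onW (Ciota k)].
    apply: (@Ck_on_comp _ _ _ _ _ _ setT (fun x' => g (iota x'))
      (fun z => lsubmx z + normal_shift z)) => //.
    by apply: Ck_onD; [exact: openT|exact: Ck_on_lsubmx|exact: Ck_on_normal_shift].
  move=> x' /set_mem[[Bx' Vx'] Fx'] /=; have [h1 h2] := hP _ Fx'.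
  have [gE [t1 t2]] := gP _ Vx'.
  suff -> : g (iota x') = h x' by [].
  apply: (duniq x' (cW' _ Fx') _ _ _ h1); last by rewrite gE h2.
  split; last by move: t2; move: `|_| => a; lra.
  move: Bx'; rewrite -ball_normE /ball_ /= => Bx'.
  have := ler_normD (lsubmx (g (iota x')) - x) (x - x'); rewrite addrA subrK.
  by move: t1 Bx'; move: `|_| `|_| `|_| => a1 a2 a3; lra.
move=> c b cW' bW cb.
have [f [fP sf]] := shift_map _ _ cW' cb.
have bc : `|b - c| < e by rewrite distrC.
have [f' [f'P sf']] := shift_map _ _ bW bc.
have shift_in c1 b1 (f1 : 'rV[R]_N -> 'rV[R]_N) : (forall x, F x = c1 ->
    exists z, [/\ in_tube x d z, segment_ends z = row_mx x b1 & f1 x = lsubmx z + normal_shift z]) ->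
    forall x, F x = c1 -> F (f1 x) = b1.
  by move=> f1P x /f1P[z [_ + ->]] => /eq_row_mx[].
have shiftK c1 b1 (f1 f2 : 'rV[R]_N -> 'rV[R]_N) : F @^-1` [set b1] `<=` W -> (forall x, F x = c1 ->
    exists z, [/\ in_tube x d z, segment_ends z = row_mx x b1 & f1 x = lsubmx z + normal_shift z]) ->
    (forall x, F x = b1 ->
    exists z, [/\ in_tube x d z, segment_ends z = row_mx x c1 & f2 x = lsubmx z + normal_shift z]) ->
    forall x, F x = c1 -> f2 (f1 x) = x.
  move=> b1W f1P f2P x Fx; have Ff := shift_in _ _ _ f1P x Fx.
  have [z [[t1 t2] /eq_row_mx[zx zb] fE]] := f1P _ Fx.
  have [z' [t' z'E ->]] := f2P _ Ff.
  (* The same segment run backwards. Its midpoint is equidistant from both ends, so it also lies in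
     the tube around [f1 x]. *)
  pose z2 : 'rV[R]_(N + n) := row_mx (lsubmx z) (- rsubmx z).
  have qz2 : normal_shift z2 = - normal_shift z.
    by rewrite /normal_shift row_mxKl row_mxKr mulNmx.
  have z2E : segment_ends z2 = row_mx (f1 x) c1.
    by rewrite /segment_ends qz2 row_mxKl opprK -fE zx Fx.
  have -> : z' = z2.
    apply: (duniq (f1 x) (b1W _ Ff) _ _ t'); last by rewrite z'E.
    rewrite /in_tube row_mxKl row_mxKr normrN; split=> //.
    rewrite fE opprD addrA subrr sub0r normrN.
    by move: t1; rewrite -zx opprB addrC subrK.
  by rewrite qz2 row_mxKl zx.
exists f, f'; split=> //; split.
- by move=> _ [x Fx <-]; exact: shift_in fP x Fx.
- by move=> _ [x Fx <-]; exact: shift_in f'P x Fx.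
- by move=> x /set_mem Fx; exact: (shiftK _ _ f f' bW fP f'P).
- by move=> x /set_mem Fx; exact: (shiftK _ _ f' f cW' f'P fP).
Qed.

End RegularCompact.

(** The levels along the path form a compact set, which gives one tolerance [e]; uniform continuity
    of [gamma] gives a subdivision whose consecutive values are within it. *)
Theorem level_path_diffeomorphic (gamma : R -> 'rV[R]_n) (B : R) : continuous gamma ->
  (forall t x, 0 <= t <= 1 -> F x = gamma t -> `|x| <= B /\ row_full (jacobian_mx x)) ->
  diffeomorphic (F @^-1` [set gamma 0]) (F @^-1` [set gamma 1]).
Proof.
move=> cg gP; pose W := [set x | exists2 t, 0 <= t <= 1 & F x = gamma t].
have cI : compact `[(0 : R), 1] by exact: segment_compact.
have cW : compact W.
  apply: bounded_closed_compact.
    exists B; split; first exact: num_real.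
    by move=> M BM x [t t01 /(gP t x t01)[xB _]]; exact: le_trans xB (ltW BM).
  rewrite (_ : W = F @^-1` (gamma @` `[0, 1])).
    apply: closed_comp; first by move=> x _; exact: differentiable_continuous (smooth_differentiable x).
    apply: compact_closed; first exact: norm_hausdorff.
    by apply: continuous_compact => //; apply: continuous_subspaceT.
  apply/seteqP; split=> x [t t01 tE]; exists t => //; by move: t01; rewrite /= in_itv /=.
have fW x : W x -> row_full (jacobian_mx x) by move=> [t t01 /(gP t x t01)[]].
have [e e0 eP] := nearby_levels_diffeomorphic cW fW.
have unif : exists2 d : R, 0 < d & forall t s, 0 <= t <= 1 -> `|s - t| < d -> `|gamma t - gamma s| < e.
  pose P (d : R) (t : R) := forall s, `|s - t| < d -> `|gamma t - gamma s| < e.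
  have H : \forall d \near (0 : R)^'+, `[0, 1]%classic `<=` P d.
    move/compact_near_coveringP : cI; apply => t _.
    have e20 : 0 < e / 2 by rewrite divr_gt0.
    have /cvgrPdist_lt/(_ _ e20)/nbhs_ballP[r /= r0 rP] := cg t.
    have r20 : 0 < r / 2 by rewrite divr_gt0.
    exists ([set t' | `|t - t'| < r / 2], [set d | d < r / 2]).
      split; first by apply/nbhs_ballP; exists (r / 2) => // y; rewrite -ball_normE.
      exact: nbhs_right_lt.
    move=> [t' d] /= [tt' dr] s st'.
    have near_t u : `|t - u| < r -> `|gamma t - gamma u| < e / 2.
      by move=> tu; apply: rP; rewrite -ball_normE.
    have l1 : `|gamma t - gamma t'| < e / 2 by apply: near_t; move: tt'; move: `|_| => a; lra.
    have l2 : `|gamma t - gamma s| < e / 2.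
      apply: near_t; have := ler_normD (t - t') (t' - s); rewrite addrA subrK [`|t' - s|]distrC.
      by move: tt' dr st'; move: `|_| `|_| `|_| => a1 a2 a3; lra.
    have := ler_normD (gamma t' - gamma t) (gamma t - gamma s).
    rewrite addrA subrK [`|gamma t' - gamma t|]distrC.
    by move: l1 l2; move: `|_| `|_| `|_| => a1 a2 a3; lra.
  have [d [d0 dP]] := filter_ex (filterI (nbhs_right_gt (0 : R)) H).
  by exists d => // t s t01; apply: dP; rewrite /= in_itv.
have [d d0 dP] := unif.
have [k kd] : exists k : nat, (k.+1%:R)^-1 < d.
  have := archi_boundP (ltW (ltr_wpDl ler01 (_ : 0 < d^-1))); rewrite invr_gt0 => /(_ d0) bd.
  exists (Num.bound (1 + d^-1)); rewrite invf_plt ?posrE// ?ltr0Sn//.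
  by rewrite -natr1; lra.
pose t (i : nat) : R := i%:R / k.+1%:R.
have k0 : (0 : R) < k.+1%:R by rewrite ltr0Sn.
have t01 i : (i <= k.+1)%N -> 0 <= t i <= 1.
  move=> ik; rewrite divr_ge0 ?ler0n//= ler_pdivrMr// mul1r ler_nat.
  by [].
have step i : (i <= k.+1)%N -> diffeomorphic (F @^-1` [set gamma 0]) (F @^-1` [set gamma (t i)]).
  elim: i => [_|i IH ik]; first by rewrite /t mul0r; exact: diffeomorphic_refl.
  apply: (diffeomorphic_trans (IH (ltnW ik))); apply: eP.
  - by move=> x Fx; exists (t i) => //; apply: t01; exact: ltnW.
  - by move=> x Fx; exists (t i.+1) => //; exact: t01.
  - apply: dP; first by apply: t01; exact: ltnW.
    by rewrite /t -mulrBl -natrB// subSnn mul1r ger0_norm// invr_ge0 ler0n.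
by have := step k.+1 (leqnn _); rewrite /t divff// lt0r_neq0.
Qed.

End LevelSets.

(** * Barycentric subdivision *)

(** The recursive calls of subdivision are on the lists [del i ws], which are shorter but are not
    tails. *)
Lemma list_ind_size (T : Type) (P : seq T -> Prop) : P [::] ->
  (forall b ws, (forall l, size l = size ws -> P l) -> P (b :: ws)) -> forall ws, P ws.
Proof.
move=> P0 PS ws; move: {2}(size ws) (erefl (size ws)) => k.
elim: k ws => [|k IH] [|b ws]//= [sw]; apply: PS => l sl; apply: IH; congruence.
Qed.

Section ListSubdivision.
Context {R : realType} {V : normedModType R}.
Implicit Types (f g : seq V -> int) (ws l : seq V) (Q : V -> Prop).

Definition del (T : Type) i (s : seq T) := take i s ++ drop i.+1 s.

Lemma size_del (T : Type) i (s : seq T) : (i < size s)%N -> size (del i s) = (size s).-1.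
Proof. by move=> si; rewrite size_cat size_drop size_takel ?(ltnW si)//; lia. Qed.

Lemma nth_del (T : Type) (x : T) i (s : seq T) k : (i < size s)%N ->
  nth x (del i s) k = nth x s (bump i k).
Proof.
move=> si; rewrite nth_cat size_takel ?(ltnW si)// /bump.
case: ltnP => ki; first by rewrite nth_take// leqNgt ki.
by rewrite nth_drop; congr nth; lia.
Qed.

Lemma del_map (T T' : Type) (h : T -> T') i s : del i (map h s) = map h (del i s).
Proof. by rewrite /del map_cat map_take map_drop. Qed.

Lemma mem_del (T : eqType) i (s : seq T) x : x \in del i s -> x \in s.
Proof. by rewrite mem_cat => /orP[/mem_take|/mem_drop]. Qed.

(** A function on vertex lists is a cochain on affine simplices. The empty list is included, so the
    complex is augmented and the cone formula below has no exceptional case. *)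
Definition list_coboundary f ws : int :=
  \sum_(0 <= i < size ws) (-1) ^+ i * f (del i ws).

Lemma list_coboundary_cons f b ws :
  list_coboundary f (b :: ws) = f ws - list_coboundary (fun l => f (b :: l)) ws.
Proof.
rewrite /list_coboundary big_nat_recl//= expr0 mul1r /del /= drop0; congr (_ + _).
rewrite -sumrN; apply: eq_bigr => i _.
by rewrite exprS mulN1r mulNr.
Qed.

Lemma list_coboundaryB f g ws :
  list_coboundary (fun l => f l - g l) ws = list_coboundary f ws - list_coboundary g ws.
Proof. by rewrite /list_coboundary -sumrB; apply: eq_bigr => i _; rewrite mulrBr. Qed.

Lemma list_coboundaryK f ws : list_coboundary (list_coboundary f) ws = 0.
Proof.
elim: ws f => [|b ws IH] f; first by rewrite /list_coboundary big_geq.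
rewrite list_coboundary_cons.
rewrite [X in _ - X](_ : _ = list_coboundary (fun l => f l - list_coboundary (fun l => f (b :: l)) l) ws).
  by rewrite list_coboundaryB IH subr0 subrr.
by apply: eq_bigr => i _; rewrite list_coboundary_cons.
Qed.

Definition bary ws : V := (size ws)%:R^-1 *: \sum_(x <- ws) x.

(** [k] is fuel, used with the length of the list; the barycenters met so far are accumulated inside
    the cochain. *)
Fixpoint sd_rec k f ws : int :=
  match k with
  | 0 => f ws
  | k'.+1 => \sum_(0 <= i < size ws)
      (-1) ^+ i * sd_rec k' (fun l => f (bary ws :: l)) (del i ws)
  end.
Definition sd f ws := sd_rec (size ws) f ws.

Fixpoint sdh_rec k f ws : int :=
  match k with
  | 0 => 0
  | k'.+1 => f (bary ws :: ws) - \sum_(0 <= i < size ws)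
      (-1) ^+ i * sdh_rec k' (fun l => f (bary ws :: l)) (del i ws)
  end.
Definition sdh f ws := sdh_rec (size ws) f ws.

Lemma sd_cons f b ws (v := b :: ws) :
  sd f v = list_coboundary (sd (fun l => f (bary v :: l))) v.
Proof.
rewrite /list_coboundary; apply: eq_big_nat => i /andP[_ iv].
by rewrite [sd _ (del i v)]/sd size_del.
Qed.

Lemma sdh_cons f b ws (v := b :: ws) :
  sdh f v = f (bary v :: v) - list_coboundary (sdh (fun l => f (bary v :: l))) v.
Proof.
rewrite /list_coboundary {1}/sdh /=; congr (_ - _); apply: eq_big_nat => i /andP[_ iv].
by rewrite [sdh _ (del i v)]/sdh size_del.
Qed.

Lemma eq_list_coboundary f g ws :
  (forall i, (i < size ws)%N -> f (del i ws) = g (del i ws)) ->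
  list_coboundary f ws = list_coboundary g ws.
Proof. by move=> fg; apply: eq_big_nat => i /andP[_ iv]; rewrite fg. Qed.

Lemma sdhB f g ws : sdh (fun l => f l - g l) ws = sdh f ws - sdh g ws.
Proof.
elim/list_ind_size: ws f g => [|b ws IH] f g; first by rewrite /sdh /= subrr.
set v := b :: ws; rewrite !sdh_cons -/v.
rewrite (eq_list_coboundary (g := fun l => sdh (fun l => f (bary v :: l)) l -
  sdh (fun l => g (bary v :: l)) l)); last by move=> i iv; rewrite IH// size_del.
by rewrite list_coboundaryB; ring.
Qed.

(* The dual of the chain homotopy d T + T d = 1 - S between barycentric
   subdivision and the identity, T and S being built by coning off from the barycenter. *)
Lemma sd_homotopy f ws :
  f ws = sd f ws + sdh (list_coboundary f) ws + list_coboundary (sdh f) ws.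
Proof.
elim/list_ind_size: ws f => [|b ws IH] f.
  by rewrite /sd /sdh /list_coboundary /= big_geq// !addr0.
set v := b :: ws; rewrite sdh_cons -/v list_coboundary_cons sd_cons -/v.
pose g l := f (bary v :: l).
rewrite (eq_list_coboundary (f := sdh (fun l => list_coboundary f (bary v :: l)))
  (g := fun l => sdh f l - (g l - sd g l - list_coboundary (sdh g) l))); last first.
  move=> i iv; rewrite (_ : (fun l => _) = (fun l => f l - list_coboundary g l)); last first.
    by apply: funext => l; rewrite list_coboundary_cons.
  rewrite sdhB; congr (_ - _); rewrite [in RHS](IH (del i v) _ g) ?size_del//.
  by ring.
rewrite !list_coboundaryB list_coboundaryK -/g.
by ring.
Qed.

Definition barycentric_convex Q :=
  forall ws, ws != [::] -> (forall x, x \in ws -> Q x) -> Q (bary ws).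

(** Locality: the homotopy samples its cochain only on lists one vertex longer, inside any convex
    set that contains the vertices. *)
Lemma sdh_ext Q f g ws : barycentric_convex Q -> (forall x, x \in ws -> Q x) ->
  (forall l, size l = (size ws).+1 -> (forall x, x \in l -> Q x) -> f l = g l) ->
  sdh f ws = sdh g ws.
Proof.
move=> cQ; elim/list_ind_size: ws f g => [|b ws IH] f g Qw fg //.
have Qb : Q (bary (b :: ws)) by exact: cQ.
rewrite !sdh_cons; congr (_ - _).
  by apply: fg => // x; rewrite inE => /orP[/eqP->|/Qw].
apply: eq_list_coboundary => i iv; apply: IH; first by rewrite size_del.
  by move=> x /mem_del; exact: Qw.
move=> l; rewrite size_del// => sl Ql; apply: fg; first by rewrite /= sl.
by move=> x; rewrite inE => /orP[/eqP->|/Ql].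
Qed.

Lemma sdh0 ws : sdh (fun=> 0) ws = 0.
Proof.
elim/list_ind_size: ws => [|b ws IH]//.
rewrite sdh_cons sub0r /list_coboundary big_nat big1 ?oppr0// => i iv.
by rewrite IH ?mulr0// size_del//; case/andP: iv.
Qed.

Definition diam_le (D : R) l := forall x y, x \in l -> y \in l -> `|x - y| <= D.

Lemma scale_sum_const ws (x : V) : (0 : R) < (size ws)%:R ->
  x = (size ws)%:R^-1 *: \sum_(y <- ws) x.
Proof.
move=> s0; rewrite big_const_seq count_predT iter_addr_0 -[X in _ *: X]scaler_nat scalerA.
by rewrite mulVf ?scale1r// gt_eqF.
Qed.

(** In the average of the differences [y - x] the term [y = x] vanishes, which gains the factor
    (size - 1) / size. *)
Lemma bary_dist (D : R) N ws x : 0 <= D -> (size ws <= N.+1)%N -> diam_le D ws -> x \in ws ->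
  `|bary ws - x| <= N%:R / N.+1%:R * D.
Proof.
move=> D0 sN dw xw.
have s0 : (0 < size ws)%N by case: ws xw {sN dw}.
have sr : (0 : R) < (size ws)%:R by rewrite ltr0n.
have -> : bary ws - x = (size ws)%:R^-1 *: \sum_(y <- ws) (y - x).
  rewrite sumrB scalerBr; congr (_ - _).
  exact: scale_sum_const.
rewrite normrZ ger0_norm ?invr_ge0 ?ler0n// ler_pdivrMl//.
have : `|\sum_(y <- ws) (y - x)| <= (size ws).-1%:R * D.
  rewrite (big_rem x xw) /= subrr add0r (le_trans (ler_norm_sum _ _ _))//.
  rewrite -(size_rem xw).
  rewrite (le_trans (y := \sum_(y <- rem x ws) D))//.
    by rewrite !big_seq ler_sum// => y /mem_rem yw; exact: dw.
  by rewrite big_const_seq count_predT iter_addr_0 mulr_natl.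
move/le_trans; apply; rewrite mulrA ler_wpM2r//.
rewrite mulrA ler_pdivlMr ?ltr0n// -!natrM ler_nat; move: s0 sN; lia.
Qed.

Lemma sd_ext_diam Q (D : R) N f g ws : 0 <= D -> barycentric_convex Q ->
  (size ws <= N.+1)%N -> (forall x, x \in ws -> Q x) -> diam_le D ws ->
  (forall l, size l = size ws -> (forall x, x \in l -> Q x) ->
    diam_le (N%:R / N.+1%:R * D) l -> f l = g l) ->
  sd f ws = sd g ws.
Proof.
move=> D0; elim/list_ind_size: ws Q f g => [|b ws IH] Q f g cQ sN Qw dw fg.
  by apply: fg => // x y.
set v := b :: ws; set e := N%:R / N.+1%:R * D.
have e0 : 0 <= e by rewrite mulr_ge0// divr_ge0.
rewrite !sd_cons -/v; apply: eq_list_coboundary => i iv.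
have sdi : size (del i v) = size ws by rewrite size_del.
(* The predicate records the distance to the outer barycenter, so that putting this vertex in front
   of a smaller piece respects the bound [e]. *)
pose Q' x := Q x /\ `|bary v - x| <= e.
apply: (IH _ _ Q') => //.
- move=> l l0 Ql; split; first by apply: cQ => // x /Ql[].
  have s0 : (0 : R) < (size l)%:R by rewrite ltr0n; case: l l0 {Ql}.
  have -> : bary v - bary l = (size l)%:R^-1 *: \sum_(y <- l) (bary v - y).
    rewrite sumrB scalerBr; congr (_ - _).
    exact: scale_sum_const.
  rewrite normrZ ger0_norm ?invr_ge0 ?ler0n// ler_pdivrMl//.
  rewrite (le_trans (ler_norm_sum _ _ _))//.
  rewrite (le_trans (y := \sum_(y <- l) e))//.
    by rewrite !big_seq ler_sum// => y /Ql[].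
  by rewrite big_const_seq count_predT iter_addr_0 mulr_natl.
- by rewrite sdi; move: sN => /=; lia.
- move=> x /mem_del xv; split; first exact: Qw.
  exact: bary_dist.
- by move=> x y /mem_del xv /mem_del yv; exact: dw.
- move=> l sl Ql dl; apply: fg.
  + by rewrite /= sl sdi.
  + by move=> x; rewrite inE => /orP[/eqP->|/Ql[]//]; exact: cQ.
  + move=> x y; rewrite !inE => /orP[/eqP->|xl] /orP[/eqP->|yl].
    * by rewrite subrr normr0.
    * by have [] := Ql _ yl.
    * by rewrite distrC; have [] := Ql _ xl.
    * exact: dl.
Qed.

Lemma sd0 ws : sd (fun=> 0) ws = 0.
Proof.
elim/list_ind_size: ws => [|b ws IH]//.
rewrite sd_cons /list_coboundary big_nat big1// => i iv.
by rewrite IH ?mulr0// size_del//; case/andP: iv.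
Qed.

Lemma sd_ext Q f g ws : barycentric_convex Q -> (forall x, x \in ws -> Q x) ->
  (forall l, size l = size ws -> (forall x, x \in l -> Q x) -> f l = g l) ->
  sd f ws = sd g ws.
Proof.
(* Any bound on the diameter serves here; the sum of all distances is one. *)
move=> cQ Qw fg; pose D : R := \sum_(x <- ws) \sum_(y <- ws) `|x - y|.
have D0 : 0 <= D by rewrite sumr_ge0// => x _; rewrite sumr_ge0.
apply: (@sd_ext_diam Q D (size ws)) => //; last by move=> l sl Ql _; exact: fg.
move=> x y xw yw; rewrite /D (big_rem x xw) /= (big_rem y yw) /= -addrA lerDl.
by rewrite addr_ge0// sumr_ge0// => z _; rewrite sumr_ge0.
Qed.

End ListSubdivision.

Section ListSubdivisionMap.
Context {R : realType} {V W : normedModType R} (h : {linear V -> W}).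

Lemma bary_map ws : h (bary ws) = bary (map h ws).
Proof. by rewrite /bary linearZ linear_sum big_map size_map. Qed.

Lemma sd_map (f : seq W -> int) ws :
  sd f (map h ws) = sd (fun l => f (map h l)) ws.
Proof.
elim/list_ind_size: ws f => [|b ws IH] f //.
rewrite [LHS]sd_cons sd_cons -map_cons -bary_map.
rewrite /list_coboundary size_map; apply: eq_big_nat => i /andP[_ iv].
by rewrite del_map IH// size_del.
Qed.

Lemma sdh_map (f : seq W -> int) ws :
  sdh f (map h ws) = sdh (fun l => f (map h l)) ws.
Proof.
elim/list_ind_size: ws f => [|b ws IH] f //.
rewrite [LHS]sdh_cons sdh_cons -map_cons -bary_map; congr (_ - _).
rewrite /list_coboundary size_map; apply: eq_big_nat => i /andP[_ iv].
by rewrite del_map IH// size_del.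
Qed.

End ListSubdivisionMap.

(** * Cohomology of subsets *)

Notation simplex R p := (set_type (@std_simplex R p)).

Section SimplexTopology.
Context {R : realType}.

Lemma continuous_at_initial {S X : topologicalType} {Y : choiceType} (w : Y -> X)
    (f : S -> initial_topology w) t :
  {for t, continuous (w \o f)} -> {for t, continuous f}.
Proof.
move=> cf U [?/= [[W oW <-]]] /= Wsfz /filterS; apply; apply: cf.
exact: open_nbhs_nbhs.
Qed.

Lemma near_eq_continuous_at {S T : topologicalType} (f g : S -> T) t :
  (\near t, f t = g t) -> {for t, continuous f} -> {for t, continuous g}.
Proof.
move=> fg; rewrite /prop_for /continuous_at -(nbhs_singleton fg).
apply: cvg_trans; apply: near_eq_cvg; apply: filterS fg => x ->; exact: erefl.
Qed.

Lemma dist_continuous_at {S : topologicalType} {V : normedModType R} (f : S -> V) t :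
  (forall e, 0 < e -> \forall x \near t, `|f t - f x| < e) <-> {for t, continuous f}.
Proof. by split=> [?|?]; apply/cvgrPdist_lt. Qed.

Lemma mx_continuous_at {S : topologicalType} m n (f : S -> 'M[R]_(m, n)) t :
  (forall i j, {for t, continuous (fun x => f x i j)}) -> {for t, continuous f}.
Proof.
move=> cf; apply/cvgrPdist_le => /= e e0.
have : \forall x \near t, forall i : 'I_m * 'I_n, `|f t i.1 i.2 - f x i.1 i.2| <= e.
  apply: (@filter_forall _ _ (fun (i : 'I_m * 'I_n) x => `|f t i.1 i.2 - f x i.1 i.2| <= e) (nbhs t)).
  by move=> -[i j] /=; have /cvgrPdist_le := cf i j; exact.
apply: filterS => x fx; apply: rV_norm_le; first exact: ltW.
by move=> i j; rewrite !mxE; exact: (fx (i, j)).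
Qed.

Lemma vertex_subproof p : @std_simplex R p (delta_mx 0 ord0).
Proof.
split=> [i|]; first by rewrite mxE; case: (_ && _); rewrite ?ler01.
rewrite (bigD1 ord0)//= mxE !eqxx big1 ?addr0// => i i0.
by rewrite mxE eqxx (negPf i0).
Qed.

Definition simplex_vertex p : simplex R p :=
  exist _ (delta_mx 0 ord0) (mem_set (vertex_subproof p)).

(** Points outside the simplex go to a vertex, so that affine maps can be written without membership
    proofs. *)
Definition to_simplex p (x : 'rV[R]_p.+1) : simplex R p := insubd (simplex_vertex p) x.

Lemma to_simplexE p (x : 'rV[R]_p.+1) : std_simplex x -> set_val (to_simplex x) = x.
Proof. by move=> sx; rewrite [LHS]val_insubd /= mem_set. Qed.

Lemma set_val_std p (t : simplex R p) : std_simplex (set_val t).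
Proof. exact: set_valP. Qed.

Lemma set_val_continuous p : continuous (set_val : simplex R p -> 'rV[R]_p.+1).
Proof. exact: initial_continuous. Qed.

Lemma std_simplex_le1 p (x : 'rV[R]_p.+1) i : std_simplex x -> x 0 i <= 1.
Proof.
by move=> [x0 x1]; rewrite -x1 (bigD1 i)//= lerDl sumr_ge0.
Qed.

Lemma std_simplex_compact p : compact (@std_simplex R p).
Proof.
apply: bounded_closed_compact.
  exists 1; split; first exact: num_real.
  move=> M M1 x sx; apply: rV_norm_le; first by rewrite (le_trans ler01)// ltW.
  move=> i j; rewrite (ord1 i) ger0_norm; last exact: sx.1.
  by rewrite (le_trans (std_simplex_le1 j sx))// ltW.
have -> : @std_simplex R p = (\bigcap_i [set x : 'rV[R]_p.+1 | 0 <= x 0 i]) `&`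
    [set x : 'rV[R]_p.+1 | \sum_i x 0 i = 1].
  by apply/seteqP; split=> x [x0 x1]; split=> //= i; [move=> _; exact: x0|exact: x0].
apply: closedI.
  apply: closed_bigI => i _.
  apply: (@closed_comp _ _ (fun x : 'rV[R]_p.+1 => x 0 i) [set y | 0 <= y]).
    by move=> x _; exact: coord_continuous.
  exact: closed_ge.
apply: (@closed_comp _ _ (fun x : 'rV[R]_p.+1 => \sum_i x 0 i) [set 1]).
  move=> x _; have : Ck_on 0 setT (fun x : 'rV[R]_p.+1 => \sum_i (x 0 i : R^o)).
    apply: Ck_on_sum; first exact: openT.
    by move=> i y _; exact: coord_continuous.
  exact.
exact: closed_eq.
Qed.

Lemma simplex_near_covering p (I : Type) (F : set_system I) (P : I -> simplex R p -> Prop) :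
  Filter F -> (forall t : simplex R p, \forall t' \near t & i \near F, P i t') ->
  \forall i \near F, forall t, P i t.
Proof.
move=> FF cov.
have cov' : forall x, std_simplex x -> \forall x' \near x & i \near F,
    forall t : simplex R p, set_val t = x' -> P i t.
  move=> x sx.
  pose t : simplex R p := exist _ x (mem_set sx).
  have [[B1 B2] /= [B1t FB2] BP] := cov t.
  move: B1t => /nbhs_ballP[e /= e0 eB].
  exists (ball x e, B2); first by split=> //; exact: nbhsx_ballx.
  move=> [y i] /= [xy B2i] t' t'y; apply: (BP (t', i)); split=> //=.
  by apply: eB; rewrite -initial_ballE /= t'y.
have /compact_near_coveringP/(_ I F _ FF cov') := @std_simplex_compact p.
by apply: filterS => i Bi t; apply: (Bi (set_val t)) => //; exact: set_val_std.
Qed.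

Lemma simplex_bounded p (V : normedModType R) (s : simplex R p -> V) : continuous s ->
  exists2 M : R, 0 < M & forall t, `|s t| <= M.
Proof.
move=> cs; have : \forall M \near +oo, forall t, `|s t| <= M.
  apply: simplex_near_covering => t.
  have : \forall t' \near t, `|s t - s t'| <= 1.
    by have /cvgrPdist_le := cs t; apply.
  move=> nt; exists ([set t' | `|s t - s t'| <= 1], [set M | `|s t| + 1 <= M]).
    by split=> //; apply: nbhs_pinfty_ge; exact: num_real.
  move=> [t' M] /= [h1 h2].
  rewrite -[s t'](subKr (s t)) (le_trans (ler_normB _ _))//.
  by rewrite (le_trans (y := `|s t| + 1))// ?lerD2l.
move=> [M0 [M0r M0P]]; exists (Num.max 1 (M0 + 1)).
  by rewrite lt_max ltr01.
by move=> t; apply: M0P; rewrite lt_max ltrDl ltr01 orbT.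
Qed.

End SimplexTopology.

Section RawCohomology.
Context {R : realType}.
Implicit Types (T : topologicalType).

(** The arguments are bare functions: faces and composites carry no continuity proof, which enters
    only through [simplex_in]. *)
Definition raw_coboundary T p (c : (simplex R p -> T) -> int) (s : simplex R p.+1 -> T) : int :=
  \sum_(i < p.+2) (-1) ^+ i * c (s \o face i).

Definition simplex_in T (A : set T) p (s : simplex R p -> T) : Prop :=
  continuous s /\ forall t, A (s t).

(* Vanishing of the reduced singular cohomology of the subspace [A] in degree [j];
   all cochains on [T] are allowed since cochains on [A] extend by zero. *)
Definition acyclic_in T (A : set T) (j : nat) : Prop :=
  match j with
  | 0 => forall c : (simplex R 0 -> T) -> int,
      (forall s : simplex R 1 -> T, simplex_in A s -> raw_coboundary c s = 0) ->
      exists k, forall s : simplex R 0 -> T, simplex_in A s -> c s = k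
  | j'.+1 => forall c : (simplex R j'.+1 -> T) -> int,
      (forall s : simplex R j'.+2 -> T, simplex_in A s -> raw_coboundary c s = 0) ->
      exists b : (simplex R j' -> T) -> int,
        forall s : simplex R j'.+1 -> T, simplex_in A s -> c s = raw_coboundary b s
  end.

Lemma simplex_in_face T (A : set T) p (s : simplex R p.+1 -> T) i :
  simplex_in A s -> simplex_in A (s \o face i).
Proof.
move=> [cs As]; split=> [|t]; last exact: As.
by move=> t; apply: continuous_comp; [exact: face_continuous|exact: cs].
Qed.

Lemma simplex_in_sub T (A B : set T) p (s : simplex R p -> T) : A `<=` B ->
  simplex_in A s -> simplex_in B s.
Proof. by move=> AB [cs As]; split=> // t; exact/AB/As. Qed.

Lemma simplex_in_comp T T' (A : set T) (B : set T') (f : T -> T') p (s : simplex R p -> T) :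
  (forall x, A x -> {for x, continuous f}) -> (forall x, A x -> B (f x)) ->
  simplex_in A s -> simplex_in B (f \o s).
Proof.
move=> cf fB [cs As]; split=> [t|t]; last exact/fB/As.
by apply: continuous_comp; [exact: cs|exact/cf/As].
Qed.

Lemma acyclic_set0 T j : acyclic_in (set0 : set T) j.
Proof.
have no p (s : simplex R p -> T) : ~ simplex_in set0 s.
  by case=> _ /(_ (to_simplex (delta_mx 0 ord0))).
by case: j => [|j] c _; [exists 0 => s /no|exists (fun=> 0) => s /no].
Qed.

(** A cocycle is pulled back along [g], solved on [B], and the solution pulled back along [f]. Only
    [g \o f] has to be the identity, so [B] may be much larger than [A]. *)
Lemma acyclic_retract T T' (A : set T) (B : set T') (f : T -> T') (g : T' -> T) j :
  (forall x, A x -> {for x, continuous f}) -> (forall x, A x -> B (f x)) ->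
  (forall y, B y -> {for y, continuous g}) -> (forall y, B y -> A (g y)) ->
  (forall x, A x -> g (f x) = x) -> acyclic_in B j -> acyclic_in A j.
Proof.
move=> cf fB cg gA gf.
have gfs p (s : simplex R p -> T) : simplex_in A s -> g \o (f \o s) = s.
  by move=> [_ As]; apply: funext => t /=; rewrite gf.
case: j => [|j] acB c cc.
  have [|k kP] := acB (fun s => c (g \o s)).
    by move=> s Bs; apply: (cc (g \o s)); exact: simplex_in_comp Bs.
  exists k => s As; rewrite -(kP (f \o s)); last exact: simplex_in_comp As.
  by rewrite gfs.
have [|b bP] := acB (fun s => c (g \o s)).
  by move=> s Bs; apply: (cc (g \o s)); exact: simplex_in_comp Bs.
exists (fun s => b (f \o s)) => s As.
rewrite -[LHS](congr1 c (gfs _ _ As)).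
by apply: (bP (f \o s)); exact: simplex_in_comp As.
Qed.

(** Coning simplices off from [p0] is a contracting homotopy; its formula is [coneE] below. *)
Lemma acyclic_star (V : normedModType R) (A : set V) (p0 : V) j : A p0 ->
  (forall x u, A x -> 0 <= u <= 1 -> A (u *: p0 + (1 - u) *: x)) -> acyclic_in A j.
Proof.
move=> Ap0 star.
(* [hd] is the barycentric coordinate of the apex, and [tl] the remaining coordinates rescaled to
   sum 1. *)
pose hd p (t : simplex R p) : R := set_val t 0 ord0.
pose tl p (t : simplex R p.+1) : simplex R p :=
  to_simplex (\row_k ((1 - hd _ t)^-1 * set_val t 0 (lift ord0 k))).
pose cone p (s : simplex R p -> V) (t : simplex R p.+1) : V :=
  if hd _ t == 1 then p0 else hd _ t *: p0 + (1 - hd _ t) *: s (tl _ t).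
have hd0 p (t : simplex R p) : 0 <= hd _ t by case: (set_val_std t) => + _; exact.
have hd1 p (t : simplex R p) : hd _ t <= 1 by apply: std_simplex_le1; exact: set_val_std.
have hdl p (t : simplex R p) : hd _ t != 1 -> 0 < 1 - hd _ t.
  by move=> h; rewrite subr_gt0 lt_neqAle h hd1.
have tlE p (t : simplex R p.+1) : hd _ t != 1 ->
    set_val (tl _ t) = \row_k ((1 - hd _ t)^-1 * set_val t 0 (lift ord0 k)).
  move=> h; rewrite to_simplexE//; have [t0 t1] := set_val_std t; split=> [i|].
    by rewrite mxE mulr_ge0// invr_ge0 ltW// hdl.
  under eq_bigr do rewrite mxE.
  rewrite -mulr_sumr; move: t1; rewrite big_ord_recl -/(hd _ t) => /(canRL (addKr _)) ->.
  by rewrite [- _ + _]addrC mulVf// gt_eqF// hdl.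
have chd p : continuous (hd p).
  move=> t; apply: (@continuous_comp _ _ _ set_val (fun x : 'rV[R]_p.+1 => x 0 ord0)).
    exact: set_val_continuous.
  exact: coord_continuous.
have ctl p (t : simplex R p.+1) : hd _ t != 1 -> {for t, continuous (tl p)}.
  move=> h; apply: continuous_at_initial.
  have nt : \forall t' \near t, hd _ t' != 1.
    have /cvgrPdist_lt/(_ _ (hdl _ _ h)) := chd _ t; apply: filterS => t' /=.
    by apply: contraTneq => ->; rewrite -leNgt ler_normr opprB lexx orbT.
  have : {for t, continuous (fun t' : simplex R p.+1 =>
      \row_k ((1 - hd _ t')^-1 * set_val t' 0 (lift ord0 k)) : 'rV[R]_p.+1)}.
    apply: mx_continuous_at => i k.
    rewrite /prop_for /continuous_at mxE; under eq_fun do rewrite mxE.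
    have c1 : {for t, continuous (fun t' : simplex R p.+1 => 1 - hd _ t')}.
      by apply: continuousB; [exact: cst_continuous|exact: chd].
    have c2 : {for t, continuous (fun t' : simplex R p.+1 => (1 - hd _ t')^-1)}.
      by apply: continuousV => //; rewrite gt_eqF// hdl.
    have c3 : {for t, continuous (fun t' : simplex R p.+1 => set_val t' 0 (lift ord0 k))}.
      apply: (@continuous_comp _ _ _ set_val (fun x : 'rV[R]_p.+2 => x 0 (lift ord0 k))).
        exact: set_val_continuous.
      exact: coord_continuous.
    exact: (continuousM c2 c3).
  by apply: near_eq_continuous_at; apply: filterS nt => t' /tlE.
have ccone p (s : simplex R p -> V) : continuous s -> continuous (cone p s).
  move=> cs t; have [h|h] := eqVneq (hd _ t) 1; last first.
    have nt : \forall t' \near t, hd _ t' != 1.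
      have /cvgrPdist_lt/(_ _ (hdl _ _ h)) := chd _ t; apply: filterS => t' /=.
      by apply: contraTneq => ->; rewrite -leNgt ler_normr opprB lexx orbT.
    have : {for t, continuous (fun t' => hd _ t' *: p0 + (1 - hd _ t') *: s (tl _ t'))}.
      apply: continuousD; first by apply: continuousZr_tmp; exact: chd.
      apply: continuousZ; first by apply: continuousB; [exact: cst_continuous|exact: chd].
      by apply: (@continuous_comp _ _ _ (tl p) s); [exact: ctl|exact: cs].
    by apply: near_eq_continuous_at; apply: filterS nt => t'; rewrite /cone => /negPf ->.
  (* At the apex [tl] has no limit; continuity comes from the factor [1 - hd], since [s] is bounded
     on the compact simplex. *)
  have [M M0 sM] := simplex_bounded cs.
  have Mp : 0 < M + `|p0| by rewrite ltr_pwDl.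
  have ct : cone _ s t = p0 by rewrite /cone h eqxx.
  apply/dist_continuous_at => e e0.
  have ep : 0 < e / (M + `|p0|) by rewrite divr_gt0.
  have /cvgrPdist_lt/(_ _ ep) := chd _ t; apply: filterS => t'; rewrite ct h.
  rewrite ger0_norm ?subr_ge0// => ht'.
  rewrite /cone; case: eqVneq => [_|h']; first by rewrite subrr normr0.
  have -> : p0 - (hd _ t' *: p0 + (1 - hd _ t') *: s (tl _ t')) =
      (1 - hd _ t') *: (p0 - s (tl _ t')).
    by rewrite scalerBr [in X in _ = X - _]scalerBl scale1r opprD addrA.
  rewrite normrZ ger0_norm ?subr_ge0//.
  apply: (@le_lt_trans _ _ ((1 - hd _ t') * (M + `|p0|))).
    rewrite ler_wpM2l ?subr_ge0// (le_trans (ler_normB _ _))// addrC lerD2r.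
    exact: sM.
  by rewrite -ltr_pdivlMr.
have cone_in p (s : simplex R p -> V) : simplex_in A s -> simplex_in A (cone _ s).
  move=> [cs As]; split=> [|t]; first exact: ccone.
  by rewrite /cone; case: ifP => // _; apply: star => //; rewrite hd0 hd1.
have face0 p (s : simplex R p -> V) : cone _ s \o face ord0 = s.
  apply: funext => t /=.
  have h : hd _ (face ord0 t) = 0 by rewrite /hd /= /face_row mxE unlift_none.
  rewrite /cone h eq_sym oner_eq0 scale0r add0r subr0 scale1r; congr s.
  apply: val_inj; rewrite [LHS]tlE ?h 1?eq_sym ?oner_eq0//.
  by apply/rowP => k; rewrite !mxE subr0 invr1 mul1r liftK.
have faceS p (s : simplex R p.+1 -> V) i :
    cone _ s \o face (lift ord0 i) = cone _ (s \o face i).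
  apply: funext => t /=.
  have h : hd _ (face (lift ord0 i) t) = hd _ t.
    rewrite /hd /= /face_row mxE (_ : ord0 = lift (lift ord0 i) ord0) ?liftK//.
    exact: val_inj.
  rewrite /cone h; case: eqVneq => // h1; congr (_ + _ *: s _).
  apply: val_inj; rewrite [LHS]tlE ?h// [RHS](_ : _ = face_row i (set_val (tl _ t)))//.
  rewrite tlE//; apply/rowP => k; rewrite !mxE.
  case: (unliftP i k) => [l ->|->].
    have E : lift ord0 (lift i l) = lift (lift ord0 i) (lift ord0 l).
      by apply: val_inj; rewrite /= /bump /=; lia.
    by rewrite E liftK /= mxE.
  by rewrite unlift_none /= mulr0.
have coneE p c (s : simplex R p.+1 -> V) : raw_coboundary c (cone _ s) =
    c s - raw_coboundary (fun s' => c (cone _ s')) s.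
  rewrite /raw_coboundary big_ord_recl expr0 mul1r face0; congr (_ + _).
  rewrite -sumrN; apply: eq_bigr => i _.
  by rewrite faceS lift0 exprS mulN1r mulNr.
case: j => [|j] c cc.
  (* In degree 0 the second face of the cone is the constant simplex at [p0]. *)
  exists (c (fun=> p0)) => s As; have := cc _ (cone_in _ _ As).
  rewrite /raw_coboundary !big_ord_recl big_ord0 expr0 expr1 mul1r addr0 face0 mulN1r.
  move=> /eqP; rewrite subr_eq0 => /eqP ->; congr c; apply: funext => t /=.
  suff h : hd _ (face (lift ord0 ord0) t) = 1 by rewrite /cone h eqxx.
  have [_] := set_val_std t; rewrite big_ord1 => t1.
  rewrite /hd /= /face_row mxE (_ : ord0 = lift (lift ord0 ord0) ord0) ?liftK//.
  exact: val_inj.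
exists (fun s => c (cone _ s)) => s As; apply/eqP; rewrite -subr_eq0 -coneE.
by apply/eqP/cc/cone_in.
Qed.

End RawCohomology.

(** * Mayer-Vietoris *)

Module Export FaceRow.

Lemma face_row_is_linear (R : realType) p (i : 'I_p.+2) : linear (@face_row R p i).
Proof.
move=> a x y; apply/rowP => k; rewrite !mxE.
by case: (unliftP i k) => [j|] _ /=; rewrite ?mxE// mulr0 addr0.
Qed.

HB.instance Definition _ (R : realType) p (i : 'I_p.+2) :=
  GRing.isLinear.Build R 'rV[R]_p.+1 'rV[R]_p.+2 *:%R (@face_row R p i)
    (@face_row_is_linear R p i).

End FaceRow.

Section SmallSimplices.
Context {R : realType} {T : topologicalType}.

Lemma raw_coboundaryD p (c d : (simplex R p -> T) -> int) s :
  raw_coboundary (fun s => c s + d s) s = raw_coboundary c s + raw_coboundary d s.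
Proof. by rewrite -big_split; apply: eq_bigr => i _; rewrite mulrDr. Qed.

Lemma raw_coboundaryB p (c d : (simplex R p -> T) -> int) s :
  raw_coboundary (fun s => c s - d s) s = raw_coboundary c s - raw_coboundary d s.
Proof. by rewrite -sumrB; apply: eq_bigr => i _; rewrite mulrBr. Qed.

Definition affine_simplex p q (ws : seq 'rV[R]_p.+1) (t : simplex R q) : simplex R p :=
  to_simplex (\sum_(i < q.+1) set_val t 0 i *: nth 0 ws i).

Definition std_list p (ws : seq 'rV[R]_p.+1) : Prop := forall x, x \in ws -> std_simplex x.

Lemma affine_simplexE p q ws (t : simplex R q) : std_list ws -> size ws = q.+1 ->
  set_val (affine_simplex ws t : simplex R p) = \sum_(i < q.+1) set_val t 0 i *: nth 0 ws i.
Proof.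
move=> sw sz; rewrite to_simplexE//; have [t0 t1] := set_val_std t.
have sn (i : 'I_q.+1) : std_simplex (nth 0 ws i).
  by apply: sw; apply: mem_nth; rewrite sz.
split=> [k|].
  rewrite summxE sumr_ge0// => i _; rewrite mxE mulr_ge0//.
  by case: (sn i) => + _; exact.
under eq_bigr do rewrite summxE.
rewrite exchange_big /= -t1; apply: eq_bigr => i _.
by under eq_bigr do rewrite mxE; rewrite -mulr_sumr (sn i).2 mulr1.
Qed.

Lemma affine_simplex_continuous p q ws : std_list ws -> size ws = q.+1 ->
  continuous (affine_simplex ws : simplex R q -> simplex R p).
Proof.
move=> sw sz; apply: continuous_comp_initial => t.
have : {for t, continuous (fun t : simplex R q => \sum_(i < q.+1) set_val t 0 i *: nth 0 ws i)}.
  apply: (@continuous_comp _ _ _ set_val (fun x : 'rV[R]_q.+1 => \sum_(i < q.+1) x 0 i *: nth 0 ws i)).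
    exact: set_val_continuous.
  have : Ck_on 0 setT (fun x : 'rV[R]_q.+1 => \sum_(i < q.+1) x 0 i *: nth 0 ws i).
    apply: Ck_on_sum; first exact: openT.
    by move=> i x _; apply: continuousZr_tmp; exact: coord_continuous.
  exact.
have <- : set_val \o (affine_simplex ws : simplex R q -> simplex R p) =
    (fun t => \sum_(i < q.+1) set_val t 0 i *: nth 0 ws i).
  by apply: funext => t' /=; rewrite affine_simplexE.
exact.
Qed.

Lemma affine_simplex_face p q ws (i : 'I_q.+2) (t : simplex R q) : std_list ws ->
  size ws = q.+2 -> affine_simplex ws (face i t) = affine_simplex (del i ws) t :> simplex R p.
Proof.
move=> sw sz; have szd : size (del i ws) = q.+1 by rewrite size_del sz.
apply: val_inj; rewrite [LHS]affine_simplexE// [RHS]affine_simplexE//; last first.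
  by move=> x /mem_del/sw.
rewrite (bigD1_ord i)//= mxE unlift_none scale0r add0r.
by apply: eq_bigr => k _; rewrite mxE liftK /= nth_del ?sz.
Qed.

Definition std_vertices p : seq 'rV[R]_p.+1 := [seq delta_mx 0 i | i <- enum 'I_p.+1].

Lemma size_std_vertices p : size (std_vertices p) = p.+1.
Proof. by rewrite size_map size_enum_ord. Qed.

Lemma std_vertices_std p : std_list (std_vertices p).
Proof.
move=> x /mapP[i _ ->]; split=> [k|].
  by rewrite mxE; case: (_ && _); rewrite ?ler01.
rewrite (bigD1 i)//= mxE !eqxx big1 ?addr0// => k ki.
by rewrite mxE eqxx (negPf ki).
Qed.

Lemma nth_std_vertices p (i : 'I_p.+1) : nth 0 (std_vertices p) i = delta_mx 0 i.
Proof. by rewrite (nth_map i) ?size_enum_ord// nth_ord_enum. Qed.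

Lemma affine_std_vertices p (t : simplex R p) : affine_simplex (std_vertices p) t = t.
Proof.
apply: val_inj; rewrite [LHS]affine_simplexE ?size_std_vertices//; last exact: std_vertices_std.
rewrite [RHS]row_sum_delta; apply: eq_bigr => i _.
by rewrite nth_std_vertices.
Qed.

Lemma face_std_vertices p (i : 'I_p.+2) :
  map (face_row i) (std_vertices p) = del i (std_vertices p.+1).
Proof.
have szd : size (del i (std_vertices p.+1)) = p.+1 by rewrite size_del size_std_vertices.
apply: (@eq_from_nth _ 0); first by rewrite size_map size_std_vertices.
move=> k; rewrite size_map size_std_vertices => kp.
rewrite (nth_map 0) ?size_std_vertices// nth_del ?size_std_vertices//.
rewrite -[k]/(val (Ordinal kp)) nth_std_vertices -[bump i _]/(val (lift i (Ordinal kp))) nth_std_vertices.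
apply/rowP => l; rewrite !mxE; case: (unliftP i l) => [m|] -> /=.
  by rewrite mxE eqxx (inj_eq (@lift_inj _ i)).
by rewrite (negPf (neq_lift _ _)).
Qed.

(** The cochain [c] on the affine simplices of the domain of [s], as a function of vertex lists. The
    value 0 on other lengths is compatible with coboundaries. *)
Definition pull_cochain p q (c : (simplex R q -> T) -> int) (s : simplex R p -> T)
    (ws : seq 'rV[R]_p.+1) : int :=
  if size ws == q.+1 then c (s \o affine_simplex ws) else 0.

Lemma pull_cochain_face p q (c : (simplex R q -> T) -> int) (s : simplex R p.+1 -> T) i ws :
  std_list ws -> pull_cochain c (s \o face i) ws = pull_cochain c s (map (face_row i) ws).
Proof.
move=> sw; rewrite /pull_cochain size_map; case: eqP => // sz; congr c.
apply: funext => t /=; congr s; apply: val_inj.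
rewrite [LHS](_ : _ = face_row i (set_val (affine_simplex ws t)))// affine_simplexE//.
rewrite [RHS]affine_simplexE ?size_map//; last first.
  by move=> x /mapP[y /sw sy ->]; exact: face_row_std.
rewrite linear_sum; apply: eq_bigr => k _.
by rewrite linearZ (nth_map 0)// sz.
Qed.

Lemma pull_cochain_coboundary p q (c : (simplex R q -> T) -> int) (s : simplex R p -> T) ws :
  std_list ws -> list_coboundary (pull_cochain c s) ws =
  pull_cochain (raw_coboundary c) s ws.
Proof.
move=> sw; rewrite /list_coboundary [RHS]/pull_cochain; case: eqP => [sz|sz].
  rewrite sz big_mkord; apply: eq_bigr => i _; congr (_ * _).
  rewrite /pull_cochain size_del sz// eqxx; congr c; apply: funext => t /=.
  by rewrite affine_simplex_face.
rewrite big_nat big1// => i /andP[_ iw].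
rewrite /pull_cochain size_del//; case: eqP => [E|_]; last by rewrite mulr0.
by exfalso; apply: sz; rewrite -E prednK//; apply: leq_ltn_trans iw.
Qed.

(** The cancellation of signs is inherited from vertex lists, evaluated at the standard vertices. *)
Lemma raw_coboundaryK p (c : (simplex R p -> T) -> int) (s : simplex R p.+2 -> T) :
  raw_coboundary (raw_coboundary c) s = 0.
Proof.
have sE : s \o affine_simplex (std_vertices p.+2) = s.
  by apply: funext => t /=; rewrite affine_std_vertices.
have sv := @std_vertices_std p.+2.
have := pull_cochain_coboundary (raw_coboundary c) s sv.
rewrite [RHS]/pull_cochain size_std_vertices eqxx sE => <-.
rewrite -(list_coboundaryK (pull_cochain c s) (std_vertices p.+2)).
apply: eq_list_coboundary => i _; rewrite pull_cochain_coboundary// => x /mem_del; exact: sv.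
Qed.

Lemma std_simplex_barycentric p : barycentric_convex (@std_simplex R p).
Proof.
move=> ws w0 sw; have s0 : (0 : R) < (size ws)%:R by rewrite ltr0n; case: ws w0 {sw}.
split=> [k|].
  rewrite mxE mulr_ge0 ?invr_ge0 ?ler0n// summxE big_seq sumr_ge0// => x /sw[+ _]; exact.
under eq_bigr do rewrite mxE summxE.
rewrite -mulr_sumr exchange_big /= big_seq (eq_bigr (fun=> 1)); last by move=> x /sw[].
by rewrite -big_seq big_const_seq count_predT iter_addr_0 mulVf// gt_eqF.
Qed.

Lemma std_diam_le p ws : @std_list p ws -> diam_le 1 ws.
Proof.
move=> sw x y /sw sx /sw sy; apply: rV_norm_le => // i j; rewrite (ord1 i) !mxE.
have [x0 _] := sx; have [y0 _] := sy.
have := std_simplex_le1 j sx; have := std_simplex_le1 j sy.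
move: (x0 j) (y0 j); rewrite ler_norml => *; apply/andP; split; lra.
Qed.

Lemma affine_simplex_dist p q ws (t : simplex R q) (x : 'rV[R]_p.+1) e : std_list ws ->
  size ws = q.+1 -> (forall y, y \in ws -> `|x - y| <= e) ->
  `|x - set_val (affine_simplex ws t : simplex R p)| <= e.
Proof.
move=> sw sz dw; rewrite affine_simplexE//; have [t0 t1] := set_val_std t.
rewrite -[x]scale1r -{1}t1 scaler_suml -sumrB (le_trans (ler_norm_sum _ _ _))//.
rewrite (le_trans (y := \sum_(i < q.+1) set_val t 0 i * e))//; last first.
  by rewrite -mulr_suml t1 mul1r.
apply: ler_sum => i _; rewrite -scalerBr normrZ ger0_norm// ler_wpM2l//.
by apply: dw; apply: mem_nth; rewrite sz.
Qed.

Lemma lebesgue_number p (s : simplex R p -> T) (U V : set T) : open U -> open V ->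
  continuous s -> (forall t, U (s t) \/ V (s t)) ->
  exists2 e : R, 0 < e & forall t : simplex R p,
    (forall t', `|set_val t - set_val t'| < e -> U (s t')) \/
    (forall t', `|set_val t - set_val t'| < e -> V (s t')).
Proof.
move=> oU oV cs UV.
pose P (e : R) (t : simplex R p) :=
    (forall t', `|set_val t - set_val t'| < e -> U (s t')) \/
    (forall t', `|set_val t - set_val t'| < e -> V (s t')).
suff : \forall e \near 0^'+, forall t, P e t.
  move=> H; near (0 : R)^'+ => e; exists e => //; near: e => //.
apply: simplex_near_covering => t.
have key (W : set T) : open W -> W (s t) -> \forall t' \near t & e \near 0^'+,
    forall t'', `|set_val t' - set_val t''| < e -> W (s t'').
  move=> oW Wt; have /nbhs_ballP[d /= d0 dW] := cs t _ (open_nbhs_nbhs (conj oW Wt)).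
  exists ([set t' | ball t (d / 2) t'], [set e | e < d / 2]).
    split; first by apply/nbhs_ballP; exists (d / 2) => //=; exact: divr_gt0.
    by apply: nbhs_right_lt; exact: divr_gt0.
  move=> [t' e] /= [tt' ed] t'' t't''; apply: dW.
  move: tt'; rewrite -!initial_ballE /= -!ball_normE /= => tt'.
  rewrite -(subrKA (set_val t')) (le_lt_trans (ler_normD _ _))//.
  by rewrite [d]splitr ltrD// (lt_trans t't'').
have [Ut|Vt] := UV t; [have [B BF BP] := key U oU Ut|have [B BF BP] := key V oV Vt].
  by exists B => // x Bx; left; exact: (BP x Bx).
by exists B => // x Bx; right; exact: (BP x Bx).
Unshelve. all: by end_near. Qed.

(** Each subdivision shrinks diameters by N / (N + 1), whose powers tend to 0; a cochain that
    vanishes on small lists is eventually killed. *)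
Lemma std_diam_sd p N (f : seq 'rV[R]_p.+1 -> int) (d : R) : 0 < d ->
  (forall ws, std_list ws -> size ws = N.+1 -> diam_le d ws -> f ws = 0) ->
  exists m, forall i, (m <= i)%N -> forall ws, std_list ws -> size ws = N.+1 ->
    iter i sd f ws = 0.
Proof.
move=> d0 fd; pose r : R := N%:R / N.+1%:R.
have r0 : 0 <= r by rewrite divr_ge0.
have r1 : r < 1 by rewrite ltr_pdivrMr ?ltr0n// mul1r ltr_nat.
have itd i ws D : 0 <= D -> r ^+ i * D <= d -> std_list ws -> size ws = N.+1 -> diam_le D ws ->
    iter i sd f ws = 0.
  elim: i ws D => [|i IH] ws D D0 rD sw sz dw.
    apply: fd => // x y xw yw; rewrite (le_trans (dw _ _ xw yw))//.
    by rewrite expr0 mul1r in rD.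
  rewrite iterS -(sd0 ws).
  apply: (@sd_ext_diam _ _ (@std_simplex R p) D N) => //.
  - exact: std_simplex_barycentric.
  - by rewrite sz.
  - rewrite sz => l sl Ql dl; apply: (IH l (r * D)) => //; first exact: mulr_ge0.
    by rewrite mulrA -exprSr.
have /cvgrPdist_le/(_ _ d0)[m _ mP] : (r ^+ n @[n --> \oo] --> (0 : R)).
  by apply: cvg_expr; rewrite ger0_norm.
exists m => i mi ws sw sz; apply: (itd i ws 1) => //; last exact: std_diam_le.
rewrite mulr1; have := mP i mi; rewrite sub0r normrN ger0_norm//; exact: exprn_ge0.
Qed.

Lemma sd_iter_ext p (f g : seq 'rV[R]_p.+1 -> int) N m :
  (forall ws, std_list ws -> size ws = N -> f ws = g ws) ->
  forall ws, std_list ws -> size ws = N -> iter m sd f ws = iter m sd g ws.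
Proof.
move=> fg; elim: m => [|m IH] ws sw sz; first exact: fg.
rewrite !iterS; apply: (@sd_ext _ _ (@std_simplex R p)) => //.
  exact: std_simplex_barycentric.
by move=> l sl sdl; apply: IH; rewrite ?sl.
Qed.

Lemma sd_iter_map p (i : 'I_p.+2) (f : seq 'rV[R]_p.+2 -> int) m ws :
  iter m sd f (map (face_row i) ws) = iter m sd (fun l => f (map (face_row i) l)) ws.
Proof.
elim: m ws => [|m IH] ws //; rewrite !iterS sd_map.
congr (sd _ ws); exact/funext.
Qed.

(** Telescoping of [sd_homotopy]: subdivisions of a cocycle are cocycles, so the term in
    [list_coboundary f] drops out at every stage. *)
Lemma sd_iter_homotopy p (f : seq 'rV[R]_p.+1 -> int) m :
  (forall ws, std_list ws -> list_coboundary f ws = 0) ->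
  forall ws, std_list ws ->
  f ws = iter m sd f ws + \sum_(i < m) list_coboundary (sdh (iter i sd f)) ws.
Proof.
move=> f0.
have sdh0' (g : seq 'rV[R]_p.+1 -> int) ws : (forall ws, std_list ws -> list_coboundary g ws = 0) -> std_list ws ->
    g ws = sd g ws + list_coboundary (sdh g) ws.
  move=> g0 sw; rewrite {1}(sd_homotopy g ws); congr (_ + _).
  rewrite -[RHS]addr0; congr (_ + _); rewrite -(sdh0 ws).
  apply: (@sdh_ext _ _ (@std_simplex R p)) => //; first exact: std_simplex_barycentric.
  by move=> l _ sl; exact: g0.
have fi i : forall ws, std_list ws -> list_coboundary (iter i sd f) ws = 0.
  elim: i => [|i IH] ws sw; first exact: f0.
  have E l : std_list l -> iter i.+1 sd f l =
      iter i sd f l - list_coboundary (sdh (iter i sd f)) l.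
    by move=> sl; rewrite [X in X - _](sdh0' _ _ IH sl) addrK.
  rewrite (eq_list_coboundary (g := fun l => iter i sd f l - list_coboundary (sdh (iter i sd f)) l)).
    by rewrite list_coboundaryB list_coboundaryK IH// subr0.
  by move=> k kw; apply: E => x /mem_del; exact: sw.
elim: m => [|m IH] ws sw; first by rewrite big_ord0 addr0.
rewrite big_ord_recr /= addrCA addrA -addrA -sdh0'//.
  by rewrite addrC -IH.
exact: fi.
Qed.

(** The number of subdivisions that makes the pieces small depends on the simplex. The homotopy is
    therefore summed up to an individual bound [mm s], and surplus terms vanish because [c] is zero
    on small simplices. *)
Lemma small_simplices (A U V : set T) j (c : (simplex R j.+1 -> T) -> int) :
  open U -> open V -> A `<=` U `|` V ->
  (forall s : simplex R j.+2 -> T, simplex_in A s -> raw_coboundary c s = 0) ->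
  (forall s : simplex R j.+1 -> T, simplex_in (A `&` U) s -> c s = 0) ->
  (forall s : simplex R j.+1 -> T, simplex_in (A `&` V) s -> c s = 0) ->
  exists b : (simplex R j -> T) -> int,
    forall s : simplex R j.+1 -> T, simplex_in A s -> c s = raw_coboundary b s.
Proof.
move=> oU oV AUV cc cU cV.
pose P p (s : simplex R p -> T) m := forall i, (m <= i)%N -> forall ws, std_list ws ->
  size ws = j.+2 -> iter i sd (pull_cochain c s) ws = 0.
have PP p (s : simplex R p -> T) : simplex_in A s -> exists m, P p s m.
  move=> [cs As].
  have [e e0 eP] := lebesgue_number oU oV cs (fun t => AUV _ (As t)).
  have e2 : 0 < e / 2 by rewrite divr_gt0.
  apply: (std_diam_sd e2) => ws sw sz dw.
  rewrite /pull_cochain sz eqxx.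
  have w0 : nth 0 ws 0 \in ws by apply: mem_nth; rewrite sz.
  have ct : continuous (s \o (affine_simplex ws : simplex R j.+1 -> simplex R p)).
    by move=> t; apply: continuous_comp; [exact: affine_simplex_continuous|exact: cs].
  have tE : set_val (to_simplex (nth 0 ws 0)) = nth 0 ws 0 by rewrite to_simplexE//; exact: sw.
  have near_t (t : simplex R j.+1) : `|set_val (to_simplex (nth 0 ws 0)) - set_val (affine_simplex ws t)| < e.
    rewrite tE (@le_lt_trans _ _ (e / 2))//; last by rewrite ltr_pdivrMr// ltr_pMr// ltr1n.
    by apply: affine_simplex_dist => // y yw; exact: dw.
  have [Us|Vs] := eP (to_simplex (nth 0 ws 0)).
    by apply: cU; split=> // t; split; [exact: As|exact/Us/near_t].
  by apply: cV; split=> // t; split; [exact: As|exact/Vs/near_t].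
pose mm (s : simplex R j -> T) : nat := xget 0%N [set m | P j s m].
have mmP s : simplex_in A s -> P j s (mm s).
  by move=> /PP[m Pm]; rewrite /mm; case: xgetP => // /(_ m).
exists (fun s => \sum_(i < mm s) sdh (iter i sd (pull_cochain c s)) (std_vertices j)).
move=> s As.
have [m0 m0P] := PP _ _ As.
(* A bound that serves [s] and all its faces at once. *)
pose m := maxn m0 (\max_(i < j.+2) mm (s \o face i)).
pose f := pull_cochain c s.
have f0 ws : std_list ws -> list_coboundary f ws = 0.
  move=> sw; rewrite pull_cochain_coboundary// /pull_cochain; case: eqP => // sz.
  apply: cc; split=> [t|t]; last exact: As.2.
  by apply: continuous_comp; [exact: affine_simplex_continuous|exact: As.1].
have -> : c s = f (std_vertices j.+1).
  rewrite /f /pull_cochain size_std_vertices eqxx; congr c; apply: funext => t /=.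
  by rewrite affine_std_vertices.
rewrite (sd_iter_homotopy m f0); last exact: std_vertices_std.
rewrite (m0P m (leq_maxl _ _)) ?size_std_vertices//; last exact: std_vertices_std.
rewrite add0r /raw_coboundary /list_coboundary size_std_vertices.
under eq_bigr do rewrite big_mkord.
rewrite exchange_big /=; apply: eq_bigr => k _; rewrite -mulr_sumr; congr (_ * _).
have As' := simplex_in_face k As.
have sE i : sdh (iter i sd f) (del k (std_vertices j.+1)) =
    sdh (iter i sd (pull_cochain c (s \o face k))) (std_vertices j).
  rewrite -face_std_vertices sdh_map; apply: (@sdh_ext _ _ (@std_simplex R j)).
  - exact: std_simplex_barycentric.
  - exact: std_vertices_std.
  - move=> l _ sl; rewrite sd_iter_map.
    by apply: (@sd_iter_ext _ _ _ (size l)) => // ws sw _; rewrite pull_cochain_face.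
apply: etrans (eq_bigr _ (fun (i : 'I_m) _ => sE i)) _.
have km : (mm (s \o face k) <= m)%N.
  by rewrite leq_max (leq_bigmax k) orbT.
(* Terms beyond the bound of the face evaluate only subdivisions that are already zero. *)
rewrite -(subnKC km) big_split_ord /= [X in _ + X]big1 ?addr0// => i _.
rewrite -(sdh0 (std_vertices j)); apply: (@sdh_ext _ _ (@std_simplex R j)).
- exact: std_simplex_barycentric.
- exact: std_vertices_std.
- move=> l; rewrite size_std_vertices => sl stl.
  by apply: (mmP _ As'); rewrite ?leq_addr.
Qed.

Theorem mayer_vietoris_acyclic (A U V : set T) j : open U -> open V -> A `<=` U `|` V ->
  acyclic_in (R := R) (A `&` U) j.+1 -> acyclic_in (R := R) (A `&` V) j.+1 ->
  acyclic_in (R := R) (A `&` U `&` V) j -> acyclic_in (R := R) A j.+1.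
Proof.
move=> oU oV AUV acU acV acUV c cc.
have AU : A `&` U `<=` A by move=> x [].
have AV : A `&` V `<=` A by move=> x [].
have UVU : A `&` U `&` V `<=` A `&` U by move=> x [].
have UVV : A `&` U `&` V `<=` A `&` V by move=> x [[]].
have [a aP] := acU c (fun s h => cc s (simplex_in_sub AU h)).
have [b bP] := acV c (fun s h => cc s (simplex_in_sub AV h)).
(* On the intersection [a - b] is a cocycle. Correcting [b] by the coboundary of a primitive of it,
   or by a constant in degree 0, makes the two primitives of [c] agree there. *)
have [b' b'P ab'] : exists2 b' : (simplex R j -> T) -> int,
    forall s : simplex R j.+1 -> T, simplex_in (A `&` V) s -> c s = raw_coboundary b' s &
    forall s : simplex R j -> T, simplex_in (A `&` U `&` V) s -> a s = b' s.
  have abc s : simplex_in (A `&` U `&` V) s -> raw_coboundary (fun s => a s - b s) s = 0.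
    move=> As; rewrite raw_coboundaryB -aP; last exact: simplex_in_sub As.
    by rewrite -bP ?subrr//; exact: simplex_in_sub As.
  case: j a b acU acV acUV c cc aP bP abc => [|j] a b _ _ acUV c cc aP bP abc.
    have [k kP] := acUV _ abc; exists (fun s => b s + k).
      move=> s As; rewrite bP// raw_coboundaryD -[LHS]addr0; congr (_ + _).
      by rewrite /raw_coboundary !big_ord_recl big_ord0 expr0 expr1; ring.
    by move=> s /kP <-; rewrite addrC subrK.
  have [e eP] := acUV _ abc; exists (fun s => b s + raw_coboundary e s).
    move=> s As; rewrite bP// raw_coboundaryD -[LHS]addr0; congr (_ + _).
    by rewrite raw_coboundaryK.
  by move=> s /eP <-; rewrite addrC subrK.
(* The glued cochain need not be a primitive on large simplices, but [c] minus its coboundary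
   vanishes on those inside [U] or inside [V]. *)
pose g (s : simplex R j -> T) : int :=
  if pselect (simplex_in (A `&` U) s) is left _ then a s else b' s.
have [|||d dP] := @small_simplices A U V j (fun s => c s - raw_coboundary g s) oU oV AUV.
- move=> s As; by rewrite raw_coboundaryB cc// raw_coboundaryK subrr.
- move=> s As; rewrite aP// -raw_coboundaryB; apply: big1 => i _.
  rewrite /g; case: pselect => [_|[]]; last exact: simplex_in_face.
  by rewrite subrr mulr0.
- move=> s As; rewrite b'P// -raw_coboundaryB; apply: big1 => i _.
  rewrite /g; case: pselect => [As'|_]; last by rewrite subrr mulr0.
  rewrite -ab' ?subrr ?mulr0//; split; first by case: As'.
  move=> t; split; first by case: As' => _; exact.
  by have [_ /(_ t)[]] := simplex_in_face i As.
exists (fun s => d s + g s) => s As.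
by rewrite raw_coboundaryD -dP// subrK.
Qed.

End SmallSimplices.

(** * Complements of coordinate subspaces *)

Section CoordinateComplement.
Context {R : realType} {V : normedModType R} {I : eqType}.
Variables (l : I -> V -> R) (e : I -> V).
Hypotheses (cl : forall i, continuous (l i))
  (ll : forall i a x y, l i (a *: x + y) = a * l i x + l i y)
  (le : forall i j, l i (e j) = (i == j)%:R).

Definition some_coord_neq0 (S : seq I) : set V := [set x | exists2 i, i \in S & l i x != 0].

Lemma open_coord_neq0 S : open (some_coord_neq0 S).
Proof.
have -> : some_coord_neq0 S = \bigcup_(i in [set i | i \in S]) (l i @^-1` [set y | y != 0]).
  by apply/seteqP; split=> x [i iS xi]; exists i.
apply: bigcup_open => i _; apply: open_comp; first by move=> x _; exact: cl.
exact: open_neq.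
Qed.

Lemma coordD i x y : l i (x + y) = l i x + l i y.
Proof. by have := ll i 1 x y; rewrite scale1r mul1r. Qed.

Lemma coordZ i a x : l i (a *: x) = a * l i x.
Proof.
have l0 : l i 0 = 0 by have := ll i 1 0 0; rewrite scale1r addr0 mul1r => /eqP; rewrite -subr_eq0 opprD addrA subrr sub0r oppr_eq0 => /eqP.
by rewrite -[_ *: _]addr0 ll l0 addr0.
Qed.

(** Star-shaped about plus or minus [e i]: moving towards that point keeps the sign of coordinate
    [i] and only rescales the coordinates in [S]. *)
Lemma acyclic_half_coord i S (b : bool) j : i \notin S ->
  acyclic_in (R := R) ([set x | 0 < (-1) ^+ b * l i x] `|` some_coord_neq0 S) j.
Proof.
move=> iS; apply: (@acyclic_star _ _ _ ((-1) ^+ b *: e i)).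
  by left; rewrite /= coordZ le eqxx mulr1 -expr2 sqrr_sign ltr01.
move=> x u + /andP[u0 u1].
have sgn : (-1) ^+ b * (-1) ^+ b = 1 :> R by rewrite -expr2 sqrr_sign.
have [->|un1] := eqVneq u 1.
  by move=> _; left; rewrite subrr scale0r addr0 scale1r /= coordZ le eqxx mulr1 sgn ltr01.
have u1' : 0 < 1 - u by rewrite subr_gt0 lt_neqAle un1.
case=> [/= xi|[s sS xs]]; [left|right].
  rewrite /= coordD !coordZ le eqxx mulr1 mulrDr mulrCA sgn mulr1 mulrCA.
  by rewrite ltr_wpDl// mulr_gt0.
exists s => //; rewrite coordD !coordZ le.
have -> : (s == i) = false by apply/negbTE; apply: contraNneq iS => <-.
by rewrite !mulr0 add0r mulf_neq0// gt_eqF.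
Qed.

Lemma simplex0_eq (t t' : simplex R 0) : t = t'.
Proof.
apply: val_inj; apply/rowP => i; rewrite ord1.
by have [_] := set_val_std t; have [_] := set_val_std t'; rewrite !big_ord1 => <- <-.
Qed.

(** The set is a homotopy sphere of dimension [size S - 1]. The two half sets of one coordinate
    cover it and meet in the set for the remaining coordinates, as in a suspension. *)
Lemma acyclic_some_coord_neq0 S j : uniq S -> j.+1 != size S ->
  acyclic_in (R := R) (some_coord_neq0 S) j.
Proof.
elim: S j => [|i S IH] j.
  move=> _ _; rewrite (_ : some_coord_neq0 _ = set0); first exact: acyclic_set0.
  by apply/seteqP; split=> x // [].
move=> /= /andP[iS uS].
set A := some_coord_neq0 (i :: S).
pose H (b : bool) := [set x | 0 < (-1) ^+ b * l i x] `|` some_coord_neq0 S.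
have oH b : open (H b).
  apply: openU; last exact: open_coord_neq0.
  apply: (@open_comp _ _ (fun x => (-1) ^+ b * l i x) [set y | 0 < y]); last exact: open_gt.
  move=> x _; have c1 : {for x, continuous (fun _ : V => (-1) ^+ b : R)} by exact: cst_continuous.
  by apply: cvgM; [exact: c1|exact: cl].
have AH b : A `&` H b = H b.
  apply/seteqP; split=> [x []//|x Hx]; split=> //.
  case: Hx => [/= x1|[s sS xs]]; last by exists s; rewrite // inE sS orbT.
  exists i; first exact: mem_head.
  by apply: contraTneq x1 => ->; rewrite mulr0 ltxx.
have AHH : A `<=` H false `|` H true.
  move=> x [s]; rewrite inE => /orP[/eqP->|sS] xs; last by left; right; exists s.
  have [x0|x0|x0] := ltgtP 0 (l i x); last by rewrite x0 eqxx in xs.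
    by left; left; rewrite /= mul1r.
  by right; left; rewrite /= expr1 mulN1r oppr_gt0.
have HH : A `&` H false `&` H true = some_coord_neq0 S.
  rewrite AH; apply/seteqP; split=> x; last by split; right.
  move=> [[/= x1|//] [/= x2|//]]; move: x1 x2; rewrite expr0 expr1 mul1r mulN1r oppr_gt0 => x1 x2.
  by have := lt_trans x1 x2; rewrite ltxx.
have acH b k : acyclic_in (R := R) (H b) k by exact: acyclic_half_coord.
(* Degree 0 is not reached by Mayer-Vietoris: there [S] is nonempty, and the point [e s0] lies in
   both halves. *)
case: j => [|j] sz; last first.
  apply: (mayer_vietoris_acyclic (oH false) (oH true) AHH); rewrite ?AH//.
  by rewrite -[H false]AH HH; apply: IH => //.
move=> c cc.
have HA b : H b `<=` A by rewrite -(AH b) => x [].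
have [k1 k1P] := acH false 0%N c (fun s h => cc s (simplex_in_sub (HA _) h)).
have [k2 k2P] := acH true 0%N c (fun s h => cc s (simplex_in_sub (HA _) h)).
have [s0 s0S] : exists s, s \in S by case: S sz {IH iS uS A H oH AH AHH HH acH cc HA k1P k2P} => // s S _; exists s; exact: mem_head.
have s0P : some_coord_neq0 S (e s0) by exists s0; rewrite // le eqxx oner_eq0.
have k12 : k1 = k2.
  rewrite -(k1P (fun=> e s0)); last by split=> [|t]; [exact: cst_continuous|right].
  by apply: k2P; split=> [|t]; [exact: cst_continuous|right].
exists k1 => s [cs As].
pose t0 := simplex_vertex 0 : simplex R 0.
have [Ht|Ht] := AHH _ (As t0).
  by apply: k1P; split=> // t; rewrite (simplex0_eq t t0).
by rewrite k12; apply: k2P; split=> // t; rewrite (simplex0_eq t t0).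
Qed.

End CoordinateComplement.

(** * Singular cohomology of a subspace through cochains on the ambient space *)

Section Transfer.
Context {R : realType} {T : topologicalType} (X : set T).

Lemma lift_continuous p (s : simplex R p -> T) (sX : simplex_in X s) :
  continuous (fun t => exist _ (s t) (mem_set (sX.2 t)) : set_type X).
Proof. by apply: continuous_comp_initial; exact: sX.1. Qed.

Definition lift_simplex p (s : simplex R p -> T) (sX : simplex_in X s) :
    singular_simplex R (set_type X) p :=
  exist (fun f : simplex R p -> set_type X => continuous f) _ (@lift_continuous p s sX).

Definition drop_simplex p (s : singular_simplex R (set_type X) p) : simplex R p -> T :=
  set_val \o sval s.

Lemma drop_simplex_in p (s : singular_simplex R (set_type X) p) : simplex_in X (drop_simplex s).
Proof.
split=> [t|t]; last exact: set_valP.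
by apply: continuous_comp; [exact: (svalP s)|exact: initial_continuous].
Qed.

Lemma singular_simplex_eq p (s s' : singular_simplex R (set_type X) p) :
  (forall t, set_val (sval s t) = set_val (sval s' t)) -> s = s'.
Proof.
case: s s' => [f cf] [g cg] /= fg.
have E : f = g by apply: funext => t; exact/val_inj/fg.
by subst g; congr exist; exact: Prop_irrelevance.
Qed.

(** In positive degree reduced and unreduced cohomology agree. A cocycle on the subspace is extended
    by zero to all functions, and the primitive found there is restricted. *)
Lemma singular_cohomology_eq0 j : acyclic_in (R := R) X j.+1 ->
  forall c : singular_cohomology R (set_type X) j.+1, c = 0.
Proof.
move=> acX c; elim/quotW: c => z.
have z0 : coboundary (z : cochain R (set_type X) j.+1) = 0.
  by case: z => z /= /asboolP.
pose c0 (s : simplex R j.+1 -> T) : int :=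
  if pselect (simplex_in X s) is left sX then (z : cochain _ _ _) (lift_simplex sX) else 0.
have [|b bP] := acX c0.
  move=> s sX.
  transitivity (coboundary (z : cochain R (set_type X) j.+1) (lift_simplex sX)); last by rewrite z0.
  apply: eq_bigr => i _; congr (_ * _).
  rewrite /c0; case: pselect => [sX'|[]]; last exact: simplex_in_face.
  by congr (cochain_of z _); exact: singular_simplex_eq.
suff zB : z - 0 \in @is_coboundary R (set_type X) j.+1.
  move: zB; rewrite Quotient.idealrBE => /eqP ->.
  by rewrite piE.
rewrite subr0; apply/asboolP; exists (fun s => b (drop_simplex s)) => //.
apply: funext => s.
have sX := drop_simplex_in s.
transitivity (c0 (drop_simplex s)); first by rewrite (bP _ sX).
rewrite /c0; case: pselect => [sX'|//].
by congr (cochain_of z _); exact: singular_simplex_eq.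
Qed.

End Transfer.

(** * Triangular charts of a Hermitian matrix *)

Section MatrixPreliminaries.
Context {C : numClosedFieldType} {n : nat}.
Implicit Types (A B M S Z X : 'M[C]_n) (y z : 'cV[C]_n).

Definition ct m p (A : 'M[C]_(m, p)) : 'M[C]_(p, m) := map_mx Num.conj A^T.

Lemma ctE m p (A : 'M[C]_(m, p)) i j : ct A i j = (A j i)^*.
Proof. by rewrite !mxE. Qed.

Lemma ctM m p q (A : 'M[C]_(m, p)) (B : 'M[C]_(p, q)) : ct (A *m B) = ct B *m ct A.
Proof. by rewrite /ct trmx_mul map_mxM. Qed.

Lemma ctK m p (A : 'M[C]_(m, p)) : ct (ct A) = A.
Proof. by apply/matrixP => i j; rewrite !ctE conjCK. Qed.

Lemma hermP A : (A \is hermsymmx) = (A == ct A).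
Proof. by rewrite is_hermitianmxE expr0 scale1r. Qed.

Lemma mxM1 A B : A *m B = 1%:M -> A \in unitmx /\ invmx A = B.
Proof.
move=> AB; have [uA _] := mulmx1_unit AB; split=> //.
by rewrite -[RHS]mul1mx -(mulVmx uA) -mulmxA AB mulmx1.
Qed.

Lemma ct_self_ge0 m (y : 'cV[C]_m) : 0 <= (ct y *m y) 0 0.
Proof. by rewrite mxE sumr_ge0// => i _; rewrite ctE mulrC mul_conjC_ge0. Qed.

Lemma ct_self_eq0 m (y : 'cV[C]_m) : (ct y *m y) 0 0 = 0 -> y = 0.
Proof.
rewrite mxE => /psumr_eq0P y0; apply/colP => i; rewrite mxE.
have y1 (k : 'I_m) : true -> 0 <= ct y 0 k * y k 0.
  by move=> _; rewrite ctE mulrC mul_conjC_ge0.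
have /eqP := y0 y1 i isT; rewrite ctE mulrC mul_conjC_eq0 => /eqP//.
Qed.

(** For a preorder these matrices form its incidence algebra. *)
Definition rel_supported (rho : rel 'I_n) A := forall i j, ~~ rho i j -> A i j = 0.

Lemma rel_supportedM rho A B : transitive rho -> rel_supported rho A -> rel_supported rho B ->
  rel_supported rho (A *m B).
Proof.
move=> tr rA rB i j ij; rewrite mxE big1// => k _.
have [ik|/rA->] := boolP (rho i k); last by rewrite mul0r.
have [kj|/rB->] := boolP (rho k j); last by rewrite mulr0.
by rewrite (tr _ _ _ ik kj) in ij.
Qed.

Lemma rel_supported_scalar rho (a : C) : reflexive rho -> rel_supported rho a%:M.
Proof.
by move=> rr i j ij; rewrite mxE; case: eqP ij => [->|]; rewrite ?rr.
Qed.

(** Back substitution, well founded because [rho] strictly decreases the rank [r] off the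
    diagonal. *)
Lemma rel_supported_inv (r : 'I_n -> nat) rho Z X : reflexive rho -> transitive rho ->
  (forall i j, rho i j -> i != j -> (r j < r i)%N) ->
  rel_supported rho Z -> (forall i, Z i i != 0) -> Z *m X = 1%:M ->
  rel_supported rho X /\ forall i, X i i = (Z i i)^-1.
Proof.
move=> rr tr rk rZ Z0 ZX.
have E i j : Z i i * X i j = (i == j)%:R - \sum_(k | k != i) Z i k * X k j.
  have := congr1 (fun N : 'M[C]_n => N i j) ZX; rewrite !mxE (bigD1 i)//= => <-.
  by rewrite addrK.
have rX : rel_supported rho X.
  move=> i; have [m] := ubnP (r i); elim: m i => // m IH i im j ij.
  apply: (mulfI (Z0 i)); rewrite E mulr0 big1 ?subr0.
    by case: eqP ij => // ->; rewrite rr.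
  move=> k ki; have [ik|/rZ->] := boolP (rho i k); last by rewrite mul0r.
  rewrite IH ?mulr0//; first by apply: leq_trans (rk _ _ ik _) im; rewrite eq_sym.
  by apply: contra ij; exact: tr.
split=> // i; apply: (mulfI (Z0 i)); rewrite E eqxx divff// big1 ?subr0// => k ki.
have [ik|/rZ->] := boolP (rho i k); last by rewrite mul0r.
rewrite rX ?mulr0//; apply/negP => kl.
have ri : (r k < r i)%N by apply: rk => //; rewrite eq_sym.
by have := ltn_trans ri (rk _ _ kl ki); rewrite ltnn.
Qed.

Definition lowermx A := rel_supported (fun i j => (j <= i)%N) A.
Definition uppermx A := rel_supported (fun i j => (i <= j)%N) A.
(** Membership in the [k]-th step of the standard flag. *)
Definition supp_lt k y := forall i : 'I_n, (k <= i)%N -> y i 0 = 0.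

Lemma lowermx_inv Z X : lowermx Z -> (forall i, Z i i != 0) -> Z *m X = 1%:M ->
  lowermx X /\ forall i, X i i = (Z i i)^-1.
Proof.
apply: (rel_supported_inv (r := val)) => [i|j i k ij jk|i j ij ne]; first exact: leqnn.
  exact: leq_trans jk ij.
by rewrite ltn_neqAle ij eq_sym ne.
Qed.

Lemma uppermx_inv Z X : uppermx Z -> (forall i, Z i i != 0) -> Z *m X = 1%:M ->
  uppermx X /\ forall i, X i i = (Z i i)^-1.
Proof.
apply: (rel_supported_inv (r := fun i : 'I_n => (n - i)%N)) => [i|j i k ij jk|i j ij ne].
- exact: leqnn.
- exact: leq_trans ij jk.
- have : (i < j)%N by rewrite ltn_neqAle ij ne.
  by have := ltn_ord j; lia.
Qed.

Lemma trigmx_unit A : lowermx A \/ uppermx A -> (forall i, A i i != 0) -> A \in unitmx.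
Proof.
move=> tA A0.
have : \det A = \prod_i A i i.
  case: tA => tA; first by apply: det_trig; apply/is_trig_mxP => i j ij; apply: tA; rewrite -ltnNge.
  rewrite -det_tr det_trig; first by apply: eq_bigr => i _; rewrite mxE.
  by apply/is_trig_mxP => i j ij; rewrite mxE; apply: tA; rewrite -ltnNge.
by rewrite unitmxE unitfE => ->; apply/prodf_neq0 => i _; exact: A0.
Qed.

Lemma uppermx_supp_lt A y k : uppermx A -> supp_lt k y -> supp_lt k (A *m y).
Proof.
move=> uA sy i ki; rewrite mxE big1// => j _.
have [ij|ij] := leqP i j; first by rewrite sy ?mulr0// (leq_trans ki).
by rewrite uA ?mul0r// -ltnNge.
Qed.

Lemma lowermx_supp_lt_eq0 A y k : lowermx A -> (forall i, A i i != 0) -> supp_lt k y ->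
  (forall i : 'I_n, (i < k)%N -> (A *m y) i 0 = 0) -> y = 0.
Proof.
move=> lA A0 sy Ay; apply/colP => i; rewrite mxE.
have [m] := ubnP (val i); elim: m i => // m IH i im.
have [ik|/sy//] := ltnP i k.
have := Ay i ik; rewrite mxE (bigD1 i)//= big1 ?addr0.
  by move/eqP; rewrite mulf_eq0 (negPf (A0 i)) => /eqP.
move=> j ji; have [ij|ij] := ltnP i j; first by rewrite lA ?mul0r// -ltnNge.
by rewrite IH ?mulr0//; move: ji im; rewrite -(inj_eq val_inj)/=; lia.
Qed.

Lemma lowermxM_diag A B i : lowermx A -> lowermx B -> (A *m B) i i = A i i * B i i.
Proof.
move=> lA lB; rewrite mxE (bigD1 i)//= big1 ?addr0// => k ki.
have [ki'|ki'] := ltnP i k; first by rewrite lA ?mul0r// -ltnNge.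
rewrite lB ?mulr0// -ltnNge ltn_neqAle ki' andbT.
by apply: contra_neq ki => /val_inj.
Qed.

End MatrixPreliminaries.

Lemma lup_decomposition {C : numClosedFieldType} {n : nat} (S : 'M[C]_n) : S \in unitmx ->
  exists (w : 'S_n) L U, [/\ perm_mx w *m S = L *m U, lowermx L, forall i, L i i = 1,
    uppermx U & U \in unitmx].
Proof.
case: n S => [|n] S uS.
  exists 1%g, 1%:M, 1%:M; split; rewrite ?unitmx1//; try by case.
  by apply/matrixP; case.
have := cormen_lup_correct S; have := cormen_lup_perm S.
have := cormen_lup_lower S; have := @cormen_lup_upper _ _ S; have := cormen_lup_detL S.
case: cormen_lup => [[P L] U] /= dL uU lL /is_perm_mxP[w ->] PLU.
exists w, L, U; split=> //.
- by move=> i j; rewrite -ltnNge => ij; rewrite lL ?(ltnW ij)// -val_eqE (ltn_eqF ij).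
- by move=> i; rewrite lL// eqxx.
- by move=> i j; rewrite -ltnNge => ij; rewrite uU.
- have : L *m U \in unitmx by rewrite -[_ *m _]PLU unitmx_mul unitmx_perm.
  by rewrite unitmx_mul => /andP[].
Qed.

(** * Spectral projectors and triangular frames *)

Section SpectralProjectors.
Context {C : numClosedFieldType} {n : nat} (lam : 'I_n -> C).
Hypothesis lam_inj : injective lam.
Implicit Types (A B M S Z X : 'M[C]_n) (y z : 'cV[C]_n) (w : 'S_n).

(** Lagrange interpolation polynomial evaluated at [A]: for a matrix with spectrum [lam] it is the
    projector onto an eigenspace, and it is polynomial in the entries of every [A]. *)
Definition eigproj (i : 'I_n) A : 'M[C]_n :=
  \prod_(j | j != i) ((lam i - lam j)^-1 *: (A - (lam j)%:M)).

Definition eigdiag w : 'M[C]_n := diag_mx (\row_k lam (w k)).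

(** The rows of [S] are left eigenvectors, listed in the order [w]. *)
Definition eigbasis w A S := S \in unitmx /\ S *m A = eigdiag w *m S.

Lemma eigproj_conj i S A B : S \in unitmx -> S *m A = B *m S ->
  S *m eigproj i A = eigproj i B *m S.
Proof.
move=> uS SA; rewrite /eigproj.
apply: (big_rec2 (fun a b : 'M[C]_n => S *m a = b *m S)) => [|j a b ji ab].
  by rewrite mulmx1 mul1mx.
rewrite -[LHS]/(S *m (((lam i - lam j)^-1 *: (A - (lam j)%:M)) *m a)).
rewrite -[RHS]/(((lam i - lam j)^-1 *: (B - (lam j)%:M)) *m b *m S).
rewrite mulmxA -[RHS]mulmxA -ab mulmxA; congr (_ *m _).
by rewrite -scalemxAr -scalemxAl mulmxBr mulmxBl SA scalar_mxC.
Qed.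

Lemma prod_diag_mx (r : seq 'I_n) (P : pred 'I_n) (d : 'I_n -> 'I_n -> C) :
  \prod_(j <- r | P j) (diag_mx (\row_k d j k) : 'M[C]_n) =
  diag_mx (\row_k \prod_(j <- r | P j) d j k).
Proof.
elim: r => [|j r IH].
  rewrite big_nil; apply/matrixP => a b; rewrite !mxE big_nil.
  by case: eqP.
rewrite big_cons IH; case: ifP => Pj; last first.
  by congr diag_mx; apply/rowP => k; rewrite !mxE big_cons Pj.
rewrite -[LHS]/(_ *m _) mulmx_diag; congr diag_mx; apply/rowP => k.
by rewrite !mxE big_cons Pj.
Qed.

Lemma eigproj_eigdiag w i : eigproj (w i) (eigdiag w) = delta_mx i i.
Proof.
pose d j k := (lam (w i) - lam j)^-1 * (lam (w k) - lam j).
have -> : eigproj (w i) (eigdiag w) = diag_mx (\row_k \prod_(j | j != w i) d j k).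
  rewrite -prod_diag_mx; apply: eq_bigr => j _; apply/matrixP => a b; rewrite !mxE.
  by case: eqP => [->|_]; rewrite ?mulr1n ?mulr0n ?subr0 ?mulr0.
apply/matrixP => a b; rewrite !mxE /d; have [<-|ab] := eqVneq a b; last first.
  rewrite mulr0n; case: eqP => [ai|//]; case: eqP => // bi.
  by rewrite ai bi eqxx in ab.
rewrite mulr1n andbb; have [->|ai] := eqVneq a i.
  rewrite big1// => j ji; rewrite mulVf// subr_eq0.
  by apply: contra_neq ji => /lam_inj.
by rewrite (bigD1 (w a)) ?(inj_eq perm_inj)//= subrr mulr0 mul0r.
Qed.

Lemma eigprojE w A S i : eigbasis w A S -> S *m eigproj (w i) A = delta_mx i i *m S.
Proof. by move=> [uS SA]; rewrite (eigproj_conj _ uS SA) eigproj_eigdiag. Qed.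

Lemma delta_mulmx p i (Z : 'M[C]_(n, p)) k j :
  (delta_mx i i *m Z) k j = (k == i)%:R * Z i j.
Proof.
rewrite mxE (bigD1 i)//= mxE eqxx andbT big1 ?addr0// => l li.
by rewrite mxE (negPf li) andbF mul0r.
Qed.

Lemma eigproj_eq0 w A S i y : eigbasis w A S ->
  (eigproj (w i) A *m y == 0) = ((S *m y) i 0 == 0).
Proof.
move=> eS; have [uS _] := eS.
have E : S *m (eigproj (w i) A *m y) = delta_mx i i *m (S *m y).
  by rewrite !mulmxA (eigprojE i eS).
apply/eqP/eqP => [P0|P0].
  have := congr1 (fun z : 'cV[C]_n => z i 0) E.
  by rewrite P0 mulmx0 delta_mulmx eqxx mul1r mxE => <-.
rewrite -[LHS]mul1mx -(mulVmx uS) -mulmxA E.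
rewrite (_ : delta_mx i i *m (S *m y) = 0) ?mulmx0//.
by apply/colP => k; rewrite delta_mulmx P0 mulr0 mxE.
Qed.

(* The flag spanned by the first basis vectors is transverse to the eigenspaces
   of [lam (w k)], [lam (w k.+1)], ... of [A]. *)
Definition nondeg w A := forall (k : nat) y, supp_lt k y ->
  (forall i : 'I_n, (i < k)%N -> eigproj (w i) A *m y = 0) -> y = 0.

Lemma lower_upper_nondeg w A S L U : eigbasis w A S -> S = L *m U -> lowermx L ->
  (forall i, L i i != 0) -> uppermx U -> U \in unitmx -> nondeg w A.
Proof.
move=> eS SLU lL L0 uU unU k y sy Py.
have Uy : U *m y = 0.
  apply: (lowermx_supp_lt_eq0 lL L0 (uppermx_supp_lt uU sy)) => i ik.
  by have /eqP := Py i ik; rewrite (eigproj_eq0 _ _ eS) SLU -mulmxA => /eqP.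
by rewrite -[y]mul1mx -(mulVmx unU) -mulmxA Uy mulmx0.
Qed.

Lemma eigbasis_perm w A S : eigbasis 1 A S -> eigbasis w A (perm_mx w *m S).
Proof.
move=> [uS SA]; split; first by rewrite unitmx_mul unitmx_perm.
rewrite -mulmxA SA !mulmxA; congr (_ *m _); apply/matrixP => i j.
rewrite -row_permE -[perm_mx w]mulmx1 -row_permE !mxE.
rewrite (bigD1 i)//= big1 ?addr0.
  by rewrite !mxE eqxx mulr1n perm1; case: eqP; rewrite ?mulr1n ?mulr0n ?mulr1 ?mulr0.
by move=> k ki; rewrite mxE eq_sym (negPf ki) mulr0n mul0r.
Qed.

(** Row pivoting in the LUP decomposition of an eigenbasis finds an order for which no leading minor
    vanishes. *)
Lemma nondeg_exists A S : eigbasis 1 A S -> exists w, nondeg w A.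
Proof.
move=> eS; have [w [L [U [SLU lL L1 uU unU]]]] := lup_decomposition eS.1.
exists w; apply: (lower_upper_nondeg (eigbasis_perm w eS) SLU lL) => // i.
by rewrite L1 oner_neq0.
Qed.

Definition unitary S := S *m ct S = 1%:M.

Lemma unitaryV S : unitary S -> ct S *m S = 1%:M.
Proof. exact: mulmx1C. Qed.

Lemma unitary_unit S : unitary S -> S \in unitmx.
Proof. by move=> /mxM1[]. Qed.

Definition diag_lt k : 'M[C]_n := diag_mx (\row_i (i < k)%:R).

Lemma diag_ltM p k (Z : 'M[C]_(n, p)) i j : (diag_lt k *m Z) i j = (i < k)%:R * Z i j.
Proof. by rewrite mul_diag_mx !mxE. Qed.

Definition eigprojs_lt w k A : 'M[C]_n := \sum_(i < n | (i < k)%N) eigproj (w i) A.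

Lemma eigprojs_ltE w k A S : unitary S -> eigbasis w A S ->
  eigprojs_lt w k A = ct S *m diag_lt k *m S.
Proof.
move=> oS eS; rewrite -[LHS]mul1mx -(unitaryV oS) -!mulmxA; congr (_ *m _).
rewrite mulmx_sumr; under eq_bigr do rewrite (eigprojE _ eS).
apply/matrixP => a b; rewrite diag_ltM summxE.
under eq_bigr do rewrite delta_mulmx.
have [ak|ak] := ltnP a k; last first.
  rewrite mul0r big1// => i ik; case: eqVneq => [ai|_]; last by rewrite mul0r.
  by rewrite -ai ltnNge ak in ik.
rewrite mul1r (bigD1 a)//= eqxx mul1r big1 ?addr0// => i /andP[_ ia].
by rewrite eq_sym (negPf ia) mul0r.
Qed.

Lemma eigproj_unitaryE w i A S : unitary S -> eigbasis w A S ->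
  eigproj (w i) A = ct S *m delta_mx i i *m S.
Proof.
move=> oS eS; rewrite -[LHS]mul1mx -(unitaryV oS) -!mulmxA; congr (_ *m _).
exact: eigprojE.
Qed.

(** First [k] rows from [A], the others from the identity. With [k = j] and right-hand side
    [delta_mx j 0], a solution has last nonzero entry 1 at [j] and is annihilated by the first [j]
    rows of [A]. *)
Definition ortho_sys A k : 'M[C]_n := diag_lt k *m A + (1%:M - diag_lt k).

Lemma ortho_sysE p A k (Z : 'M[C]_(n, p)) i j :
  (ortho_sys A k *m Z) i j = if (i < k)%N then (A *m Z) i j else Z i j.
Proof.
rewrite mulmxDl mulmxBl mul1mx -mulmxA mxE diag_ltM [X in _ + X]mxE [X in _ + (_ + X)]mxE diag_ltM.
by case: ifP; rewrite ?mul1r ?mul0r ?subrr ?addr0 ?subr0 ?add0r.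
Qed.

Lemma unitmx_inj A : (forall y, A *m y = 0 -> y = 0) -> A \in unitmx.
Proof.
move=> A0; rewrite -unitmx_tr unitmxE unitfE; apply/negP => /det0P[v v0 vA].
move/negP: v0; apply; apply/eqP.
by rewrite -[v]trmxK (A0 v^T) ?trmx0// -[A]trmxK -trmx_mul vA trmx0.
Qed.

Lemma unitmx_notinj A : A \notin unitmx -> exists2 y : 'cV[C]_n, A *m y = 0 & y != 0.
Proof.
rewrite -unitmx_tr unitmxE unitfE negbK => /det0P[v v0 vA].
by exists v^T; rewrite ?trmx_eq0// -[A]trmxK -trmx_mul vA trmx0.
Qed.

Lemma ortho_sys_unit A k :
  (forall y, supp_lt k y -> (ct y *m A *m y) 0 0 = 0 -> y = 0) -> ortho_sys A k \in unitmx.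
Proof.
move=> A0; apply: unitmx_inj => y Ny.
have Nyi i : (ortho_sys A k *m y) i 0 = 0 by rewrite Ny mxE.
have sy : supp_lt k y by move=> i ki; have := Nyi i; rewrite ortho_sysE ltnNge ki.
apply: A0 => //; rewrite -mulmxA mxE big1// => i _.
have [ik|/sy yi] := ltnP i k; last by rewrite ctE yi conjC0 mul0r.
by have := Nyi i; rewrite ortho_sysE ik => ->; rewrite mulr0.
Qed.

Definition ortho_vec A (j : 'I_n) : 'cV[C]_n := invmx (ortho_sys A j) *m delta_mx j 0.

Lemma ortho_vec_uniq A (j : 'I_n) y : ortho_sys A j \in unitmx -> supp_lt j.+1 y ->
  (forall i : 'I_n, (i < j)%N -> (A *m y) i 0 = 0) -> y = y j 0 *: ortho_vec A j.
Proof.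
move=> uN sy Ay; rewrite -[LHS]mul1mx -(mulVmx uN) -mulmxA scalemxAr; congr (_ *m _).
apply/colP => i; rewrite ortho_sysE [RHS]mxE [delta_mx _ _ _ _]mxE andbT.
have [ij|ji] := ltnP i j; first by rewrite Ay// (negPf (_ : i != j)) ?mulr0// neq_ltn ij.
have [->|ne] := eqVneq i j; first by rewrite mulr1.
by rewrite mulr0 sy// ltn_neqAle ji andbT eq_sym.
Qed.

Lemma ortho_vecP A (j : 'I_n) (y := ortho_vec A j) : ortho_sys A j \in unitmx ->
  [/\ supp_lt j.+1 y, y j 0 = 1 & forall i : 'I_n, (i < j)%N -> (A *m y) i 0 = 0].
Proof.
move=> uN; have E : ortho_sys A j *m y = delta_mx j 0 by rewrite mulKVmx.
have Ei (i : 'I_n) : (ortho_sys A j *m y) i 0 = (i == j)%:R by rewrite E mxE andbT.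
split=> [i ji||i ij].
- have := Ei i; rewrite ortho_sysE ltnNge (ltnW ji) /= => ->.
  by rewrite (negPf (_ : i != j))// neq_ltn ji orbT.
- by have := Ei j; rewrite ortho_sysE ltnn eqxx.
- by have := Ei i; rewrite ortho_sysE ij => ->; rewrite (negPf (_ : i != j))// neq_ltn ij.
Qed.

(** Gram-Schmidt in closed form: directions from the systems of [Q j], lengths from the forms [P j].
    The absolute value changes nothing where the form is positive and makes the root continuous
    everywhere. *)
Definition ortho_mx (Q P : 'I_n -> 'M[C]_n) : 'M[C]_n :=
  \matrix_(i, j) (ortho_vec (Q j) j i 0 /
    sqrtC `|(ct (ortho_vec (Q j) j) *m P j *m ortho_vec (Q j) j) 0 0|).

Lemma ortho_mxP (Q P : 'I_n -> 'M[C]_n) (b := ortho_mx Q P) :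
  (forall j, ortho_sys (Q j) j \in unitmx) ->
  (forall j, 0 < (ct (ortho_vec (Q j) j) *m P j *m ortho_vec (Q j) j) 0 0) ->
  [/\ uppermx b, forall j, 0 < b j j &
      forall i j : 'I_n, (i < j)%N -> (Q j *m b) i j = 0].
Proof.
move=> uN P0; split=> [i j ij|j|i j ij].
- have [sy _ _] := ortho_vecP (uN j).
  by rewrite mxE sy ?mul0r// ltnNge.
- have [_ y1 _] := ortho_vecP (uN j).
  by rewrite mxE y1 mul1r invr_gt0 sqrtC_gt0 normr_gt0 lt0r_neq0.
- have [_ _ Qy] := ortho_vecP (uN j).
  have := Qy i ij; rewrite !mxE => Qy0.
  under eq_bigr do rewrite mxE mulrA.
  by rewrite -mulr_suml Qy0 mul0r.
Qed.

(** Triangularity of an eigenbasis times this frame is imposed through projectors, so the frame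
    depends on [A] alone and not on the phases of the eigenvectors. *)
Definition chart_frame w A : 'M[C]_n :=
  ortho_mx (fun j => eigprojs_lt w j A) (fun j => eigproj (w j) A).

Lemma diag_lt_idem k : diag_lt k *m diag_lt k = diag_lt k.
Proof. by apply/matrixP => i j; rewrite diag_ltM !mxE; case: (i < k)%N; rewrite ?mul1r ?mul0r ?mul0rn. Qed.

Lemma ct_diag_lt k : ct (diag_lt k) = diag_lt k.
Proof.
apply/matrixP => i j; rewrite ctE !mxE eq_sym; case: eqP => [->|_]; last by rewrite mulr0n conjC0.
by rewrite mulr1n conjC_nat.
Qed.

(** The sum of the first projectors is an orthogonal projector, so its form vanishes only on vectors
    that it kills; [nondeg] excludes these in the flag. *)
Lemma eigprojs_lt_unit w A S (j : nat) : unitary S -> eigbasis w A S -> nondeg w A ->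
  ortho_sys (eigprojs_lt w j A) j \in unitmx.
Proof.
move=> oS eS nd; apply: ortho_sys_unit => y sy.
rewrite (eigprojs_ltE _ oS eS).
have -> : ct y *m (ct S *m diag_lt j *m S) *m y =
    ct (diag_lt j *m (S *m y)) *m (diag_lt j *m (S *m y)).
  rewrite !ctM ct_diag_lt !mulmxA; congr (_ *m _ *m _).
  by rewrite -[_ *m diag_lt j in RHS]mulmxA diag_lt_idem.
move=> /ct_self_eq0 Dy; apply: (nd j) => // i ij; apply/eqP.
rewrite (eigproj_eq0 _ _ eS); have := congr1 (fun z : 'cV[C]_n => z i 0) Dy.
by rewrite diag_ltM ij mul1r => ->; rewrite mxE.
Qed.

Lemma upper_vector_exists w A S (j : 'I_n) : eigbasis w A S -> nondeg w A ->
  exists y, [/\ supp_lt j.+1 y, y j 0 = 1 & forall i : 'I_n, (i < j)%N -> (S *m y) i 0 = 0].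
Proof.
move=> eS nd.
(* The first [j] rows of [S], a zero row, then rows of the identity: [Z] is singular, and a rescaled
   kernel vector is the wanted [y]. *)
pose Z : 'M[C]_n := \matrix_(a, b)
  (if (a < j)%N then S a b else if a == j then 0 else (a == b)%:R).
have [uZ|/unitmx_notinj[y Zy y0]] := boolP (Z \in unitmx).
  have := congr1 (fun N : 'M[C]_n => N j j) (mulmxV uZ); rewrite !mxE eqxx big1.
    by move=> /eqP; rewrite eq_sym oner_eq0.
  by move=> k _; rewrite mxE ltnn eqxx mul0r.
have Zi i : (Z *m y) i 0 = 0 by rewrite Zy mxE.
have Sy (i : 'I_n) : (i < j)%N -> (S *m y) i 0 = 0.
  by move=> ij; rewrite -(Zi i) !mxE; apply: eq_bigr => k _; rewrite mxE ij.
have sy : supp_lt j.+1 y.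
  move=> i ji; rewrite -(Zi i) mxE (bigD1 i)//= big1 ?addr0.
    rewrite mxE ltnNge (ltnW ji) /= eqxx (negPf (_ : i != j)) ?mul1r//.
    by rewrite neq_ltn ji orbT.
  move=> k ki; rewrite mxE ltnNge (ltnW ji) /= [i == k]eq_sym (negPf ki).
  by case: ifP; rewrite mul0r.
have yj : y j 0 != 0.
  apply: contra_neq y0 => yj; apply: (nd j).
    by move=> i; rewrite leq_eqVlt => /orP[/eqP/val_inj <-//|]; exact: sy.
  by move=> i ij; apply/eqP; rewrite (eigproj_eq0 _ _ eS) Sy.
exists ((y j 0)^-1 *: y); split=> [i ji||i ij].
- by rewrite mxE (sy _ ji) mulr0.
- by rewrite mxE mulVf.
- by rewrite -scalemxAr mxE Sy// mulr0.
Qed.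

Lemma chart_vecP w A S (Y := fun j : 'I_n => ortho_vec (eigprojs_lt w j A) j) :
  unitary S -> eigbasis w A S -> nondeg w A ->
  [/\ forall i j : 'I_n, (i < j)%N -> (S *m Y j) i 0 = 0,
      forall j, (S *m Y j) j 0 != 0 &
      forall j, (ct (Y j) *m eigproj (w j) A *m Y j) 0 0 = `|(S *m Y j) j 0| ^+ 2].
Proof.
move=> oS eS nd.
have uN j : ortho_sys (eigprojs_lt w j A) j \in unitmx by exact: eigprojs_lt_unit eS nd.
have SY (i j : 'I_n) : (i < j)%N -> (S *m Y j) i 0 = 0.
  (* The sum of projectors kills what the first [j] rows of [S] kill; so [y] satisfies the equations
     that define [Y j], and uniqueness applies. *)
  have [y [sy y1 Sy]] := upper_vector_exists j eS nd.
  suff <- : y = Y j by exact: Sy.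
  rewrite (@ortho_vec_uniq (eigprojs_lt w j A) j y)// ?y1 ?scale1r// => k kj.
  rewrite (eigprojs_ltE _ oS eS) -!mulmxA mxE big1// => l _.
  rewrite diag_ltM; have [lj|_] := ltnP l j; last by rewrite mul0r mulr0.
  by rewrite Sy// !mulr0.
have PY j : (ct (Y j) *m eigproj (w j) A *m Y j) 0 0 = `|(S *m Y j) j 0| ^+ 2.
  rewrite (eigproj_unitaryE _ oS eS) !mulmxA -ctM -!mulmxA mxE (bigD1 j)//= big1 ?addr0.
    by rewrite delta_mulmx eqxx mul1r ctE normCK mulrC.
  by move=> k kj; rewrite delta_mulmx (negPf kj) mul0r mulr0.
have SY0 j : (S *m Y j) j 0 != 0.
  apply/eqP => SYj; have [sy y1 _] := ortho_vecP (uN j).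
  have : Y j = 0.
    apply: (nd j.+1) => // i; rewrite ltnS leq_eqVlt => /orP[/eqP/val_inj ->|ij];
      by apply/eqP; rewrite (eigproj_eq0 _ _ eS) ?SYj ?SY.
  by move=> Y0; move: y1; rewrite -/(Y j) Y0 mxE => /eqP; rewrite eq_sym oner_eq0.
by [].
Qed.

Lemma chart_form_gt0 w A S (j : 'I_n) (y := ortho_vec (eigprojs_lt w j A) j) :
  unitary S -> eigbasis w A S -> nondeg w A -> 0 < (ct y *m eigproj (w j) A *m y) 0 0.
Proof.
move=> oS eS nd; have [_ y0 ->] := chart_vecP oS eS nd.
by rewrite exprn_gt0// normr_gt0 y0.
Qed.

Lemma chart_frameP w A S (b := chart_frame w A) : unitary S -> eigbasis w A S -> nondeg w A ->
  [/\ uppermx b, forall j, 0 < b j j & exists S', [/\ unitary S', eigbasis w A S',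
      lowermx (S' *m b) & forall j, (S' *m b) j j = 1]].
Proof.
move=> oS eS nd.
have uN j : ortho_sys (eigprojs_lt w j A) j \in unitmx by exact: eigprojs_lt_unit eS nd.
pose Y (j : 'I_n) := ortho_vec (eigprojs_lt w j A) j.
have [SY SY0 PY] := chart_vecP oS eS nd.
have P0 j := chart_form_gt0 j oS eS nd.
have [ub b0 _] := ortho_mxP uN P0.
split=> //.
(* Phases of the diagonal of the triangular product; dividing the rows of [S] by them turns this
   diagonal into ones. *)
pose u j := (S *m Y j) j 0 / `|(S *m Y j) j 0|.
have uu j : (u j)^* * u j = 1.
  by rewrite mulrC -normCK normrM normfV normr_id divff ?expr1n// normr_eq0 SY0.
pose S' := diag_mx (\row_j (u j)^*) *m S.
have oS' : unitary S'.
  rewrite /unitary /S' ctM mulmxA -[_ *m S *m _]mulmxA oS mulmx1.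
  apply/matrixP => i j; rewrite mul_diag_mx !mxE; case: (eqVneq j i) => [->|ne].
    by rewrite mulr1n conjCK uu.
  by rewrite mulr0n conjC0 mulr0.
have bk (k j : 'I_n) : b k j = Y j k 0 / `|(S *m Y j) j 0|.
  by rewrite mxE -/(Y j) PY ger0_norm ?exprn_ge0// sqrCK.
have bE (i j : 'I_n) : (S' *m b) i j = (u i)^* * ((S *m Y j) i 0 / `|(S *m Y j) j 0|).
  rewrite /S' -mulmxA mul_diag_mx [LHS]mxE [X in X * _]mxE; congr (_ * _).
  rewrite mxE [X in _ = X / _]mxE mulr_suml; apply: eq_bigr => k _.
  by rewrite bk mulrA.
exists S'; split=> //.
- split; first exact: unitary_unit.
  rewrite /S' -mulmxA eS.2 !mulmxA; congr (_ *m _).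
  by rewrite /eigdiag !mulmx_diag; congr diag_mx; apply/rowP => k; rewrite !mxE mulrC.
- by move=> i j ij; rewrite bE SY ?mul0r ?mulr0// ltnNge.
- by move=> j; rewrite bE uu.
Qed.

Lemma diag_lower (d : 'rV[C]_n) : lowermx (diag_mx d).
Proof.
by move=> i j; rewrite -ltnNge mxE => ij; rewrite -val_eqE (ltn_eqF ij) mulr0n.
Qed.

Lemma lowermxM A B : lowermx A -> lowermx B -> lowermx (A *m B).
Proof. by apply: rel_supportedM => j i k /= ij jk; exact: leq_trans jk ij. Qed.

Lemma lower_left_eigenvector w A (i : 'I_n) : lowermx A -> (forall k, A k k = lam (w k)) ->
  exists m : 'rV[C]_n, [/\ forall k : 'I_n, (i < k)%N -> m 0 k = 0, m 0 i = 1 &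
    m *m A = lam (w i) *: m].
Proof.
move=> lA dA; pose B := A - (lam (w i))%:M.
(* Rows of [B] up to [i], rows of the identity after it: [Z] is triangular with a zero at [(i, i)],
   and its left kernel is supported on indices up to [i]. *)
pose Z : 'M[C]_n := \matrix_(a, b) (if (a <= i)%N then B a b else (a == b)%:R).
have lB (a b : 'I_n) : (a < b)%N -> B a b = 0.
  by move=> ab; rewrite !mxE lA -?ltnNge// -val_eqE (ltn_eqF ab) mulr0n subr0.
have /eqP/det0P[v v0 vZ] : \det Z = 0.
  rewrite det_trig; last first.
    apply/is_trig_mxP => a b ab; rewrite mxE; case: ifP => _; first exact: lB.
    by rewrite -val_eqE (ltn_eqF ab).
  by rewrite (bigD1 i)//= !mxE leqnn eqxx mulr1n dA subrr mul0r.
have vZk k : (v *m Z) 0 k = 0 by rewrite vZ mxE.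
have vk (k : 'I_n) : (i < k)%N -> v 0 k = 0.
  move=> ik; rewrite -(vZk k) mxE (bigD1 k)//= big1 ?addr0.
    by rewrite mxE leqNgt ik /= eqxx mulr1.
  move=> a ak; rewrite mxE; case: ifP => [ai|_]; last by rewrite (negPf ak) mulr0.
  by rewrite lB ?mulr0// (leq_ltn_trans ai).
have vB k : (v *m B) 0 k = 0.
  rewrite -(vZk k) !mxE; apply: eq_bigr => a _; rewrite [in RHS]mxE.
  by have [ai|ia] := leqP a i; rewrite // vk// !mul0r.
(* Were [v 0 i] zero, all entries would vanish successively from the last index down, since
   simplicity of the spectrum excludes other zero pivots. *)
have vi : v 0 i != 0.
  apply: contra_neq v0 => vi; apply/rowP => t; rewrite mxE.
  have [m] := ubnP (n - t); elim: m t => // m IH t tm.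
  have [->//|ti] := eqVneq t i.
  have := vB t; rewrite mxE (bigD1 t)//= big1 ?addr0.
    rewrite !mxE eqxx mulr1n dA => /eqP; rewrite mulf_eq0 => /orP[/eqP//|].
    by rewrite subr_eq0 => /eqP/lam_inj/perm_inj ti'; rewrite ti' eqxx in ti.
  move=> a at_; have [ta|ta] := ltnP t a; last first.
    by rewrite lB ?mulr0// ltn_neqAle ta andbT; apply: contra_neq at_ => /val_inj.
  by rewrite IH ?mul0r//; have := ltn_ord a; move: ta tm; lia.
exists ((v 0 i)^-1 *: v); split=> [k ik||].
- by rewrite mxE (vk _ ik) mulr0.
- by rewrite mxE mulVf.
- rewrite -scalemxAl scalerA mulrC -scalerA; congr (_ *: _).
  apply/rowP => k; have := vB k.
  by rewrite mulmxBr mul_mx_scalar mxE [X in _ + X]mxE => /eqP; rewrite subr_eq0 => /eqP ->.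
Qed.

Lemma lower_eigbasis w A : lowermx A -> (forall k, A k k = lam (w k)) ->
  exists M, [/\ lowermx M, forall i, M i i = 1 & eigbasis w A M].
Proof.
move=> lA dA; have [f fP] := choice (fun i => lower_left_eigenvector i lA dA).
pose M : 'M[C]_n := \matrix_(i, j) f i 0 j.
have lM : lowermx M.
  by move=> i j; rewrite -ltnNge => ij; rewrite mxE; have [H _ _] := fP i; rewrite H.
have M1 i : M i i = 1 by rewrite mxE; have [_ ->] := fP i.
exists M; split=> //; split.
  by apply: trigmx_unit; [left|move=> i; rewrite M1 oner_neq0].
apply/matrixP => i j; rewrite mul_diag_mx !mxE.
have [_ _ /(congr1 (fun v : 'rV[C]_n => v 0 j))] := fP i.
rewrite !mxE => <-; by apply: eq_bigr => k _; rewrite mxE.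
Qed.

(** If [M] is a unipotent lower triangular eigenbasis, the projector of [w i] is
    [invmx M *m delta_mx i i *m M], whose row [i] is row [i] of [M]. The frame is thus polynomial in
    [A]. *)
Definition lower_frame w A : 'M[C]_n := \matrix_(i, j) eigproj (w i) A i j.

Lemma lower_frame_uniq w A M : lowermx M -> (forall i, M i i = 1) -> eigbasis w A M ->
  M = lower_frame w A.
Proof.
move=> lM M1 eM; have [uM _] := eM; apply/matrixP => i j; rewrite mxE.
have M0 k : M k k != 0 by rewrite M1 oner_neq0.
have [lV dV] := lowermx_inv lM M0 (mulmxV uM).
rewrite -[eigproj _ _]mul1mx -(mulVmx uM) -mulmxA (eigprojE i eM) mxE (bigD1 i)//= big1.
  by rewrite addr0 delta_mulmx eqxx mul1r dV M1 invr1 mul1r.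
by move=> k ki; rewrite delta_mulmx (negPf ki) mul0r mulr0.
Qed.

Lemma lower_frameP w A (M := lower_frame w A) : lowermx A -> (forall k, A k k = lam (w k)) ->
  [/\ lowermx M, forall i, M i i = 1 & eigbasis w A M].
Proof.
move=> lA dA; have [M' [lM' M'1 eM']] := lower_eigbasis lA dA.
by rewrite /M -(lower_frame_uniq lM' M'1 eM').
Qed.

(** For a positive definite [A], the inverse Cholesky factor. *)
Definition gram_frame A : 'M[C]_n := ortho_mx (fun=> A) (fun=> A).

Section GramFrame.
Variable M : 'M[C]_n.
Hypothesis uM : M \in unitmx.
Let K := ct M *m M.

Lemma gram_form y : ct y *m K *m y = ct (M *m y) *m (M *m y).
Proof. by rewrite ctM !mulmxA. Qed.

Lemma gram_eq0 y : (ct y *m K *m y) 0 0 = 0 -> y = 0.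
Proof.
rewrite gram_form => /ct_self_eq0 My.
by rewrite -[y]mul1mx -(mulVmx uM) -mulmxA My mulmx0.
Qed.

Lemma gram_sys_unit k : ortho_sys K k \in unitmx.
Proof. by apply: ortho_sys_unit => y _; exact: gram_eq0. Qed.

Lemma gram_gt0 j : 0 < (ct (ortho_vec K j) *m K *m ortho_vec K j) 0 0.
Proof.
rewrite lt0r gram_form ct_self_ge0 andbT -gram_form; apply/eqP => /gram_eq0 y0.
have [_ y1 _] := ortho_vecP (gram_sys_unit j).
by move: y1; rewrite y0 mxE => /eqP; rewrite eq_sym oner_eq0.
Qed.

Lemma ct_form_col (a : 'M[C]_n) i j :
  (ct a *m K *m a) i j = (ct (col i a) *m K *m col j a) 0 0.
Proof.
rewrite -!mulmxA mxE [RHS]mxE; apply: eq_bigr => k _; rewrite !ctE [col i a k 0]mxE.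
congr (_ * _); rewrite !mulmxA mxE [RHS]mxE; apply: eq_bigr => l _.
by rewrite [col j a l 0]mxE.
Qed.

Lemma gram_frameP (a := gram_frame K) :
  [/\ uppermx a, forall j, 0 < a j j & ct a *m K *m a = 1%:M].
Proof.
have [ua a0 Ka] := ortho_mxP (Q := fun=> K) (P := fun=> K) (fun j => gram_sys_unit j) gram_gt0.
split=> //.
have lt_eq0 (i j : 'I_n) : (i < j)%N -> (ct a *m K *m a) i j = 0.
  move=> ij; rewrite -mulmxA mxE big1// => k _; rewrite ctE.
  have [ki|ik] := leqP k i; first by rewrite Ka ?mulr0// (leq_ltn_trans ki).
  by rewrite ua ?conjC0 ?mul0r// -ltnNge.
have cK : ct K = K by rewrite /K ctM ctK.
apply/matrixP => i j; rewrite [RHS]mxE; have [ij|ji|/val_inj <-] := ltngtP i j.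
- by rewrite lt_eq0// (negPf (_ : i != j))// neq_ltn ij.
- have cG : ct (ct a *m K *m a) = ct a *m K *m a by rewrite ctM ctM ctK cK mulmxA.
  rewrite -cG ctE lt_eq0// conjC0.
  by rewrite (negPf (_ : i != j))// neq_ltn ji orbT.
- set mu := sqrtC `|(ct (ortho_vec K i) *m K *m ortho_vec K i) 0 0|.
  have mu0 : 0 < mu by rewrite sqrtC_gt0 normr_gt0 lt0r_neq0// gram_gt0.
  have aE : col i a = mu^-1 *: ortho_vec K i.
    by apply/colP => k; rewrite [LHS]mxE [LHS]mxE [RHS]mxE mulrC.
  rewrite ct_form_col aE.
  have -> : ct (mu^-1 *: ortho_vec K i) = mu^-1 *: ct (ortho_vec K i).
    apply/rowP => k; rewrite ctE [in LHS]mxE [RHS]mxE ctE rmorphM; congr (_ * _).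
    by apply: conj_Creal; rewrite rpredV; exact: gtr0_real.
  rewrite -scalemxAr -!scalemxAl 2!mxE eqxx -[X in _ * (_ * X)](gtr0_norm (gram_gt0 i)) -[X in _ * (_ * X)](sqrtCK) -/mu.
  by rewrite -[true%:R]/1; field; exact: lt0r_neq0.
Qed.

Lemma gram_frame_uniq (a : 'M[C]_n) : uppermx a -> (forall j, 0 < a j j) ->
  ct a *m K *m a = 1%:M -> a = gram_frame K.
Proof.
move=> ua a0 aKa.
have lca : lowermx (ct a) by move=> i j ij; rewrite ctE ua ?conjC0.
have dca i : ct a i i != 0 by rewrite ctE conjC_eq0 gt_eqF.
have [lKa _] := lowermx_inv lca dca (etrans (mulmxA _ _ _) aKa).
apply/matrixP => i j; rewrite mxE.
have cE : col j a = a j j *: ortho_vec K j.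
  rewrite {1}(@ortho_vec_uniq K j (col j a)) ?gram_sys_unit//.
  - by rewrite mxE.
  - by move=> k jk; rewrite mxE ua// -ltnNge.
  - move=> k kj; rewrite -(lKa k j) -?ltnNge// mxE [RHS]mxE.
    by apply: eq_bigr => l _; rewrite [col j a l 0]mxE.
have /(congr1 (fun z : 'cV[C]_n => z i 0)) := cE; rewrite [LHS]mxE => ->.
rewrite mxE mulrC; congr (_ * _).
have := congr1 (fun N : 'M[C]_n => N j j) aKa; rewrite ct_form_col cE.
have -> : ct (a j j *: ortho_vec K j) = a j j *: ct (ortho_vec K j).
  apply/rowP => k; rewrite ctE [in LHS]mxE [RHS]mxE ctE rmorphM; congr (_ * _).
  by apply: conj_Creal; exact: gtr0_real.
rewrite -scalemxAr -!scalemxAl 2!mxE [RHS]mxE eqxx => E.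
have -> : (ct (ortho_vec K j) *m K *m ortho_vec K j) 0 0 = (a j j)^-1 ^+ 2.
  apply: (mulfI (lt0r_neq0 (a0 j))); apply: (mulfI (lt0r_neq0 (a0 j))).
  by rewrite E -[true%:R]/1; field; exact: lt0r_neq0.
by rewrite ger0_norm ?exprn_ge0 ?invr_ge0 ?(ltW (a0 j))// sqrCK ?invrK// invr_ge0 ltW.
Qed.

End GramFrame.

(** The eigenbasis of the triangular matrix times its Gram frame is unitary, so conjugation by that
    frame yields a Hermitian matrix with the same spectrum. *)
Definition chart_inv w A : 'M[C]_n :=
  let a := gram_frame (ct (lower_frame w A) *m lower_frame w A) in invmx a *m A *m a.

Definition chart w A : 'M[C]_n := invmx (chart_frame w A) *m A *m chart_frame w A.

Lemma chart_invP w A (M := lower_frame w A) (a := gram_frame (ct M *m M)) :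
  lowermx A -> (forall k, A k k = lam (w k)) ->
  [/\ uppermx a, forall j, 0 < a j j, unitary (M *m a), eigbasis w (chart_inv w A) (M *m a) &
    nondeg w (chart_inv w A)].
Proof.
move=> lA dA; have [lM M1 eM] := lower_frameP lA dA; have [uM MA] := eM.
have [ua a0 aKa] := gram_frameP uM.
have una : a \in unitmx by apply: trigmx_unit; [right|move=> i; rewrite gt_eqF].
have oS : unitary (M *m a).
  by rewrite /unitary; apply: mulmx1C; rewrite ctM -mulmxA (mulmxA (ct M)) mulmxA.
have eS : eigbasis w (chart_inv w A) (M *m a).
  split; first exact: unitary_unit.
  by rewrite /chart_inv -/M -/a !mulmxA mulmxK// MA.
split=> //; apply: (lower_upper_nondeg eS (erefl _) lM) => // i.
by rewrite M1 oner_neq0.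
Qed.

(** Both triangular factors are determined, the unipotent eigenbasis by [lower_frame_uniq] and the
    inverse of the chart frame by [gram_frame_uniq]; hence [chart_inv] undoes [chart]. The last
    clause writes an eigenbasis of [A] as lower times upper, the form in which charts are
    compared. *)
Lemma chartP w A S (Z := chart w A) : unitary S -> eigbasis w A S -> nondeg w A ->
  [/\ lowermx Z, forall k, Z k k = lam (w k), chart_inv w Z = A &
    exists r, [/\ uppermx r, r \in unitmx & eigbasis w A (lower_frame w Z *m r)]].
Proof.
move=> oS eS nd; have [ub b0 [S' [oS' eS' lM M1]]] := chart_frameP oS eS nd.
set b := chart_frame w A in ub b0 lM M1; set M := S' *m b in lM M1.
have unb : b \in unitmx by apply: trigmx_unit; [right|move=> i; rewrite gt_eqF].
have [uS' SA'] := eS'.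
have uM : M \in unitmx by rewrite unitmx_mul uS' unb.
have MZ : M *m Z = eigdiag w *m M.
  by rewrite /M /Z /chart -/b !mulmxA mulmxK// SA'.
have M0 i : M i i != 0 by rewrite M1 oner_neq0.
have [lV dV] := lowermx_inv lM M0 (mulmxV uM).
have ZE : Z = invmx M *m (eigdiag w *m M) by rewrite -MZ mulKmx.
have lZ : lowermx Z by rewrite ZE; apply: lowermxM => //; apply: lowermxM => //; exact: diag_lower.
have dZ k : Z k k = lam (w k).
  rewrite ZE lowermxM_diag// ?dV ?M1 ?invr1 ?mul1r; last by apply: lowermxM => //; exact: diag_lower.
  by rewrite lowermxM_diag//; [rewrite M1 mulr1 !mxE eqxx mulr1n|exact: diag_lower].
have ME : M = lower_frame w Z by apply: lower_frame_uniq.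
have [uV dVb] := uppermx_inv ub (fun i => (lt0r_neq0 (b0 i))) (mulmxV unb).
have aE : invmx b = gram_frame (ct M *m M).
  apply: gram_frame_uniq => //.
    by move=> j; rewrite dVb invr_gt0.
  have -> : ct M *m M = ct b *m b.
    by rewrite /M ctM mulmxA -(mulmxA (ct b)) (unitaryV oS') mulmx1.
  have -> : ct (invmx b) *m (ct b *m b) *m invmx b = ct (b *m invmx b) *m (b *m invmx b).
    by rewrite ctM !mulmxA.
  rewrite mulmxV// mulmx1; apply/matrixP => i j; rewrite ctE !mxE eq_sym.
  by case: eqP; rewrite ?conjC1 ?conjC0.
split=> //.
  rewrite /chart_inv -ME -aE invmxK /Z /chart -/b !mulmxA mulmxV// mul1mx mulmxK//.
by exists (invmx b); rewrite -ME /M mulmxK// unitmx_inv.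
Qed.

(** The intersection of two total orders. By [good_not_nondeg] and [bad_nondeg], support in it
    characterizes the chart points that lie in no earlier chart. *)
Definition good_rel w : rel 'I_n := fun i j => (j <= i)%N && (w i <= w j)%N.

Lemma good_rel_refl w : reflexive (good_rel w).
Proof. by move=> i; rewrite /good_rel !leqnn. Qed.

Lemma good_rel_trans w : transitive (good_rel w).
Proof.
move=> j i k /andP[ji wij] /andP[kj wjk].
by rewrite /good_rel (leq_trans kj ji) (leq_trans wij wjk).
Qed.

Lemma rel_supported_eigproj rho i A : reflexive rho -> transitive rho ->
  rel_supported rho A -> rel_supported rho (eigproj i A).
Proof.
move=> rr tr rA; apply: (big_ind (rel_supported rho)).
- exact: rel_supported_scalar.
- by move=> X Y rX rY; exact: (rel_supportedM tr rX rY).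
- move=> j _ a b ab; rewrite !mxE rA// sub0r.
  by case: eqP ab => [->|]; rewrite ?rr// mulr0n oppr0 mulr0.
Qed.

Lemma lower_frame_good w A : rel_supported (good_rel w) A ->
  rel_supported (good_rel w) (lower_frame w A).
Proof.
move=> gA i j ij; rewrite mxE.
apply: (rel_supported_eigproj _ _ _ gA) ij; [exact: good_rel_refl|exact: good_rel_trans].
Qed.

Lemma good_inv w M : rel_supported (good_rel w) M -> (forall i, M i i = 1) -> M \in unitmx ->
  rel_supported (good_rel w) (invmx M).
Proof.
move=> gM M1 uM.
have M0 i : M i i != 0 by rewrite M1 oner_neq0.
have rk (i j : 'I_n) : good_rel w i j -> i != j -> (val j < val i)%N.
  by move=> /andP[ji _] ne; rewrite ltn_neqAle ji andbT eq_sym.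
by have [] := rel_supported_inv (@good_rel_refl w) (@good_rel_trans w) rk gM M0 (mulmxV uM).
Qed.

Lemma good_lower_frame w A : lowermx A -> (forall k, A k k = lam (w k)) ->
  rel_supported (good_rel w) (lower_frame w A) -> rel_supported (good_rel w) A.
Proof.
move=> lA dA gM; have [lM M1 [uM MA]] := lower_frameP lA dA.
have -> : A = invmx (lower_frame w A) *m (eigdiag w *m lower_frame w A) by rewrite -MA mulKmx.
apply: (rel_supportedM (@good_rel_trans w)); first exact: good_inv.
apply: (rel_supportedM (@good_rel_trans w)) => // i j; rewrite mxE.
by case: eqP => [->|_]; rewrite ?good_rel_refl.
Qed.

(* [w'] is below [w] in the lexicographic order that reads permutations from the last entry. *)
Definition lex_lt (w' w : 'S_n) := exists k : 'I_n, (w' k < w k)%N /\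
  forall m : 'I_n, (k < m)%N -> w' m = w m.

(** At the last index [k] where [w'] and [w] differ, [w' k = w c] with [c < k], and goodness makes
    the entry [(k, c)] of [invmx M] zero. Column [c] of [invmx M], cut at [k], then contradicts
    nondegeneracy for [w']. *)
Lemma good_not_nondeg w w' A M r : lowermx M -> (forall i, M i i = 1) ->
  rel_supported (good_rel w) M -> uppermx r -> r \in unitmx -> eigbasis w A (M *m r) ->
  lex_lt w' w -> ~ nondeg w' A.
Proof.
move=> lM M1 gM ur unr eS [k [wk wm]] nd.
have M0 i : M i i != 0 by rewrite M1 oner_neq0.
have uM : M \in unitmx by apply: trigmx_unit => //; left.
have [lV dV] := lowermx_inv lM M0 (mulmxV uM).
have gV := good_inv gM M1 uM.
pose c := (w^-1)%g (w' k).
have wc : w c = w' k by rewrite permKV.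
have ck : (c < k)%N.
  have [//|kc|/val_inj ck] := ltngtP c k; last by rewrite -wc ck ltnn in wk.
  by have := wm _ kc; rewrite wc => /perm_inj ck; rewrite ck ltnn in kc.
pose v := col c (invmx M).
pose z := diag_lt k *m v.
have zE i : z i 0 = (i < k)%:R * invmx M i c by rewrite diag_ltM mxE.
(* For rows up to [k] the cut could matter only through the entry [(k, c)] of [invmx M], which is
   zero. *)
have Mz (m : 'I_n) : (m <= k)%N -> m != c -> (M *m z) m 0 = 0.
  move=> mk mc; transitivity ((M *m invmx M) m c); last by rewrite mulmxV// mxE (negPf mc).
  rewrite !mxE; apply: eq_bigr => l _; rewrite zE.
  have [lk|] := ltnP l k; first by rewrite mul1r.
  rewrite leq_eqVlt => /orP[/eqP/val_inj kl|kl].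
    by rewrite -kl mul0r gV// /good_rel wc (ltnW ck) -ltnNge.
  by rewrite lM ?mul0r// -ltnNge (leq_ltn_trans mk).
pose y := invmx r *m z.
have unV : uppermx (invmx r).
  have r0 i : r i i != 0.
    have dr : \det r = \prod_i r i i.
      rewrite -det_tr det_trig; first by apply: eq_bigr => j _; rewrite mxE.
      by apply/is_trig_mxP => a b ab; rewrite mxE; apply: ur; rewrite -ltnNge.
    by move: unr; rewrite unitmxE unitfE dr => /prodf_neq0/(_ i isT).
  by have [] := uppermx_inv ur r0 (mulmxV unr).
have sy : supp_lt k y.
  apply: uppermx_supp_lt => // i ki; rewrite zE ltnNge ki mul0r//.
have Sy : M *m r *m y = M *m z by rewrite /y -mulmxA mulKVmx.
have y0 : y = 0.
  apply: (nd k) => // i ik; rewrite -[w' i](permKV w).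
  apply/eqP; rewrite (eigproj_eq0 _ _ eS) Sy Mz//.
    rewrite leqNgt; apply/negP => km; have := wm _ km; rewrite permKV => /perm_inj im.
    by move: km; rewrite im ltnNge (ltnW ik).
  by apply: contraTneq ik => /perm_inj/perm_inj ->; rewrite ltnn.
have : z = 0 by rewrite -[z](mulKVmx unr) -/y y0 mulmx0.
move=> /(congr1 (fun z : 'cV[C]_n => z c 0)); rewrite zE ck mul1r dV M1 invr1 mxE => /eqP.
by rewrite oner_eq0.
Qed.

(** Among the nonzero entries of [M] that violate goodness, take one at [(i, j)] with [i - j] least,
    and exchange the values of [w] at [i] and [j]. *)
Lemma bad_nondeg w A M r : lowermx M -> (forall i, M i i = 1) ->
  ~ rel_supported (good_rel w) M -> uppermx r -> r \in unitmx -> eigbasis w A (M *m r) ->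
  exists2 w', lex_lt w' w & nondeg w' A.
Proof.
move=> lM M1 gM ur unr eS.
have M0 i : M i i != 0 by rewrite M1 oner_neq0.
pose P (p : 'I_n * 'I_n) := [&& (p.2 < p.1)%N, (w p.2 < w p.1)%N & M p.1 p.2 != 0].
have [p0 Pp0] : exists p, P p.
  apply: contrapT => noP; apply: gM => i j ij; apply/eqP; apply: contrapT => /negP Mij.
  apply: noP; exists (i, j); rewrite /P /= Mij andbT.
  have ji : (j <= i)%N by rewrite leqNgt; apply/negP => lt; rewrite lM ?eqxx// -ltnNge in Mij.
  move: ij; rewrite /good_rel ji /= -ltnNge => wij; rewrite wij andbT ltn_neqAle ji andbT.
  by apply/eqP => /val_inj E; rewrite E ltnn in wij.
case: (@arg_minnP _ p0 P (fun p => p.1 - p.2)%N Pp0) => -[i j] /and3P[/= ji wji Mij] minP.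
have small (a b : 'I_n) : (w b < w a)%N -> (a - b < i - j)%N -> M a b = 0.
  move=> wba abij; apply/eqP; apply: contrapT => /negP Mab.
  have ba : (b < a)%N.
    rewrite ltnNge leq_eqVlt; apply/negP => /orP[/eqP/val_inj E|lt].
      by rewrite E ltnn in wba.
    by rewrite lM ?eqxx// -ltnNge in Mab.
  by have := minP (a, b); rewrite /P /= ba wba Mab => /(_ isT); rewrite leqNgt abij.
pose w' : 'S_n := (tperm i j * w)%g.
have w'E x : w' x = w (tperm i j x) by rewrite permM.
exists w'.
  exists i; split; first by rewrite w'E tpermL.
  by move=> m im; rewrite w'E tpermD// neq_ltn ?im// ?(ltn_trans ji im).
move=> k y sy Py; pose z := r *m y.
have sz : supp_lt k z by exact: uppermx_supp_lt.
have Mz (a : 'I_n) : (a < k)%N -> (M *m z) (tperm i j a) 0 = 0.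
  move=> ak; have /eqP := Py a ak; rewrite w'E (eigproj_eq0 _ _ eS) -mulmxA.
  by move/eqP.
suff z0 : z = 0 by rewrite -[y](mulKmx unr) -/z z0 mulmx0.
(* For [k <= j] or [k > i] the transposition preserves the set of the first [k] indices, and the
   conditions are those for [w]; only [j < k <= i] is new. *)
have [kj|jk] := leqP k j.
  apply: (lowermx_supp_lt_eq0 lM M0 sz) => a ak.
  rewrite -[a](@tpermD _ i j); first exact: Mz.
    by rewrite neq_ltn (ltn_trans (leq_trans ak kj) ji) orbT.
  by rewrite neq_ltn (leq_trans ak kj) orbT.
have [ki|ik] := leqP k i; last first.
  apply: (lowermx_supp_lt_eq0 lM M0 sz) => a ak.
  rewrite -(tpermK i j a); apply: Mz.
  by case: tpermP => // _.
have Mzc (c : 'I_n) : (c < k)%N -> c != j -> (M *m z) c 0 = 0.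
  move=> ck cj; rewrite -[c](@tpermD _ i j) ?Mz// 1?eq_sym//.
  by rewrite neq_ltn (leq_trans ck ki).
have Mzi : (M *m z) i 0 = 0 by rewrite -(tpermR i j) Mz.
have row_c (c : 'I_n) : (c < k)%N -> c != j -> z c 0 != 0 ->
    exists2 m : 'I_n, (m < c)%N & (M c m != 0) && (z m 0 != 0).
  move=> ck cj zc; apply: contrapT => nom; move/negP: zc; apply.
  have := Mzc c ck cj; rewrite mxE (bigD1 c)//= M1 mul1r big1 ?addr0; first by move=> ->.
  move=> m mc; have [cm|] := ltnP c m; first by rewrite lM ?mul0r// -ltnNge.
  rewrite leq_eqVlt (negPf (_ : val m != val c))//= => mc'.
  apply/eqP; rewrite mulf_eq0; apply: contrapT => /negP; rewrite negb_or => H.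
  by apply: nom; exists m.
(* By minimality, nonzero entries of [z] outside [j] sit at indices [c > j] with [w c <= w j]. Row
   [i] of [M] vanishes at these, again by minimality, so row [i] of the system leaves only
   [M i j * z j 0 = 0]. *)
have goodz (c : 'I_n) : (c < k)%N -> c != j -> z c 0 != 0 -> (j < c)%N && (w c <= w j)%N.
  have [m] := ubnP (val c); elim: m c => // m IH c cm ck cj zc.
  have [l lc /andP[Mcl zl]] := row_c c ck cj zc.
  have [E|lj] := eqVneq l j.
    rewrite -E lc leqNgt; apply/negP => wlc; move/negP: Mcl; apply; apply/eqP.
    by apply: small => //; rewrite E; move: lc ck ki ji; rewrite E; lia.
  have /andP[jl wl] : (j < l)%N && (w l <= w j)%N.
    by apply: IH => //; [rewrite -ltnS; exact: leq_ltn_trans lc cm|exact: ltn_trans lc ck].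
  rewrite (ltn_trans jl lc) /= (leq_trans _ wl)// leqNgt; apply/negP => wlc.
  move/negP: Mcl; apply; apply/eqP; apply: small => //.
  by move: lc ck ki ji jl; lia.
have zj : z j 0 = 0.
  move: Mzi; rewrite mxE (bigD1 j)//= big1 ?addr0.
    by move/eqP; rewrite mulf_eq0 (negPf Mij) => /eqP.
  move=> m mj; have [mk|km] := ltnP m k; last by rewrite sz ?mulr0.
  have [->|zm] := eqVneq (z m 0) 0; first by rewrite mulr0.
  have /andP[jm wm] := goodz m mk mj zm.
  rewrite small ?mul0r//; first exact: leq_ltn_trans wm wji.
  by move: mk ki ji jm; lia.
suff zc0 c : z c 0 = 0 by apply/colP => c; rewrite zc0 mxE.
have [m] := ubnP (val c); elim: m c => // m IH c cm.
have [ck|/sz//] := ltnP c k; have [E|cj] := eqVneq c j; first by rewrite E zj.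
apply/eqP; apply: contrapT => /negP zc.
have [l lc /andP[_]] := row_c c ck cj zc.
by rewrite IH ?eqxx// -ltnS; exact: leq_ltn_trans lc cm.
Qed.

End SpectralProjectors.

(** * Hermitian matrices and unitary eigenbases *)

Section HermitianSpectrum.
Context {C : numClosedFieldType} {n : nat} (lam : 'I_n -> C).
Hypotheses (lam_inj : injective lam) (lam_real : forall i, lam i \is Num.real).
Implicit Types (A S Z X : 'M[C]_n) (w : 'S_n).

Lemma ct_scale m p (c : C) (Z : 'M[C]_(m, p)) : ct (c *: Z) = c^* *: ct Z.
Proof. by apply/matrixP => i j; rewrite ctE [in LHS]mxE [RHS]mxE ctE rmorphM. Qed.

Lemma unitary_perm w S : unitary S -> unitary (perm_mx w *m S).
Proof.
move=> oS; rewrite /unitary ctM mulmxA -(mulmxA (perm_mx w)) oS mulmx1.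
apply/matrixP => i j; rewrite -row_permE mxE ctE !mxE (inj_eq perm_inj) eq_sym.
by rewrite conjC_nat.
Qed.

Lemma unit_multiple (v : 'rV[C]_n) : v != 0 ->
  exists2 c, c != 0 & (c *: v) *m ct (c *: v) = 1%:M.
Proof.
move=> v0; set N := (v *m ct v) 0 0.
have NE : N = (ct (ct v) *m ct v) 0 0 by rewrite ctK.
have N0 : N != 0.
  apply: contra_neq v0; rewrite NE => /ct_self_eq0 v0.
  by rewrite -[v]ctK v0; apply/rowP => i; rewrite ctE !mxE conjC0.
have Ngt0 : 0 < N by rewrite lt0r N0 NE ct_self_ge0.
have s0 : 0 < sqrtC N by rewrite sqrtC_gt0.
exists (sqrtC N)^-1; first by rewrite invr_eq0 lt0r_neq0.
apply/matrixP => i j; rewrite !ord1 ct_scale -scalemxAr -scalemxAl 2!mxE -/N [RHS]mxE eqxx.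
rewrite (conj_Creal (_ : (sqrtC N)^-1 \is Num.real)); last by rewrite rpredV gtr0_real.
by rewrite -[X in _ * (_ * X)](sqrtCK) -[true%:R]/1; field; exact: lt0r_neq0.
Qed.

Lemma herm_eigbasis A : A \is hermsymmx -> (forall i, eigenvalue A (lam i)) ->
  exists S, unitary S /\ eigbasis lam 1 A S.
Proof.
rewrite hermP => /eqP hA eA.
have /choice[u uP] : forall i, exists u : 'rV[C]_n, u *m A = lam i *: u /\ u *m ct u = 1%:M.
  move=> i; have /eigenvalueP[v vA v0] := eA i; have [c c0 cv] := unit_multiple v0.
  by exists (c *: v); split=> //; rewrite -scalemxAl vA !scalerA mulrC.
have orth i j : i != j -> (u i *m ct (u j)) 0 0 = 0.
  move=> ij; have [uA _] := uP i; have [vA _] := uP j.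
  have : (u i *m A) *m ct (u j) = u i *m ct (u j *m A) by rewrite ctM -hA mulmxA.
  rewrite uA vA ct_scale -scalemxAl -scalemxAr (conj_Creal (lam_real j)).
  move=> /(congr1 (fun N : 'M[C]_1 => N 0 0)); rewrite [LHS]mxE [RHS]mxE => /eqP.
  rewrite -subr_eq0 -mulrBl mulf_eq0 subr_eq0 => /orP[/eqP/lam_inj E|/eqP//].
  by rewrite E eqxx in ij.
pose S : 'M[C]_n := \matrix_(i, j) u i 0 j.
have oS : unitary S.
  apply/matrixP => i j; transitivity ((u i *m ct (u j)) 0 0).
    by rewrite !mxE; apply: eq_bigr => k _; rewrite !ctE !mxE.
  by have [<-|ij] := eqVneq i j; [rewrite (uP i).2 !mxE !eqxx|rewrite orth// [RHS]mxE (negPf ij)].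
exists S; split=> //; split; first exact: unitary_unit.
apply/matrixP => i j; rewrite mul_diag_mx !mxE perm1.
have [/(congr1 (fun v : 'rV[C]_n => v 0 j)) + _] := uP i.
rewrite !mxE => <-; by apply: eq_bigr => k _; rewrite mxE.
Qed.

Lemma eigbasis_herm w A S : unitary S -> eigbasis lam w A S ->
  A \is hermsymmx /\ forall a, eigenvalue A a <-> exists i, a = lam i.
Proof.
move=> oS [uS SA]; have AE : A = ct S *m eigdiag lam w *m S.
  by rewrite -mulmxA -SA mulmxA unitaryV// mul1mx.
split.
  rewrite hermP AE !ctM ctK mulmxA; apply/eqP; congr (_ *m _ *m _).
  apply/matrixP => i j; rewrite ctE !mxE eq_sym; case: eqP => [->|_]; last by rewrite conjC0.
  by rewrite mulr1n conj_Creal.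
move=> a; split.
  move=> /eigenvalueP[v vA v0]; pose z := v *m ct S.
  have zS : z *m S = v by rewrite /z -mulmxA unitaryV// mulmx1.
  have z0 : z != 0 by apply: contra_neq v0 => z0; rewrite -zS z0 mul0mx.
  have zD : z *m eigdiag lam w = a *: z.
    rewrite -[LHS]mulmx1 -oS mulmxA -(mulmxA z) -SA mulmxA zS vA -scalemxAl//.
  have [k zk] : exists k, z 0 k != 0.
    apply: contrapT => nz; move/negP: z0; apply; apply/eqP/rowP => k; rewrite [RHS]mxE.
    by apply/eqP; apply: contrapT => /negP zk; apply: nz; exists k.
  exists (w k); move/(congr1 (fun v : 'rV[C]_n => v 0 k)): zD.
  by rewrite mul_mx_diag [LHS]mxE [RHS]mxE [X in _ * X]mxE mulrC => /(mulIf zk)->.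
move=> [i ->]; apply/eigenvalueP; exists (row ((w^-1)%g i) S).
  by rewrite -row_mul SA; apply/rowP => j; rewrite mxE mul_diag_mx !mxE permKV.
apply/eqP => r0; have /(congr1 (fun N : 'M[C]_n => N ((w^-1)%g i) ((w^-1)%g i))) := oS.
rewrite [RHS]mxE eqxx mxE big1 => [/eqP|k _]; first by rewrite eq_sym oner_eq0.
by have /(congr1 (fun v : 'rV[C]_n => v 0 k)) := r0; rewrite !mxE => ->; rewrite mul0r.
Qed.

End HermitianSpectrum.

(** * Staircase form under triangular conjugation *)

Section HessenbergMatrices.
Context {C : numClosedFieldType} {n : nat} (h : 'I_n -> 'I_n).
Hypothesis hh : hessenberg_function h.
Implicit Types (A B : 'M[C]_n).

Lemma hessenberg_le (i j : 'I_n) : (i <= j)%N -> (h i <= h j)%N.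
Proof.
case: hh => _ hS; have [m] := ubnP (j - i); elim: m j => // m IH j jm ij.
have [/eqP/val_inj -> //|ne] := boolP (val i == val j).
have {ij}{}ne : (i < j)%N by rewrite ltn_neqAle ne ij.
have lt : (j.-1 < n)%N by have := ltn_ord j; lia.
apply: leq_trans (hS (Ordinal lt) j _); last by rewrite /=; lia.
by apply: IH; rewrite /=; lia.
Qed.

Definition hessmx A := forall i j : 'I_n, (h j < i)%N -> A i j = 0.

Lemma hessmx_mul_upper A B : hessmx A -> uppermx B -> hessmx (A *m B).
Proof.
move=> hA uB i j ji; rewrite mxE big1// => k _; have [kj|jk] := leqP k j.
  by rewrite hA ?mul0r// (leq_ltn_trans (hessenberg_le kj)).
by rewrite uB ?mulr0// -ltnNge.
Qed.

Lemma upper_mul_hessmx A B : uppermx A -> hessmx B -> hessmx (A *m B).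
Proof.
move=> uA hB i j ji; rewrite mxE big1// => k _; have [ik|ki] := leqP i k.
  by rewrite hB ?mulr0// (leq_trans ji).
by rewrite uA ?mul0r// -ltnNge.
Qed.

(** Charts and their inverses are conjugations by upper triangular matrices, so they respect every
    staircase; monotonicity of [h] enters through [hessmx_mul_upper]. *)
Lemma hessmx_conj A b c : hessmx A -> uppermx b -> uppermx c -> hessmx (c *m A *m b).
Proof. by move=> hA ub uc; apply: hessmx_mul_upper => //; exact: upper_mul_hessmx. Qed.

Lemma herm_staircase A : A \is hermsymmx ->
  (forall i j : 'I_n, (h i < j)%N || (h j < i)%N -> A i j = 0) <-> hessmx A.
Proof.
rewrite hermP => /eqP hA; split=> [sA i j ij|sA i j]; first by rewrite sA// ij orbT.
by move=> /orP[ij|/sA//]; rewrite hA ctE sA// conjC0.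
Qed.

End HessenbergMatrices.

(** * Continuity of the charts *)

Section ComplexContinuity.
Context {R : realType} {S : topologicalType} (t : S).
Implicit Types (f g : S -> R[i]).

Definition ccont f :=
  {for t, continuous (fun x => complex.Re (f x))} /\ {for t, continuous (fun x => complex.Im (f x))}.

Lemma ccont_ext f g : f =1 g -> ccont f -> ccont g.
Proof. by move=> /funext ->. Qed.

Lemma ccont_near f g : (\near t, f t = g t) -> ccont f -> ccont g.
Proof.
by move=> fg [fr fi]; split; [apply: near_eq_continuous_at fr|apply: near_eq_continuous_at fi];
  apply: filterS fg => x ->.
Qed.

Lemma ccont_cst (c : R[i]) : ccont (fun=> c).
Proof. by split; exact: cst_continuous. Qed.

Lemma complex_ReD (x y : R[i]) : complex.Re (x + y) = complex.Re x + complex.Re y.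
Proof. by case: x y => [a b] [c d]. Qed.

Lemma complex_ImD (x y : R[i]) : complex.Im (x + y) = complex.Im x + complex.Im y.
Proof. by case: x y => [a b] [c d]. Qed.

Lemma complex_Re_sum I (r : seq I) (P : pred I) (f : I -> R[i]) :
  complex.Re (\sum_(i <- r | P i) f i) = \sum_(i <- r | P i) complex.Re (f i).
Proof. by apply: big_morph => //; exact: complex_ReD. Qed.

Lemma complex_Im_sum I (r : seq I) (P : pred I) (f : I -> R[i]) :
  complex.Im (\sum_(i <- r | P i) f i) = \sum_(i <- r | P i) complex.Im (f i).
Proof. by apply: big_morph => //; exact: complex_ImD. Qed.

Lemma complex_ReM (x y : R[i]) :
  complex.Re (x * y) = complex.Re x * complex.Re y - complex.Im x * complex.Im y.
Proof. by case: x y => [a b] [c d]. Qed.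

Lemma complex_ImM (x y : R[i]) :
  complex.Im (x * y) = complex.Re x * complex.Im y + complex.Im x * complex.Re y.
Proof. by case: x y => [a b] [c d]. Qed.

Lemma complex_ReV (x : R[i]) :
  complex.Re x^-1 = complex.Re x / (complex.Re x ^+ 2 + complex.Im x ^+ 2).
Proof. by case: x. Qed.

Lemma complex_ImV (x : R[i]) :
  complex.Im x^-1 = - complex.Im x / (complex.Re x ^+ 2 + complex.Im x ^+ 2).
Proof. by case: x => a b /=; rewrite mulNr. Qed.

Lemma complex_ReJ (x : R[i]) : complex.Re x^*%R = complex.Re x.
Proof. by case: x. Qed.

Lemma complex_ImJ (x : R[i]) : complex.Im x^*%R = - complex.Im x.
Proof. by case: x. Qed.

Lemma complex_eq0 (x : R[i]) : (x == 0) = (complex.Re x ^+ 2 + complex.Im x ^+ 2 == 0).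
Proof. by rewrite eq_complex /= paddr_eq0 ?sqr_ge0// !sqrf_eq0. Qed.

Lemma ccontD f g : ccont f -> ccont g -> ccont (fun x => f x + g x).
Proof.
move=> [fr fi] [gr gi]; split.
  under [X in {for t, continuous X}]eq_fun do rewrite complex_ReD.
  exact: (continuousD fr gr).
under [X in {for t, continuous X}]eq_fun do rewrite complex_ImD.
exact: (continuousD fi gi).
Qed.

Lemma ccontM f g : ccont f -> ccont g -> ccont (fun x => f x * g x).
Proof.
move=> [fr fi] [gr gi]; split.
  under [X in {for t, continuous X}]eq_fun do rewrite complex_ReM.
  exact: (continuousB (continuousM fr gr) (continuousM fi gi)).
under [X in {for t, continuous X}]eq_fun do rewrite complex_ImM.
exact: (continuousD (continuousM fr gi) (continuousM fi gr)).
Qed.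

Lemma continuous_sqnorm f : ccont f ->
  {for t, continuous (fun x => complex.Re (f x) ^+ 2 + complex.Im (f x) ^+ 2)}.
Proof.
by move=> [fr fi]; exact: (continuousD (continuousM fr fr) (continuousM fi fi)).
Qed.

Lemma near_neq0 f : ccont f -> f t != 0 -> \near t, f t != 0.
Proof.
move=> cf; rewrite complex_eq0 => ft0.
have cn := continuous_sqnorm cf.
have /cn : nbhs (complex.Re (f t) ^+ 2 + complex.Im (f t) ^+ 2) [set y : R | y != 0].
  by apply: open_nbhs_nbhs; split=> //; exact: open_neq.
by move=> H; apply: (@filterS _ (nbhs t) _ _ _ _ H) => x /=; rewrite -complex_eq0.
Qed.

Lemma ccontV f : ccont f -> f t != 0 -> ccont (fun x => (f x)^-1).
Proof.
move=> cf; rewrite complex_eq0 => ft0; have [fr fi] := cf.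
have cn : {for t, continuous (fun x => (complex.Re (f x) ^+ 2 + complex.Im (f x) ^+ 2)^-1)}.
  by apply: cvgV => //; exact: continuous_sqnorm.
split.
  under [X in {for t, continuous X}]eq_fun do rewrite complex_ReV.
  exact: (continuousM fr cn).
under [X in {for t, continuous X}]eq_fun do rewrite complex_ImV.
exact: (continuousM (continuousN fi) cn).
Qed.

Lemma ccontJ f : ccont f -> ccont (fun x => (f x)^*%R).
Proof.
move=> [fr fi]; split.
  by under [X in {for t, continuous X}]eq_fun do rewrite complex_ReJ.
under [X in {for t, continuous X}]eq_fun do rewrite complex_ImJ.
exact: (continuousN fi).
Qed.

Lemma ccont_sum I (r : seq I) (P : pred I) (F : I -> S -> R[i]) :
  (forall i, P i -> ccont (F i)) -> ccont (fun x => \sum_(i <- r | P i) F i x).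
Proof.
move=> cF; elim: r => [|i r IH].
  by apply: (ccont_ext (f := fun=> 0)); [move=> x; rewrite big_nil|exact: ccont_cst].
apply: (ccont_ext (f := fun x => (if P i then F i x else 0) + \sum_(i <- r | P i) F i x)).
  by move=> x; rewrite big_cons; case: ifP => //; rewrite add0r.
by apply: ccontD => //; case: (P i) (@cF i) => [/(_ isT)//|_]; exact: ccont_cst.
Qed.

Lemma ccont_prod I (r : seq I) (P : pred I) (F : I -> S -> R[i]) :
  (forall i, P i -> ccont (F i)) -> ccont (fun x => \prod_(i <- r | P i) F i x).
Proof.
move=> cF; elim: r => [|i r IH].
  by apply: (ccont_ext (f := fun=> 1)); [move=> x; rewrite big_nil|exact: ccont_cst].
apply: (ccont_ext (f := fun x => (if P i then F i x else 1) * \prod_(i <- r | P i) F i x)).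
  by move=> x; rewrite big_cons; case: ifP => //; rewrite mul1r.
by apply: ccontM => //; case: (P i) (@cF i) => [/(_ isT)//|_]; exact: ccont_cst.
Qed.

(** Reduces the complex root in [ortho_mx] to real square roots, which are continuous everywhere. *)
Lemma sqrtC_norm (z : R[i]) :
  sqrtC `|z| = (Num.sqrt (Num.sqrt (complex.Re z ^+ 2 + complex.Im z ^+ 2)))%:C%C.
Proof.
set r := Num.sqrt (Num.sqrt _).
have -> : `|z| = (r%:C%C) ^+ 2.
  by rewrite normc_def -rmorphXn /= sqr_sqrtr ?sqrtr_ge0.
by rewrite sqrCK// lecR sqrtr_ge0.
Qed.

Lemma ccont_sqrt_norm f : ccont f -> ccont (fun x => sqrtC `|f x|).
Proof.
move=> cf; have cn := continuous_sqnorm cf.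
apply: (ccont_ext (f := fun x => (Num.sqrt (Num.sqrt (complex.Re (f x) ^+ 2 + complex.Im (f x) ^+ 2)))%:C%C)).
  by move=> x; rewrite sqrtC_norm.
split; last exact: cst_continuous.
have c1 := continuous_comp cn (@sqrt_continuous R _).
exact: (continuous_comp c1 (@sqrt_continuous R _)).
Qed.

Definition mxcont m p (F : S -> 'M[R[i]]_(m, p)) := forall i j, ccont (fun x => F x i j).

Lemma mxcont_cst m p (M : 'M[R[i]]_(m, p)) : mxcont (fun=> M).
Proof. by move=> i j; exact: ccont_cst. Qed.

Lemma mxcontD m p (F G : S -> 'M[R[i]]_(m, p)) : mxcont F -> mxcont G ->
  mxcont (fun x => F x + G x).
Proof. by move=> cF cG i j; apply: (ccont_ext _ (ccontD (cF i j) (cG i j))) => x; rewrite mxE. Qed.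

Lemma mxcontZ m p (f : S -> R[i]) (F : S -> 'M[R[i]]_(m, p)) : ccont f -> mxcont F ->
  mxcont (fun x => f x *: F x).
Proof. by move=> cf cF i j; apply: (ccont_ext _ (ccontM cf (cF i j))) => x; rewrite mxE. Qed.

Lemma mxcontM m p q (F : S -> 'M[R[i]]_(m, p)) (G : S -> 'M[R[i]]_(p, q)) : mxcont F -> mxcont G ->
  mxcont (fun x => F x *m G x).
Proof.
move=> cF cG i j; apply: (ccont_ext (f := fun x => \sum_k F x i k * G x k j)).
  by move=> x; rewrite mxE.
by apply: ccont_sum => k _; exact: ccontM.
Qed.

Lemma mxcont_ct m p (F : S -> 'M[R[i]]_(m, p)) : mxcont F -> mxcont (fun x => ct (F x)).
Proof. by move=> cF i j; apply: (ccont_ext _ (ccontJ (cF j i))) => x; rewrite ctE. Qed.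

Lemma mxcont_sum m p I (r : seq I) (P : pred I) (F : I -> S -> 'M[R[i]]_(m, p)) :
  (forall i, P i -> mxcont (F i)) -> mxcont (fun x => \sum_(i <- r | P i) F i x).
Proof.
move=> cF a b; apply: (ccont_ext (f := fun x => \sum_(i <- r | P i) F i x a b)).
  by move=> x; rewrite summxE.
by apply: ccont_sum => i Pi; exact: cF.
Qed.

Lemma mxcont_prod m I (r : seq I) (P : pred I) (F : I -> S -> 'M[R[i]]_m) :
  (forall i, P i -> mxcont (F i)) -> mxcont (fun x => \prod_(i <- r | P i) F i x).
Proof.
move=> cF; elim: r => [|i r IH].
  rewrite (_ : (fun x => _) = fun=> 1); first exact: mxcont_cst.
  by apply/funext => x; rewrite big_nil.
rewrite (_ : (fun x => _) = fun x => (if P i then F i x else 1%:M) *m \prod_(i <- r | P i) F i x).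
  by apply: mxcontM => //; case: (P i) (@cF i) => [/(_ isT)//|_]; exact: mxcont_cst.
by apply/funext => x; rewrite big_cons; case: ifP => //; rewrite mul1mx.
Qed.

Lemma ccont_det m (F : S -> 'M[R[i]]_m) : mxcont F -> ccont (fun x => \det (F x)).
Proof.
move=> cF; rewrite /determinant; apply: ccont_sum => s _.
by apply: ccontM; [exact: ccont_cst|apply: ccont_prod => i _; exact: cF].
Qed.

Lemma mxcont_adj m (F : S -> 'M[R[i]]_m) : mxcont F -> mxcont (fun x => \adj (F x)).
Proof.
move=> cF i j; apply: (ccont_ext (f := fun x => (-1) ^+ (j + i) * \det (row' j (col' i (F x))))).
  by move=> x; rewrite mxE.
apply: ccontM; [exact: ccont_cst|apply: ccont_det => a b].
by apply: (ccont_ext (f := fun x => F x (lift j a) (lift i b))) => [x|]; [rewrite !mxE|exact: cF].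
Qed.

Lemma mxcont_invmx m (F : S -> 'M[R[i]]_m) : mxcont F -> F t \in unitmx ->
  mxcont (fun x => invmx (F x)).
Proof.
move=> cF; rewrite unitmxE unitfE => Ft0 i j.
apply: (@ccont_near (fun x => (\det (F x))^-1 * \adj (F x) i j)).
  apply: filterS (near_neq0 (ccont_det cF) Ft0) => x Fx0.
  by rewrite /invmx unitmxE unitfE Fx0 [RHS]mxE.
by apply: ccontM; [apply: ccontV => //; exact: ccont_det|exact: mxcont_adj].
Qed.

End ComplexContinuity.

Section ChartContinuity.
Context {R : realType} {S : topologicalType} (t : S) {n : nat} (lam : 'I_n -> R[i]).
Implicit Types (F : S -> 'M[R[i]]_n) (w : 'S_n).

Lemma mxcont_eigproj i F : mxcont t F -> mxcont t (fun x => eigproj lam i (F x)).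
Proof.
move=> cF; apply: mxcont_prod => j _; apply: mxcontZ; first exact: ccont_cst.
by apply: mxcontD => //; exact: mxcont_cst.
Qed.

Lemma mxcont_eigprojs_lt w k F : mxcont t F -> mxcont t (fun x => eigprojs_lt lam w k (F x)).
Proof. by move=> cF; apply: mxcont_sum => i _; exact: mxcont_eigproj. Qed.

Lemma mxcont_ortho_sys k F : mxcont t F -> mxcont t (fun x => ortho_sys (F x) k).
Proof.
by move=> cF; apply: mxcontD; [apply: mxcontM => //; exact: mxcont_cst|exact: mxcont_cst].
Qed.

Lemma mxcont_ortho_vec F (j : 'I_n) : mxcont t F -> ortho_sys (F t) j \in unitmx ->
  mxcont t (fun x => ortho_vec (F x) j).
Proof.
move=> cF uN; apply: mxcontM; last exact: mxcont_cst.
by apply: mxcont_invmx => //; exact: mxcont_ortho_sys.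
Qed.

Lemma mxcont_ortho_mx (Q P : S -> 'I_n -> 'M[R[i]]_n) :
  (forall j, mxcont t (fun x => Q x j)) -> (forall j, mxcont t (fun x => P x j)) ->
  (forall j : 'I_n, ortho_sys (Q t j) j \in unitmx) ->
  (forall j, 0 < (ct (ortho_vec (Q t j) j) *m P t j *m ortho_vec (Q t j) j) 0 0) ->
  mxcont t (fun x => ortho_mx (Q x) (P x)).
Proof.
move=> cQ cP uN P0 i j; have cv := mxcont_ortho_vec (cQ j) (uN j).
apply: ccont_ext => [x|]; first by rewrite mxE.
apply: ccontM; first exact: cv.
apply: ccontV; last by rewrite sqrtC_eq0 normr_eq0 lt0r_neq0.
by apply: ccont_sqrt_norm; apply: (mxcontM (mxcontM (mxcont_ct cv) (cP j)) cv).
Qed.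

End ChartContinuity.

(** * Vanishing of odd cohomology *)

Section LexicographicOrder.
Context {n : nat}.
Implicit Types (u v w : 'S_n).

Lemma lex_lt_irr w : ~ lex_lt w w.
Proof. by case=> k; rewrite ltnn => -[]. Qed.

Lemma lex_lt_trans u v w : lex_lt u v -> lex_lt v w -> lex_lt u w.
Proof.
move=> [k [uvk uvm]] [l [vwl vwm]]; have [kl|lk|/val_inj kl] := ltngtP k l.
- exists l; split; first by rewrite uvm.
  by move=> m lm; rewrite uvm ?vwm// (ltn_trans kl).
- exists k; split; first by rewrite -vwm.
  by move=> m km; rewrite uvm ?vwm// (ltn_trans lk).
- exists k; split; first by apply: ltn_trans uvk _; rewrite kl.
  by move=> m km; rewrite uvm ?vwm// -kl.
Qed.

Lemma lex_lt_total u w : u != w -> lex_lt u w \/ lex_lt w u.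
Proof.
move=> uw; have [k0 k0P] : exists k, u k != w k.
  apply: contrapT => nk; move/eqP: uw; apply; apply/permP => k.
  by apply/eqP; apply: contrapT => /negP uk; apply: nk; exists k.
case: (@arg_maxnP _ k0 (fun k => u k != w k) val k0P) => k ukw kmax.
have eqm (m : 'I_n) : (k < m)%N -> u m = w m.
  by move=> km; apply/eqP; apply: contraLR km => /kmax; rewrite -leqNgt.
have [lt|lt|/val_inj E] := ltngtP (u k) (w k).
- by left; exists k.
- by right; exists k; split=> // m /eqm.
- by rewrite E eqxx in ukw.
Qed.

Definition lex_rank w := #|[pred u : 'S_n | `[< lex_lt u w >]]|.

Lemma lex_rank_lt u w : lex_lt u w -> (lex_rank u < lex_rank w)%N.
Proof.
move=> uw; apply: proper_card; apply/properP; split.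
  by apply/fintype.subsetP => v; rewrite !unfold_in => /asboolP vu; apply/asboolP; exact: lex_lt_trans vu uw.
by exists u; rewrite unfold_in; [exact/asboolP|apply/negP => /asboolP; exact: lex_lt_irr].
Qed.

Lemma rank_lt_lex u w : (lex_rank u < lex_rank w)%N -> lex_lt u w.
Proof.
move=> uw; have [E|/lex_lt_total[//|/lex_rank_lt wu]] := eqVneq u w.
  by rewrite E ltnn in uw.
by have := ltn_trans uw wu; rewrite ltnn.
Qed.

Lemma lex_rank_inj : injective lex_rank.
Proof.
move=> u w E; apply/eqP; apply: contrapT => /negP /lex_lt_total[]/lex_rank_lt;
  by rewrite E ltnn.
Qed.

End LexicographicOrder.

Section ComplexPairs.
Context {R : realType} {n : nat}.
Implicit Types (A : 'M[R[i]]_n) (p : 'M[R]_n * 'M[R]_n).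

Definition cplx p : 'M[R[i]]_n := \matrix_(i, j) (p.1 i j +i* p.2 i j)%C.

Lemma re_imK A : cplx (re_im A) = A.
Proof. by apply/matrixP => i j; rewrite !mxE; case: (A i j). Qed.

Lemma cplxK p : re_im (cplx p) = p.
Proof. by case: p => a b; congr pair; apply/matrixP => i j; rewrite !mxE. Qed.

Lemma mxcont_cplx p : mxcont p cplx.
Proof.
move=> i j; split.
  rewrite (_ : (fun x => _) = (fun M : 'M[R]_n => M i j) \o fst).
    by apply: continuous_comp; [exact: cvg_fst|exact: coord_continuous].
  by apply/funext => x; rewrite mxE.
rewrite (_ : (fun x => _) = (fun M : 'M[R]_n => M i j) \o snd).
  by apply: continuous_comp; [exact: cvg_snd|exact: coord_continuous].
by apply/funext => x; rewrite mxE.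
Qed.

Lemma continuous_re_im (S : topologicalType) (t : S) (F : S -> 'M[R[i]]_n) : mxcont t F ->
  {for t, continuous (fun x => re_im (F x))}.
Proof.
move=> cF.
have cr : {for t, continuous (fun x => map_mx (@complex.Re R) (F x))}.
  apply: (@mx_continuous_at R S _ _ (fun x => map_mx (@complex.Re R) (F x))) => i j.
  under [X in {for t, continuous X}]eq_fun do rewrite mxE.
  by have [] := cF i j.
have ci : {for t, continuous (fun x => map_mx (@complex.Im R) (F x))}.
  apply: (@mx_continuous_at R S _ _ (fun x => map_mx (@complex.Im R) (F x))) => i j.
  under [X in {for t, continuous X}]eq_fun do rewrite mxE.
  by have [] := cF i j.
exact: (cvg_pair cr ci).
Qed.

End ComplexPairs.

Section OddCohomology.
Context {R : realType} {n : nat} (h : 'I_n -> 'I_n) (lam : 'I_n -> R).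
Hypotheses (hh : hessenberg_function h) (hlam : simple_spectrum lam).
Local Notation T := ('M[R]_n * 'M[R]_n)%type.
Local Notation X := (X_herm h lam).
Implicit Types (A S Z : 'M[R[i]]_n) (p : T) (w : 'S_n).

Let lamC (i : 'I_n) : R[i] := (lam i)%:C%C.

Lemma simple_spectrum_inj : injective lam.
Proof.
move=> i j E; have [/hlam|/hlam|/val_inj//] := ltngtP i j; by rewrite E ltxx.
Qed.

Lemma lamC_inj : injective lamC.
Proof. by move=> i j [] /simple_spectrum_inj. Qed.

Lemma lamC_real i : lamC i \is Num.real.
Proof. by rewrite complex_real. Qed.

Lemma X_hermP p : X p <-> exists S, [/\ unitary S, eigbasis lamC 1 (cplx p) S & hessmx h (cplx p)].
Proof.
split=> [[A [[hA sA] [_ eA]] <-]|[S [oS eS hA]]].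
  rewrite re_imK; have [|S [oS eS]] := herm_eigbasis lamC_inj lamC_real hA.
    by move=> i; rewrite -[is_true _]/([set a | eigenvalue A a] (lamC i)) eA; exists i.
  by exists S; split=> //; exact/(herm_staircase h hA).
have [hA' eA] := eigbasis_herm lamC_real oS eS.
exists (cplx p); last exact: cplxK.
split; first by split=> //; exact/(herm_staircase h hA').
split=> //; apply/seteqP; split=> a /=; first by move=> /eA[i ->]; exists i.
by move=> [i _ <-]; apply/eA; exists i.
Qed.

Definition free_pos (i j : 'I_n) := (j < i)%N && (i <= h j)%N.

(** Entries of [p] outside the free positions are ignored: the inverse chart is defined on the whole
    space of pairs, and each chart domain in [X] is a retract of that space. *)
Definition chart_source w p : 'M[R[i]]_n :=
  \matrix_(i, j) (if i == j then lamC (w i) else if free_pos i j then cplx p i j else 0).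

Lemma chart_source_lower w p : lowermx (chart_source w p).
Proof.
move=> i j; rewrite -ltnNge => ij; rewrite mxE -val_eqE (ltn_eqF ij).
by rewrite /free_pos ltnNge (ltnW ij).
Qed.

Lemma chart_source_diag w p k : chart_source w p k k = lamC (w k).
Proof. by rewrite mxE eqxx. Qed.

Lemma chart_source_hess w p : hessmx h (chart_source w p).
Proof.
move=> i j ji; rewrite mxE /free_pos [(i <= h j)%N]leqNgt ji andbF.
by case: eqP ji => // ->; rewrite ltnNge (hh.1 j).
Qed.

(** On [X] this is nondegeneracy for [w], by [X_nondegP]; as a condition on determinants it is open
    in the ambient space, as Mayer-Vietoris requires. *)
Definition chart_set w : set T :=
  [set p | forall j : 'I_n, ortho_sys (eigprojs_lt lamC w j (cplx p)) j \in unitmx].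

Lemma open_chart_set w : open (chart_set w).
Proof.
rewrite openE => p Vp; rewrite /interior.
have c0 (j : 'I_n) : ccont p (fun x => \det (ortho_sys (eigprojs_lt lamC w j (cplx x)) j)).
  apply: ccont_det; apply: mxcont_ortho_sys; apply: mxcont_eigprojs_lt; exact: mxcont_cplx.
have cD := @ccont_prod _ _ p _ (index_enum 'I_n) xpredT _ (fun j _ => c0 j).
have /(near_neq0 cD) : \prod_(j < n) \det (ortho_sys (eigprojs_lt lamC w j (cplx p)) j) != 0.
  by apply/prodf_neq0 => j _; rewrite -unitfE -unitmxE.
by apply: filterS => x /prodf_neq0 H j; rewrite unitmxE unitfE H.
Qed.

Lemma eigbasis_nondegP w p S : unitary S -> eigbasis lamC w (cplx p) S ->
  nondeg lamC w (cplx p) <-> chart_set w p.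
Proof.
move=> oS eS; split=> [nd j|Vp k y sy Py].
  exact: (eigprojs_lt_unit lamC_inj _ oS eS nd).
have [nk|kn] := leqP n k.
  have Sy : S *m y = 0.
    apply/colP => i; rewrite [RHS]mxE; apply/eqP; rewrite -(eigproj_eq0 lamC_inj _ _ eS) Py//.
    exact: leq_trans (ltn_ord i) nk.
  by rewrite -[y]mul1mx -(mulVmx eS.1) -mulmxA Sy mulmx0.
rewrite -[y]mul1mx -(mulVmx (Vp (Ordinal kn))) -mulmxA.
rewrite (_ : ortho_sys _ _ *m y = 0) ?mulmx0//; apply/colP => i; rewrite ortho_sysE [RHS]mxE.
case: ltnP => /= [ik|/sy//]; rewrite /eigprojs_lt mulmx_suml summxE big1// => l lk.
by rewrite Py// mxE.
Qed.

Lemma X_nondegP w p : X p -> nondeg lamC w (cplx p) <-> chart_set w p.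
Proof.
move=> /X_hermP[S [oS eS _]].
apply: (@eigbasis_nondegP w p (perm_mx w *m S)); [exact: unitary_perm|exact: eigbasis_perm].
Qed.

Lemma X_chartP w p (Z := chart lamC w (cplx p)) : X p -> chart_set w p ->
  [/\ lowermx Z, forall k, Z k k = lamC (w k), chart_inv lamC w Z = cplx p,
    exists r, [/\ uppermx r, r \in unitmx & eigbasis lamC w (cplx p) (lower_frame lamC w Z *m r)] &
    hessmx h Z].
Proof.
move=> Xp Vp; have /X_nondegP nd := Vp; have {}nd := nd Xp.
move/X_hermP: Xp => [S [oS eS hA]].
have oS' := unitary_perm w oS; have eS' := eigbasis_perm w eS.
have [lZ dZ ZK rZ] := chartP lamC_inj oS' eS' nd; split=> //.
have [ub b0 _] := chart_frameP lamC_inj oS' eS' nd.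
have b0' i : chart_frame lamC w (cplx p) i i != 0 by rewrite lt0r_neq0.
have unb : chart_frame lamC w (cplx p) \in unitmx by apply: trigmx_unit => //; right.
have [uV _] := uppermx_inv ub b0' (mulmxV unb).
exact: hessmx_conj.
Qed.

Lemma chart_sourceK w p : X p -> chart_set w p ->
  chart_source w (re_im (chart lamC w (cplx p))) = chart lamC w (cplx p).
Proof.
move=> Xp Vp; have [lZ dZ _ _ hZ] := X_chartP Xp Vp.
apply/matrixP => i j; rewrite mxE re_imK; case: eqP => [->|/eqP ij]; first by rewrite dZ.
rewrite /free_pos; case: ltnP => /= [ji|ij']; last first.
  by rewrite lZ// -ltnNge ltn_neqAle ij' andbT.
by case: leqP => // /hZ.
Qed.

Lemma chart_inv_X w p (q := re_im (chart_inv lamC w (chart_source w p))) :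
  X q /\ chart_set w q.
Proof.
have [ua a0 oS eS nd] := chart_invP lamC_inj (chart_source_lower w p) (chart_source_diag w p).
set a := gram_frame _ in ua a0 oS eS.
have a0' i : a i i != 0 by rewrite lt0r_neq0.
have una : a \in unitmx by apply: trigmx_unit => //; right.
have [uV _] := uppermx_inv ua a0' (mulmxV una).
have qE : cplx q = chart_inv lamC w (chart_source w p) by rewrite re_imK.
have hq : hessmx h (cplx q).
  by rewrite qE; apply: hessmx_conj => //; exact: chart_source_hess.
rewrite -qE in eS nd.
have Xq : X q.
  have [hA eA] := eigbasis_herm lamC_real oS eS.
  have [|S' [oS' eS']] := herm_eigbasis lamC_inj lamC_real hA.
    by move=> i; apply/eA; exists i.
  by apply/X_hermP; exists S'.
by split; [exact: Xq|apply/(X_nondegP w Xq)].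
Qed.

Lemma chart_continuous w p : X p -> chart_set w p ->
  {for p, continuous (fun x => re_im (chart lamC w (cplx x)))}.
Proof.
move=> Xp Vp; have /X_nondegP nd := Vp; have {}nd := nd Xp.
move/X_hermP: Xp => [S [oS eS hA]].
have oS' := unitary_perm w oS; have eS' := eigbasis_perm w eS.
have [ub b0 _] := chart_frameP lamC_inj oS' eS' nd.
have unb : chart_frame lamC w (cplx p) \in unitmx.
  by apply: trigmx_unit => [|i]; [right|rewrite lt0r_neq0].
have cF : mxcont p (fun x => chart_frame lamC w (cplx x)).
  apply: mxcont_ortho_mx => [j|j|//|j].
  - by apply: mxcont_eigprojs_lt; exact: mxcont_cplx.
  - by apply: mxcont_eigproj; exact: mxcont_cplx.
  - exact: (chart_form_gt0 lamC_inj j oS' eS' nd).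
apply: continuous_re_im; apply: mxcontM => //; apply: mxcontM; last exact: mxcont_cplx.
exact: mxcont_invmx.
Qed.

Lemma chart_inv_continuous w p :
  {for p, continuous (fun x => re_im (chart_inv lamC w (chart_source w x)))}.
Proof.
have cZ : mxcont p (chart_source w).
  move=> i j; apply: (ccont_ext (f := fun x => if i == j then lamC (w i) else
      if free_pos i j then cplx x i j else 0)); first by move=> x; rewrite [RHS]mxE.
  case: (i == j); first exact: ccont_cst.
  by case: (free_pos i j); [exact: mxcont_cplx|exact: ccont_cst].
have [lM M1 [uM _]] := lower_frameP lamC_inj (chart_source_lower w p) (chart_source_diag w p).
have cM : mxcont p (fun x => lower_frame lamC w (chart_source w x)).
  move=> i j; apply: (ccont_ext (f := fun x => eigproj lamC (w i) (chart_source w x) i j)).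
    by move=> x; rewrite mxE.
  exact: mxcont_eigproj.
have cK := mxcontM (mxcont_ct cM) cM.
have [ua a0 oS _ _] := chart_invP lamC_inj (chart_source_lower w p) (chart_source_diag w p).
set a := gram_frame _ in ua a0 oS.
have una : a \in unitmx by apply: trigmx_unit => [|i]; [right|rewrite lt0r_neq0].
have ca : mxcont p (fun x => gram_frame (ct (lower_frame lamC w (chart_source w x)) *m
    lower_frame lamC w (chart_source w x))).
  apply: (mxcont_ortho_mx (fun=> cK) (fun=> cK)) => j; first exact: gram_sys_unit.
  exact: gram_gt0.
exact: (continuous_re_im (mxcontM (mxcontM (mxcont_invmx ca una) cZ) ca)).
Qed.

Definition coord_fun (x : 'I_n * 'I_n * bool) p : R :=
  if x.2 then p.1 x.1.1 x.1.2 else p.2 x.1.1 x.1.2.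

Definition coord_vec (x : 'I_n * 'I_n * bool) : T :=
  if x.2 then (delta_mx x.1.1 x.1.2, 0) else (0, delta_mx x.1.1 x.1.2).

Definition bad_pos w : seq ('I_n * 'I_n) :=
  [seq x <- enum {: 'I_n * 'I_n} | free_pos x.1 x.2 && (w x.2 < w x.1)%N].

(** Every bad position gives two real coordinates, whence the even codimension. *)
Definition bad_coords w : seq ('I_n * 'I_n * bool) :=
  [seq (x, b) | x <- bad_pos w, b <- [:: true; false]].

Lemma uniq_bad_coords w : uniq (bad_coords w).
Proof.
apply: allpairs_uniq => //; first by rewrite filter_uniq// enum_uniq.
by move=> [a b] [c d] _ _ [] -> ->.
Qed.

Lemma even_bad_coords w : odd (size (bad_coords w)) = false.
Proof. by rewrite size_allpairs /= oddM andbF. Qed.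

Lemma bad_coordsP w p : some_coord_neq0 coord_fun (bad_coords w) p <->
  exists i j, [/\ free_pos i j, (w j < w i)%N & cplx p i j != 0].
Proof.
split.
  move=> [[[i j] b]] /allpairsP[[x c] [+ _ [E1 _]]] pn.
  rewrite mem_filter -E1 mem_enum andbT => /andP[fij wij]; exists i, j; split=> //.
  by rewrite mxE eq_complex /= negb_and; move: pn; case: b => /= ->; rewrite ?orbT.
move=> [i [j [fij wij]]]; rewrite mxE eq_complex /= negb_and => /orP ne.
have ijb : (i, j) \in bad_pos w by rewrite mem_filter mem_enum /= fij wij.
by case: ne => ne; [exists (i, j, true)|exists (i, j, false)] => //;
  apply/allpairsP; [exists ((i, j), true)|exists ((i, j), false)]; rewrite !inE.
Qed.

Lemma lower_chart_rel_supported w Z : lowermx Z -> hessmx h Z ->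
  rel_supported (good_rel w) Z \/
  exists i j, [/\ free_pos i j, (w j < w i)%N & Z i j != 0].
Proof.
move=> lZ hZ; have [ex|nex] := pselect (exists i j, [/\ free_pos i j, (w j < w i)%N & Z i j != 0]).
  by right.
left=> i j ij; apply/eqP; apply: contrapT => /negP Zij; apply: nex; exists i, j.
have ji : (j <= i)%N by rewrite leqNgt; apply/negP => lt; rewrite lZ ?eqxx// -ltnNge in Zij.
have wij : (w j < w i)%N by move: ij; rewrite /good_rel ji /= -ltnNge.
split=> //; rewrite /free_pos ltn_neqAle ji andbT; apply/andP; split.
  by apply: contraTneq wij => /val_inj ->; rewrite ltnn.
by rewrite leqNgt; apply/negP => lt; rewrite hZ ?eqxx in Zij.
Qed.

Lemma chart_bad_coord w w' p : X p -> chart_set w p -> chart_set w' p -> lex_lt w' w ->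
  some_coord_neq0 coord_fun (bad_coords w) (re_im (chart lamC w (cplx p))).
Proof.
move=> Xp Vp Vp' ww; apply/bad_coordsP; rewrite re_imK.
have [lZ dZ _ [r [ur unr er]] hZ] := X_chartP Xp Vp.
have [gZ|//] := lower_chart_rel_supported w lZ hZ.
have [lM M1 _] := lower_frameP lamC_inj lZ dZ.
have gM := lower_frame_good lamC gZ.
by have := good_not_nondeg lamC_inj lM M1 gM ur unr er ww; rewrite X_nondegP.
Qed.

(** Together with [chart_bad_coord], this identifies, inside the chart of [w], the union of the
    earlier charts with the points that have a nonzero bad coordinate. *)
Lemma bad_coord_chart w p (q := re_im (chart_inv lamC w (chart_source w p))) :
  some_coord_neq0 coord_fun (bad_coords w) p -> exists2 w', lex_lt w' w & chart_set w' q.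
Proof.
move=> /bad_coordsP[i [j [fij wij pij]]].
have lZ := chart_source_lower w p; have dZ := chart_source_diag w p.
have [ua a0 _ eS _] := chart_invP lamC_inj lZ dZ.
set a := gram_frame _ in ua a0 eS.
have una : a \in unitmx by apply: trigmx_unit => [|k]; [right|rewrite lt0r_neq0].
have [lM M1 _] := lower_frameP lamC_inj lZ dZ.
have ngM : ~ rel_supported (good_rel w) (lower_frame lamC w (chart_source w p)).
  move=> /(good_lower_frame lamC_inj lZ dZ)/(_ i j); rewrite /good_rel [(w i <= w j)%N]leqNgt wij andbF.
  move=> /(_ isT) /eqP; rewrite mxE fij; case/andP: fij => ji _.
  by rewrite -val_eqE (gtn_eqF ji) (negPf pij).
have [w' ww nd] := bad_nondeg lamC_inj lM M1 ngM ua una eS.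
exists w' => //; have [Xq _] := chart_inv_X w p.
by apply/(X_nondegP w' Xq); rewrite re_imK.
Qed.

Lemma acyclic_chart w j : acyclic_in (R := R) (X `&` chart_set w) j.
Proof.
apply: (@acyclic_retract R _ _ _ setT (fun x => re_im (chart lamC w (cplx x)))
  (fun x => re_im (chart_inv lamC w (chart_source w x)))).
- by move=> p [Xp Vp]; exact: chart_continuous.
- by [].
- by move=> p _; exact: chart_inv_continuous.
- by move=> p _; exact: chart_inv_X.
- move=> p [Xp Vp]; rewrite chart_sourceK//.
  by have [_ _ -> _ _] := X_chartP Xp Vp; rewrite cplxK.
- exact: (@acyclic_star _ _ _ 0).
Qed.

Definition charts_below N : set T := [set p | exists2 w, (lex_rank w < N)%N & chart_set w p].

Lemma open_charts_below N : open (charts_below N).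
Proof.
rewrite (_ : charts_below N = \bigcup_(w in [set w : 'S_n | (lex_rank w < N)%N]) chart_set w).
  by apply: bigcup_open => w _; exact: open_chart_set.
by apply/seteqP; split=> p [w wN pw]; exists w.
Qed.

(** The number of bad coordinates is even, so the exceptional degree in [acyclic_some_coord_neq0] is
    odd, or absent when there are none. *)
Lemma acyclic_chart_below w j : ~~ odd j ->
  acyclic_in (R := R) (X `&` chart_set w `&` charts_below (lex_rank w)) j.
Proof.
move=> ej; apply: (@acyclic_retract R _ _ _ (some_coord_neq0 coord_fun (bad_coords w))
  (fun x => re_im (chart lamC w (cplx x)))
  (fun x => re_im (chart_inv lamC w (chart_source w x)))).
- by move=> p [[Xp Vp] _]; exact: chart_continuous.
- by move=> p [[Xp Vp] [w' /rank_lt_lex ww Vp']]; exact: chart_bad_coord ww.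
- by move=> p _; exact: chart_inv_continuous.
- move=> p /bad_coord_chart[w' ww Vq]; split; first exact: chart_inv_X.
  by exists w' => //; exact: lex_rank_lt.
- move=> p [[Xp Vp] _]; rewrite chart_sourceK//.
  by have [_ _ -> _ _] := X_chartP Xp Vp; rewrite cplxK.
- apply: (@acyclic_some_coord_neq0 R _ _ coord_fun coord_vec).
  + move=> [[i k] []] p; rewrite /coord_fun /=.
      rewrite (_ : (fun x => _) = (fun M : 'M[R]_n => M i k) \o fst)//.
      by apply: continuous_comp; [exact: cvg_fst|exact: coord_continuous].
    rewrite (_ : (fun x => _) = (fun M : 'M[R]_n => M i k) \o snd)//.
    by apply: continuous_comp; [exact: cvg_snd|exact: coord_continuous].
  + by move=> [[i k] []] a x y; rewrite /coord_fun /= !mxE.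
  + move=> [[i k] b] [[i' k'] b']; rewrite /coord_fun /coord_vec !xpair_eqE /=.
    by case: b b' => -[]; rewrite !mxE ?andbT ?andbF.
  + exact: uniq_bad_coords.
  + by apply: contra ej => /eqP E; have := even_bad_coords w; rewrite -E /= => /negbFE.
Qed.

Lemma acyclic_charts_below N j : odd j -> acyclic_in (R := R) (X `&` charts_below N) j.
Proof.
case: j => // j oj; elim: N => [|N IH].
  rewrite (_ : _ `&` _ = set0); first exact: acyclic_set0.
  by apply/seteqP; split=> p // [_ []].
have [[w wN]|nw] := pselect (exists w : 'S_n, lex_rank w = N); last first.
  rewrite (_ : charts_below N.+1 = charts_below N)//.
  apply/seteqP; split=> p [w wN Vp]; exists w => //; last exact: ltnW.
  by rewrite ltn_neqAle -ltnS wN andbT; apply/eqP => E; apply: nw; exists w.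
have split_below p : charts_below N.+1 p <-> chart_set w p \/ charts_below N p.
  split=> [[w' w'N Vp]|[Vp|[w' w'N Vp]]].
  - move: w'N; rewrite ltnS leq_eqVlt => /orP[/eqP E|lt]; last by right; exists w'.
    by left; rewrite -(@lex_rank_inj _ w' w)// E wN.
  - by exists w => //; rewrite wN.
  - by exists w' => //; exact: ltnW.
have EU : X `&` charts_below N.+1 `&` chart_set w = X `&` chart_set w.
  by apply/seteqP; split=> p [] => [[Xp _] Vp|Xp Vp]; do 2?split=> //; apply/split_below; left.
have EV : X `&` charts_below N.+1 `&` charts_below N = X `&` charts_below N.
  by apply/seteqP; split=> p [] => [[Xp _] Vp|Xp Vp]; do 2?split=> //; apply/split_below; right.
apply: (@mayer_vietoris_acyclic R _ _ (chart_set w) (charts_below N)).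
- exact: open_chart_set.
- exact: open_charts_below.
- by move=> p [_ /split_below].
- by rewrite EU; exact: acyclic_chart.
- by rewrite EV; exact: IH.
- by rewrite EU -wN; exact: acyclic_chart_below.
Qed.

Theorem odd_singular_cohomology_eq0 j : odd j ->
  forall c : singular_cohomology R (set_type X) j, c = 0.
Proof.
case: j => // j oj; apply: singular_cohomology_eq0.
(* Ranks are at most the number of permutations, so this stage contains every chart. *)
rewrite (_ : X_herm h lam = X `&` charts_below (#|{: 'S_n}|.+1)); first exact: acyclic_charts_below.
apply/seteqP; split=> p; last by case.
move=> Xp; split=> //; move/X_hermP: (Xp) => [S [oS eS _]].
have [w nd] := nondeg_exists lamC_inj eS; exists w; last exact/X_nondegP.
by rewrite ltnS max_card.
Qed.

End OddCohomology.

(** * Traces of powers *)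

Section ComplexCalculus.
Context {R : realType} {V : normedModType R}.
Implicit Types (f g : V -> R[i]) (x v : V) (d e : R[i]).

Definition complex_Ck k f :=
  Ck_on k setT ((fun x => complex.Re (f x)) : V -> R^o) /\
  Ck_on k setT ((fun x => complex.Im (f x)) : V -> R^o).

Lemma complex_Ck_cst k (c : R[i]) : complex_Ck k (fun=> c).
Proof. by split; exact: Ck_on_cst. Qed.

Lemma complex_CkD k f g : complex_Ck k f -> complex_Ck k g -> complex_Ck k (fun x => f x + g x).
Proof.
move=> [fr fi] [gr gi]; split.
  under [X in Ck_on _ _ X]eq_fun do rewrite complex_ReD.
  by apply: (@Ck_onD _ _ R^o) => //; exact: openT.
under [X in Ck_on _ _ X]eq_fun do rewrite complex_ImD.
by apply: (@Ck_onD _ _ R^o) => //; exact: openT.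
Qed.

Lemma complex_CkM k f g : complex_Ck k f -> complex_Ck k g -> complex_Ck k (fun x => f x * g x).
Proof.
move=> [fr fi] [gr gi]; have oT : open [set: V] by exact: openT.
split.
  under [X in Ck_on _ _ X]eq_fun do rewrite complex_ReM.
  apply: (@Ck_onD _ _ R^o) => //; first exact: Ck_onM.
  by apply: (@Ck_on_linear_comp _ _ R^o R^o _ _ (-%R)) => //; [exact: opp_continuous|exact: Ck_onM].
under [X in Ck_on _ _ X]eq_fun do rewrite complex_ImM.
by apply: (@Ck_onD _ _ R^o) => //; exact: Ck_onM.
Qed.

Lemma complex_Ck_sum k n (F : 'I_n -> V -> R[i]) :
  (forall i, complex_Ck k (F i)) -> complex_Ck k (fun x => \sum_i F i x).
Proof.
move=> CF; elim: n F CF => [|n IH] F CF.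
  by under eq_fun do rewrite big_ord0; exact: complex_Ck_cst.
under eq_fun do rewrite big_ord_recl.
by apply: complex_CkD => //; exact: IH.
Qed.

Definition complex_derive x v f d :=
  is_derive x v ((fun x => complex.Re (f x)) : V -> R^o) (complex.Re d) /\
  is_derive x v ((fun x => complex.Im (f x)) : V -> R^o) (complex.Im d).

Lemma complex_derive_cst x v (c : R[i]) : complex_derive x v (fun=> c) 0.
Proof. by split; exact: is_derive_cst. Qed.

Lemma complex_deriveD x v f g d e : complex_derive x v f d -> complex_derive x v g e ->
  complex_derive x v (fun x => f x + g x) (d + e).
Proof.
move=> [fr fi] [gr gi]; split.
  under [X in is_derive _ _ X]eq_fun do rewrite complex_ReD.
  by rewrite complex_ReD; exact: (is_deriveD fr gr).
under [X in is_derive _ _ X]eq_fun do rewrite complex_ImD.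
by rewrite complex_ImD; exact: (is_deriveD fi gi).
Qed.

Lemma complex_deriveM x v f g d e : complex_derive x v f d -> complex_derive x v g e ->
  complex_derive x v (fun x => f x * g x) (d * g x + f x * e).
Proof.
move=> [fr fi] [gr gi]; split.
  under [X in is_derive _ _ X]eq_fun do rewrite complex_ReM.
  suff -> : complex.Re (d * g x + f x * e) =
      complex.Re (f x) *: (complex.Re e : R^o) + complex.Re (g x) *: (complex.Re d : R^o) -
      (complex.Im (f x) *: (complex.Im e : R^o) + complex.Im (g x) *: (complex.Im d : R^o)).
    exact: is_deriveB (is_deriveM fr gr) (is_deriveM fi gi).
  by rewrite complex_ReD !complex_ReM /GRing.scale /=; ring.
under [X in is_derive _ _ X]eq_fun do rewrite complex_ImM.
suff -> : complex.Im (d * g x + f x * e) =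
    complex.Re (f x) *: (complex.Im e : R^o) + complex.Im (g x) *: (complex.Re d : R^o) +
    (complex.Im (f x) *: (complex.Re e : R^o) + complex.Re (g x) *: (complex.Im d : R^o)).
  exact: is_deriveD (is_deriveM fr gi) (is_deriveM fi gr).
by rewrite complex_ImD !complex_ImM /GRing.scale /=; ring.
Qed.

Lemma complex_derive_sum x v n (F : 'I_n -> V -> R[i]) (D : 'I_n -> R[i]) :
  (forall i, complex_derive x v (F i) (D i)) ->
  complex_derive x v (fun x => \sum_i F i x) (\sum_i D i).
Proof.
move=> CF; elim: n F D CF => [|n IH] F D CF.
  by under [X in complex_derive _ _ X]eq_fun do rewrite big_ord0;
    rewrite big_ord0; exact: complex_derive_cst.
under [X in complex_derive _ _ X]eq_fun do rewrite big_ord_recl.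
by rewrite big_ord_recl; apply: complex_deriveD => //; exact: IH.
Qed.

Section MatrixPowers.
Context {n : nat}.
Implicit Types (F G : V -> 'M[R[i]]_n) (D E : 'M[R[i]]_n).

Definition mx_Ck k F := forall i j, complex_Ck k (fun x => F x i j).
Definition mx_derive x v F D := forall i j, complex_derive x v (fun x => F x i j) (D i j).

Lemma mx_CkX k F m : mx_Ck k F -> mx_Ck k (fun x => F x ^+ m).
Proof.
move=> CF; elim: m => [|m IH] i j.
  by under [X in complex_Ck _ X]eq_fun do rewrite expr0; exact: complex_Ck_cst.
under [X in complex_Ck _ X]eq_fun do rewrite exprS mxE.
by apply: complex_Ck_sum => l; exact: complex_CkM.
Qed.

Lemma complex_Ck_trace_exp k F m : mx_Ck k F -> complex_Ck k (fun x => \tr (F x ^+ m)).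
Proof. by move=> CF; apply: complex_Ck_sum => i; exact: mx_CkX. Qed.

Lemma mx_deriveM x v F G D E : mx_derive x v F D -> mx_derive x v G E ->
  mx_derive x v (fun x => F x *m G x) (D *m G x + F x *m E).
Proof.
move=> dF dG i j; under [X in complex_derive _ _ X]eq_fun do rewrite mxE.
rewrite !mxE -big_split /=.
by apply: complex_derive_sum => l; exact: complex_deriveM.
Qed.

Lemma mx_deriveX x v F D m : mx_derive x v F D ->
  mx_derive x v (fun x => F x ^+ m) (\sum_(i < m) F x ^+ i *m D *m F x ^+ (m - i.+1)).
Proof.
move=> dF; elim: m => [|m IH].
  under [X in mx_derive _ _ X]eq_fun do rewrite expr0.
  by move=> i j; rewrite big_ord0 [X in complex_derive _ _ _ X]mxE; exact: complex_derive_cst.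
under [X in mx_derive _ _ X]eq_fun do rewrite exprS.
have := mx_deriveM dF IH; congr mx_derive.
rewrite [RHS]big_ord_recl /= expr0 mul1mx subn1 /=; congr (_ + _).
rewrite mulmx_sumr; apply: eq_bigr => i _.
by rewrite subSS !mulmxA exprS.
Qed.

(** The terms of the noncommutative Leibniz sum have equal traces by cyclicity. *)
Lemma complex_derive_trace_exp x v F D m : mx_derive x v F D ->
  complex_derive x v (fun x => \tr (F x ^+ m)) (m%:R * \tr (F x ^+ m.-1 *m D)).
Proof.
move=> dF; have -> : m%:R * \tr (F x ^+ m.-1 *m D) =
    \tr (\sum_(i < m) F x ^+ i *m D *m F x ^+ (m - i.+1)).
  rewrite raddf_sum /= (eq_bigr (fun=> \tr (F x ^+ m.-1 *m D))).
    by rewrite sumr_const card_ord mulr_natl.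
  move=> i _; rewrite mxtrace_mulC mulmxA.
  rewrite -[F x ^+ (m - i.+1) *m _]/(F x ^+ (m - i.+1) * F x ^+ i) -exprD.
  by congr (\tr (_ ^+ _ *m _)); have := ltn_ord i; lia.
by apply: complex_derive_sum => i; exact: mx_deriveX.
Qed.

End MatrixPowers.
End ComplexCalculus.

(** * Newton's identities and transversality *)

Section NewtonIdentities.
Context {F : numFieldType} {n : nat}.
Implicit Types f g : 'I_n -> F.

Definition root_poly f : {poly F} := \prod_i ('X - (f i)%:P).

Lemma size_root_poly f : size (root_poly f) = n.+1.
Proof. by rewrite size_prod_XsubC -sum1_size big_const_ord iter_addn_0 mul1n. Qed.

(** Horner division of [root_poly f] by its factor at [i]; the extra ['X] shifts indices so that the
    formula also covers [m = 0]. *)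
Lemma root_poly_cofactor f i m (Q := \prod_(j | j != i) ('X - (f j)%:P)) :
  ('X * Q)`_m = \sum_(j < n.+1 - m) (root_poly f)`_(m + j) * f i ^+ j.
Proof.
have PE : root_poly f = 'X * Q - (f i)%:P * Q by rewrite /root_poly (bigD1 i)//= mulrBl.
have step k : ('X * Q)`_k = (root_poly f)`_k + f i * ('X * Q)`_k.+1.
  have XQ : ('X * Q)`_k.+1 = Q`_k by rewrite coefXM.
  by rewrite XQ PE coefB coefCM addrNK.
have [d] := ubnP (n.+1 - m); elim: d m => // d IH m md.
have [nm|mn] := leqP n.+1 m.
  rewrite (eqP (_ : n.+1 - m == 0)%N); last by rewrite subn_eq0.
  rewrite big_ord0 nth_default//; apply: leq_trans (size_polyMleq _ _) _.
  have : size (root_poly f) = (size Q).+1.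
    have Q0 : Q != 0 by apply: monic_neq0; apply: monic_prod => j _; exact: monicXsubC.
    by rewrite /root_poly (bigD1 i)//= size_monicM ?monicXsubC// size_XsubC.
  by rewrite size_root_poly size_polyX => -[<-] /=; rewrite add1n.
rewrite step IH; last by move: md; lia.
rewrite (subSn (mn : (m <= n)%N)) big_ord_recl /= addn0 expr0 mulr1; congr (_ + _).
rewrite (_ : n.+1 - m.+1 = n - m)%N; last by lia.
rewrite mulr_sumr; apply: eq_bigr => j _; rewrite /= /bump /= add1n addSnnS exprS.
by rewrite mulrCA.
Qed.

(** ['X] times the derivative is the sum over [i] of the products computed in
    [root_poly_cofactor]. *)
Lemma newton_identity f m : (m <= n)%N ->
  (root_poly f)`_m *+ m = \sum_(j < n.+1 - m) (root_poly f)`_(m + j) * \sum_i f i ^+ j.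
Proof.
move=> mn; have -> : (root_poly f)`_m *+ m = ('X * (root_poly f)^`())`_m.
  by rewrite coefXM; case: m mn => [|m] _; rewrite ?mulr0n//= coef_deriv.
have -> : (root_poly f)^`() = \sum_i \prod_(j | j != i) ('X - (f j)%:P).
  rewrite /root_poly; have : uniq (index_enum 'I_n) by exact: index_enum_uniq.
  elim: (index_enum 'I_n) => [|a r IH] /=; first by rewrite !big_nil derivC.
  move=> /andP[ar ur]; rewrite !big_cons derivM derivXsubC mul1r IH//= eqxx; congr (_ + _).
    by rewrite big_seq [RHS]big_seq_cond; apply: eq_bigl => j; case: eqP => [->|];
      rewrite ?(negPf ar) ?andbT.
  rewrite mulr_sumr big_seq [RHS]big_seq; apply: eq_bigr => i ir; rewrite big_cons.
  by rewrite (negPf (_ : a != i))//; apply: contraNneq ar => ->.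
rewrite mulr_sumr coef_sum; under eq_bigr do rewrite root_poly_cofactor.
by rewrite exchange_big; apply: eq_bigr => j _; rewrite mulr_sumr.
Qed.

Lemma power_sums_root_poly f g :
  (forall k, (0 < k <= n)%N -> \sum_i f i ^+ k = \sum_i g i ^+ k) -> root_poly f = root_poly g.
Proof.
move=> fg; apply/polyP => m.
have [nm|mn] := ltnP n m; first by rewrite !nth_default ?size_root_poly.
have [d] := ubnP (n - m); elim: d m mn => // d IH m mn md.
have lead p : (root_poly p)`_n = 1.
  have : root_poly p \is monic by apply: monic_prod => j _; exact: monicXsubC.
  by move/monicP; rewrite /lead_coef size_root_poly.
move: mn; rewrite leq_eqVlt => /orP[/eqP->|mn]; first by rewrite !lead.
(* The power sum of exponent 0 is [n]; moving its term to the left leaves the factor [m - n],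
   invertible below the leading coefficient. *)
have E p : (root_poly p)`_m *+ m - (root_poly p)`_m *+ n =
    \sum_(j < n - m) (root_poly p)`_(m + j.+1) * \sum_i p i ^+ j.+1.
  rewrite newton_identity ?(ltnW mn)// (subSn (ltnW mn)) big_ord_recl /= addn0.
  under [X in _ * X]eq_bigr do rewrite expr0.
  by rewrite sumr_const card_ord mulr_natr addrAC subrr add0r.
have : (root_poly f)`_m *+ m - (root_poly f)`_m *+ n =
    (root_poly g)`_m *+ m - (root_poly g)`_m *+ n.
  rewrite !E; apply: eq_bigr => j _; have := ltn_ord j => jn.
  by rewrite fg ?IH//; lia.
have nm0 : (n - m)%:R != 0 :> F by rewrite pnatr_eq0 subn_eq0 -ltnNge.
move=> H; apply: (mulfI nm0); rewrite !mulr_natl !mulrnBr ?(ltnW mn)//.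
by rewrite -[LHS]opprB -[RHS]opprB H.
Qed.

Lemma root_polyP f a : root (root_poly f) a = [exists i, a == f i].
Proof.
apply/idP/existsP => [|[i /eqP ->]].
  rewrite /root_poly /root horner_prod => /eqP/eqP/prodf_eq0[i _].
  by rewrite hornerXsubC subr_eq0 => ai; exists i.
by rewrite /root /root_poly horner_prod (bigD1 i)//= hornerXsubC subrr mul0r.
Qed.

End NewtonIdentities.

(** * Matrices that commute with a staircase matrix *)

Section Transversality.
Context {C : numClosedFieldType} {n : nat} (h : 'I_n -> 'I_n) (lam : 'I_n -> C).
Hypotheses (hh : hessenberg_function h) (lam_inj : injective lam).
Implicit Types (A B N S : 'M[C]_n).

(** In an eigenbasis of [A] the matrix [N] is diagonal because the spectrum is simple, and its
    diagonal entries are eigenvalues of a nilpotent matrix. *)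
Lemma commuting_strictly_lower_eq0 A N S : eigbasis lam 1 A S -> A *m N = N *m A ->
  (forall i j : 'I_n, (i <= j)%N -> N i j = 0) -> N = 0.
Proof.
move=> [uS SA] AN lN; pose D := S *m N *m invmx S.
have DS : D *m S = S *m N by rewrite mulmxKV.
have dD : D *m eigdiag lam 1 = eigdiag lam 1 *m D.
  have -> : eigdiag lam 1 = S *m A *m invmx S by rewrite SA mulmxK.
  by rewrite /D !mulmxA !mulmxKV//; congr (_ *m _); rewrite -!mulmxA AN.
have D0 i j : i != j -> D i j = 0.
  move=> ij; have /matrixP/(_ i j) := dD; rewrite mul_mx_diag mul_diag_mx !mxE !perm1 mulrC.
  move/eqP; rewrite -subr_eq0 -mulrBl mulf_eq0 subr_eq0 => /orP[/eqP/lam_inj E|/eqP//].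
  by rewrite E eqxx in ij.
have rN i : row i S *m N = D i i *: row i S.
  rewrite -row_mul -DS; apply/rowP => k; rewrite [LHS]mxE [LHS]mxE [RHS]mxE [X in _ = _ * X]mxE.
  rewrite (bigD1 i)//= big1 ?addr0// => j ji.
  by rewrite D0 ?mul0r// eq_sym.
have Dii i : D i i = 0.
  apply/eqP; apply: contrapT => /negP Di.
  have uN : N - (D i i)%:M \in unitmx.
    apply: trigmx_unit => [|k].
      by left=> a b; rewrite -ltnNge => ab; rewrite !mxE lN ?(ltnW ab)// -val_eqE (ltn_eqF ab) subr0.
    by rewrite mxE [X in _ + X]mxE [X in _ - X]mxE lN// eqxx mulr1n sub0r oppr_eq0.
  have r0 : row i S *m (N - (D i i)%:M) = 0 by rewrite mulmxBr rN mul_mx_scalar subrr.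
  have {}r0 : row i S = 0 by rewrite -[row i S](mulmxK uN) r0 mul0mx.
  have /matrixP/(_ i i) := mulmxV uS; rewrite [RHS]mxE eqxx mxE big1 => [/eqP|k _].
    by rewrite eq_sym oner_eq0.
  by have /rowP/(_ k) := r0; rewrite !mxE => ->; rewrite mul0r.
have : S *m N = 0.
  apply/row_matrixP => i; rewrite row_mul rN Dii scale0r; apply/rowP => k; by rewrite !mxE.
by move=> SN; rewrite -[N](mulKmx uS) SN mulmx0.
Qed.

(* Writing [B = N + ct N] with [N] below the staircase, [A *m N - N *m A] is strictly lower and
   [A *m ct N - ct N *m A] strictly upper triangular, so that both vanish. *)
Lemma commuting_off_staircase_eq0 A B S : A \is hermsymmx -> B \is hermsymmx -> hessmx h A ->
  eigbasis lam 1 A S -> A *m B = B *m A ->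
  (forall i j : 'I_n, (i <= h j)%N -> (j <= h i)%N -> B i j = 0) -> B = 0.
Proof.
rewrite !hermP => /eqP hA /eqP hB sA eS AB B0.
pose N : 'M[C]_n := \matrix_(i, j) (if (h j < i)%N then B i j else 0).
have N0 (i j : 'I_n) : (i <= h j)%N -> N i j = 0 by move=> ij; rewrite mxE ltnNge ij.
have A0 (i j : 'I_n) : (h i < j)%N -> A i j = 0 by move=> ij; rewrite hA ctE sA// conjC0.
have BN : B = N + ct N.
  apply/matrixP => i j; rewrite [RHS]mxE ctE !mxE.
  have [ji|ij] := ltnP (h j) i.
    rewrite ifN ?conjC0 ?addr0// -leqNgt (leq_trans _ (hh.1 i))//.
    by rewrite ltnW// (leq_ltn_trans (hh.1 j) ji).
  rewrite add0r; case: ltnP => [lt|ge]; first by rewrite [in LHS]hB ctE.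
  by rewrite conjC0 B0.
pose M := A *m N - N *m A.
have M0 (i j : 'I_n) : (i <= j)%N -> M i j = 0.
  move=> ij; have hij := hessenberg_le hh ij.
  have AN0 : (A *m N) i j = 0.
    rewrite mxE big1// => k _; have [/N0->|jk] := leqP k (h j); first by rewrite mulr0.
    by rewrite A0 ?mul0r// (leq_ltn_trans hij).
  have NA0 : (N *m A) i j = 0.
    rewrite mxE big1// => k _; have [/N0->|ki] := leqP i (h k); first by rewrite mul0r.
    by rewrite A0 ?mulr0// (leq_trans ki).
  by rewrite /M mxE [X in _ + X]mxE AN0 NA0 subr0.
have cM : ct M = - (A *m ct N - ct N *m A).
  apply/matrixP => i j; have /matrixP/(_ i j) : ct M = ct N *m ct A - ct A *m ct N.
    by rewrite -!ctM; apply/matrixP => a b; rewrite !ctE !mxE rmorphB !rmorph_sum.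
  by move=> ->; rewrite -hA opprB.
have MM : M = ct M.
  rewrite cM; apply/eqP; rewrite -addr_eq0; apply/eqP.
  have : A *m B - B *m A = 0 by rewrite AB subrr.
  by rewrite BN mulmxDr mulmxDl opprD addrACA.
have {MM}AN : A *m N = N *m A.
  apply/eqP; rewrite -subr_eq0 -/M; apply/eqP/matrixP => i j; rewrite [RHS]mxE.
  have [ij|ij] := leqP i j; first exact: M0.
  by rewrite MM ctE M0 ?conjC0// ltnW.
have NE0 : N = 0.
  apply: (commuting_strictly_lower_eq0 eS AN) => i j ij; apply: N0.
  exact: leq_trans ij (hh.1 j).
by rewrite BN NE0 add0r; apply/matrixP => i j; rewrite ctE !mxE conjC0.
Qed.

(** A polynomial of degree below [n] that annihilates [A] has the [n] distinct eigenvalues as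
    roots. *)
Lemma sum_powers_eq0 A S (c : 'I_n -> C) : eigbasis lam 1 A S ->
  \sum_k c k *: A ^+ k = 0 -> forall k, c k = 0.
Proof.
move=> [uS SA] cA.
pose p : {poly C} := \poly_(k < n) (if insub k is Some i then c i else 0).
have rA i k : row i S *m A ^+ k = lam i ^+ k *: row i S.
  elim: k => [|k IH]; first by rewrite !expr0 mulmx1 scale1r.
  rewrite exprSr -[A ^+ k * A]/(A ^+ k *m A) mulmxA IH -scalemxAl -row_mul SA.
  apply/rowP => l; rewrite !mxE (bigD1 i)//= big1 ?addr0.
    by rewrite !mxE eqxx mulr1n perm1 exprS mulrA [_ * lam i]mulrC.
  by move=> a ai; rewrite !mxE eq_sym (negPf ai) mulr0n mul0r.
have p0 : p = 0.
  apply: (@roots_geq_poly_eq0 _ _ [seq lam i | i : 'I_n]).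
  - apply/allP => _ /mapP[i _ ->]; apply/eqP.
    have : row i S *m (\sum_k c k *: A ^+ k) = p.[lam i] *: row i S.
      rewrite mulmx_sumr horner_poly scaler_suml; apply: eq_bigr => k _.
      by rewrite -scalemxAr rA scalerA insubT//= => lt; congr (c _ * _ *: _); exact: val_inj.
    rewrite cA mulmx0 => /esym/eqP; rewrite scaler_eq0 => /orP[/eqP//|/eqP r0].
    have /matrixP/(_ i i) := mulmxV uS; rewrite [RHS]mxE eqxx mxE big1 => [/eqP|k _].
      by rewrite eq_sym oner_eq0.
    by have /rowP/(_ k) := r0; rewrite !mxE => ->; rewrite mul0r.
  - by rewrite map_inj_uniq// enum_uniq.
  - by rewrite size_map -cardE card_ord size_poly.
move=> k; have /polyP/(_ k) := p0; rewrite coef_poly coef0 ltn_ord insubT//= => lt <-.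
by congr c; exact: val_inj.
Qed.

End Transversality.

(** * Counting the free real coordinates *)

Section StaircaseCount.
Context {n : nat} (h : 'I_n -> 'I_n).
Hypothesis hh : hessenberg_function h.

Lemma card_ord_itv (a b : nat) : (b <= n)%N -> \sum_(i < n | (a <= i < b)%N) 1 = (b - a)%N.
Proof.
move=> bn; rewrite -(big_mkord (fun i => (a <= i < b)%N) (fun=> 1%N)).
have [ab|ba] := leqP a b; last first.
  rewrite (eqP (_ : b - a == 0)%N) ?subn_eq0 1?ltnW// big1// => i.
  by move=> /andP[ai ib]; have := leq_ltn_trans ai ib; rewrite ltnNge (ltnW ba).
rewrite -[RHS]muln1 -sum_nat_const_nat (big_nat_widen _ _ _ _ _ bn) (big_nat_widenl a 0)//.
by apply: eq_bigl => i; rewrite andbC.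
Qed.

(* Positions of the free real coordinates of a staircase matrix; [true] marks real parts and
   [cx] tells whether the entries are complex. *)
Definition stair_index (cx : bool) : pred ('I_n * 'I_n * bool) := fun x =>
  [&& (x.1.2 <= x.1.1)%N, (x.1.1 <= h x.1.2)%N & x.2 || cx && (x.1.2 < x.1.1)%N].

(** The diagonal accounts for the excess [n] over the dimension, and it matches the [n] trace
    functions that cut out the level. *)
Lemma card_stair_index cx :
  #|stair_index cx| = ((if cx then 2 * staircase_dim h else staircase_dim h) + n)%N.
Proof.
have E (x : bool) : \sum_(p : 'I_n * 'I_n | stair_index cx (p, x)) 1 =
    (if x then staircase_dim h + n else if cx then staircase_dim h else 0)%N.
  rewrite -(pair_big_dep xpredT (fun i j => stair_index cx ((i, j), x)) (fun _ _ => 1%N)) /=.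
  rewrite (exchange_big_dep xpredT)//= /stair_index /=.
  have hn (j : 'I_n) : (h j < n)%N by exact: ltn_ord.
  case: x => /=.
    transitivity (\sum_(j < n) ((h j - j) + 1))%N.
      apply: eq_bigr => j _; rewrite addn1 -subSn ?(hh.1 j)// -(card_ord_itv j (hn j)).
      by apply: eq_bigl => i; rewrite ltnS andbT.
    by rewrite big_split /= sum1_card card_ord.
  case: cx => /=; last by rewrite big1// => j _; rewrite big_pred0// => i; rewrite !andbF.
  apply: eq_bigr => j _; rewrite -(subSS j) -(card_ord_itv j.+1 (hn j)).
  by apply: eq_bigl => i; rewrite ltnS; case: ltngtP; rewrite ?andbT ?andbF.
rewrite -sum1_card.
transitivity (\sum_(x : bool) \sum_(p : 'I_n * 'I_n | stair_index cx (p, x)) 1)%N.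
  rewrite pair_big_dep /= (reindex (fun q : bool * ('I_n * 'I_n) => (q.2, q.1))) //=.
  by exists (fun q => (q.2, q.1)) => -[].
rewrite big_bool /= !E; case: cx {E} => /=; rewrite ?addn0//.
by rewrite mul2n -addnn addnAC.
Qed.

End StaircaseCount.

(** * Staircase matrices as levels *)

Lemma trace_exp_eigbasis {C : numClosedFieldType} {n : nat} (mu : 'I_n -> C) (A S : 'M[C]_n) k :
  eigbasis mu 1 A S -> \tr (A ^+ k) = \sum_i mu i ^+ k.
Proof.
move=> [uS SA].
have SAk : S *m A ^+ k = diag_mx (\row_i mu i ^+ k) *m S.
  elim: k => [|k IH].
    rewrite expr0 mulmx1; apply/matrixP => i j; rewrite mul_diag_mx !mxE expr0 mul1r//.
  rewrite exprSr -[A ^+ k * A]/(A ^+ k *m A) mulmxA IH -mulmxA SA mulmxA; congr (_ *m _).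
  by rewrite mulmx_diag; congr diag_mx; apply/rowP => i; rewrite !mxE perm1 exprSr.
rewrite -[A ^+ k](mulKmx uS) SAk mxtrace_mulC mulmxK// mxtrace_diag.
by apply: eq_bigr => i _; rewrite mxE.
Qed.

Section StaircaseLevels.
Context {R : realType} {n : nat} (h : 'I_n -> 'I_n) (cx : bool).
Hypothesis hh : hessenberg_function h.
Local Notation T := ('M[R]_n * 'M[R]_n)%type.
Local Notation N := #|stair_index h cx|.
Implicit Types (x v : 'rV[R]_N) (p : T) (t : 'I_n * 'I_n * bool) (lam mu : 'I_n -> R).

(** The sum has at most one term. It reads 0 at positions that are not free, and it is linear in [x]
    without a case distinction. *)
Definition stair_coord x t : R := \sum_(k | enum_val k == t) x 0 k.

Lemma stair_coord_val x k : stair_coord x (enum_val k) = x 0 k.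
Proof.
rewrite /stair_coord (bigD1 k)//= big1 ?addr0// => j /andP[/eqP/enum_val_inj -> /eqP//].
Qed.

Lemma stair_coord_notin x t : ~~ stair_index h cx t -> stair_coord x t = 0.
Proof.
move=> nt; rewrite /stair_coord big_pred0// => k; apply/eqP => E.
by move/negP: nt; apply; rewrite -E; exact: (enum_valP k).
Qed.

(** The Hermitian matrix with the given lower part. On the diagonal, the imaginary part reads a
    position that is never free, hence 0. *)
Definition stair_pair x : T :=
  (\matrix_(i, j) if (j <= i)%N then stair_coord x (i, j, true) else stair_coord x (j, i, true),
   \matrix_(i, j) if (j < i)%N then stair_coord x (i, j, false) else - stair_coord x (j, i, false)).

Definition stair_row p : 'rV[R]_N := \row_k coord_fun (enum_val k) p.

Lemma stair_coord_row p t :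
  stair_coord (stair_row p) t = if stair_index h cx t then coord_fun t p else 0.
Proof.
case: ifP => [It|/negbT/stair_coord_notin//].
have It' : t \in stair_index h cx by exact: It.
by rewrite -[in LHS](enum_rankK_in It' It') stair_coord_val mxE enum_rankK_in.
Qed.

Lemma stair_coord_linear a x v t :
  stair_coord (a *: x + v) t = a * stair_coord x t + stair_coord v t.
Proof.
rewrite /stair_coord mulr_sumr -big_split /=.
by apply: eq_bigr => k _; rewrite !mxE.
Qed.

Lemma stair_pair_linear : linear stair_pair.
Proof.
move=> a x v; congr pair; apply/matrixP => i j; rewrite !mxE.
  by case: ifP => _; rewrite stair_coord_linear.
by case: ifP => _; rewrite stair_coord_linear// opprD mulrN.
Qed.

HB.instance Definition _ := GRing.isLinear.Build R 'rV[R]_N T *:%R stair_pair stair_pair_linear.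

Lemma stair_row_linear : linear stair_row.
Proof.
by move=> a p q; apply/rowP => k; rewrite !mxE /coord_fun; case: ifP => _ /=; rewrite !mxE.
Qed.

HB.instance Definition _ := GRing.isLinear.Build R T 'rV[R]_N *:%R stair_row stair_row_linear.

Lemma coord_fun_continuous t : continuous (coord_fun t : T -> R).
Proof.
case: t => [[i j] []] p; rewrite /coord_fun /=.
  apply: (@continuous_comp T _ _ fst (fun M : 'M[R]_n => M i j) p); first exact: cvg_fst.
  exact: coord_continuous.
apply: (@continuous_comp T _ _ snd (fun M : 'M[R]_n => M i j) p); first exact: cvg_snd.
exact: coord_continuous.
Qed.

Lemma stair_row_continuous : continuous stair_row.
Proof.
move=> p; apply: mx_continuous_at => i j.
under [X in {for p, continuous X}]eq_fun do rewrite mxE.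
exact: coord_fun_continuous.
Qed.

Lemma stair_pairK : cancel stair_pair stair_row.
Proof.
move=> x; apply/rowP => k; rewrite mxE -stair_coord_val.
have := enum_valP k; rewrite unfold_in /stair_index; case: (enum_val k) => [[i j] []] /=.
  by move=> /and3P[ji _ _]; rewrite /coord_fun /= mxE ji.
by move=> /and3P[_ _ /andP[_ ji]]; rewrite /coord_fun /= mxE ji.
Qed.

Definition stair_mx x : 'M[R[i]]_n := cplx (stair_pair x).

Lemma stair_mx_herm x : stair_mx x \is hermsymmx.
Proof.
rewrite hermP; apply/eqP/matrixP => i j; rewrite ctE; apply/eqP; rewrite eq_complex.
rewrite complex_ReJ complex_ImJ !mxE /=; case: (ltngtP i j) => [ij|ij|/val_inj ->] //=.
- by rewrite eqxx /=.
- by rewrite opprK !eqxx.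
- rewrite (_ : stair_coord x (j, j, false) = 0) ?oppr0 ?eqxx//.
  by rewrite stair_coord_notin// /stair_index /= ltnn !andbF.
Qed.

Lemma stair_mx_hess x : hessmx h (stair_mx x).
Proof.
move=> i j ji; have lt := leq_ltn_trans (hh.1 j) ji.
rewrite /stair_mx !mxE lt (ltnW lt); apply/eqP; rewrite eq_complex /=.
by rewrite !stair_coord_notin ?eqxx// /stair_index /= [(i <= h j)%N]leqNgt ji !andbF.
Qed.

Lemma stair_pair_real x : ~~ cx -> (stair_pair x).2 = 0.
Proof.
move=> ncx; apply/matrixP => i j; rewrite !mxE.
by case: ifP => _; rewrite stair_coord_notin ?oppr0// /stair_index /= (negPf ncx) !andbF.
Qed.

Lemma stair_rowK p : cplx p \is hermsymmx -> hessmx h (cplx p) -> (~~ cx -> p.2 = 0) ->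
  stair_pair (stair_row p) = p.
Proof.
rewrite hermP => /eqP/matrixP hp sp rp.
have re_sym i j : p.1 i j = p.1 j i.
  by have /(congr1 (@complex.Re R)) := hp i j; rewrite ctE complex_ReJ !mxE.
have im_sym i j : p.2 i j = - p.2 j i.
  by have /(congr1 (@complex.Im R)) := hp i j; rewrite ctE complex_ImJ !mxE.
have re0 (i j : 'I_n) : (h j < i)%N -> p.1 i j = 0.
  by move=> ji; have /(congr1 (@complex.Re R)) := sp i j ji; rewrite !mxE.
have im0 (i j : 'I_n) : (h j < i)%N -> p.2 i j = 0.
  by move=> ji; have /(congr1 (@complex.Im R)) := sp i j ji; rewrite !mxE.
have reE (i j : 'I_n) : (j <= i)%N -> stair_coord (stair_row p) (i, j, true) = p.1 i j.
  move=> ji; rewrite stair_coord_row /stair_index /coord_fun /= ji /= andbT.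
  by case: leqP => // /re0.
have imE (i j : 'I_n) : (j < i)%N -> stair_coord (stair_row p) (i, j, false) = p.2 i j.
  move=> ji; rewrite stair_coord_row /stair_index /coord_fun /= ji (ltnW ji) /= andbT.
  case: leqP => [_|/im0//] /=.
  by case: ifP => // /negbT/rp ->; rewrite mxE.
have imD i : p.2 i i = 0 by have := im_sym i i; move: (p.2 i i) => a; lra.
rewrite [RHS]surjective_pairing; congr pair; apply/matrixP => i j; rewrite mxE.
  by have [ji|/ltnW ij] := leqP j i; rewrite reE// re_sym.
have [ji|] := ltnP j i; first by rewrite imE.
rewrite leq_eqVlt => /orP[/eqP/val_inj ->|ij]; last by rewrite imE// -im_sym.
by rewrite imD stair_coord_notin ?oppr0// /stair_index /= ltnn !andbF.
Qed.

(** The traces are real because the matrix is Hermitian, so real parts lose nothing. *)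
Definition trace_powers x : 'rV[R]_n := \row_k complex.Re (\tr (stair_mx x ^+ k.+1)).

Definition power_sums lam : 'rV[R]_n := \row_k \sum_i lam i ^+ k.+1.

Definition stair_entry t x : R^o := coord_fun t (stair_pair x).

Lemma stair_entry_linear t : linear (stair_entry t).
Proof.
move=> a x v; rewrite /stair_entry linearP /coord_fun.
by case: ifP => _ /=; rewrite !mxE.
Qed.

HB.instance Definition _ t :=
  GRing.isLinear.Build R 'rV[R]_N R^o *:%R (stair_entry t) (stair_entry_linear t).

Lemma stair_mx_Re x i j : complex.Re (stair_mx x i j) = stair_entry (i, j, true) x.
Proof. by rewrite mxE. Qed.

Lemma stair_mx_Im x i j : complex.Im (stair_mx x i j) = stair_entry (i, j, false) x.
Proof. by rewrite mxE. Qed.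

Lemma stair_mx_Ck k : mx_Ck k stair_mx.
Proof.
move=> i j; split.
  under [X in Ck_on _ _ X]eq_fun do rewrite stair_mx_Re.
  by apply: Ck_on_linear; exact: linear_rV_continuous.
under [X in Ck_on _ _ X]eq_fun do rewrite stair_mx_Im.
by apply: Ck_on_linear; exact: linear_rV_continuous.
Qed.

Lemma is_derive_linear (f : {linear 'rV[R]_N -> R^o}) x v : is_derive x v f (f v).
Proof.
have cf : continuous f by exact: linear_rV_continuous.
apply: DeriveDef; last exact: linear_derive.
by apply: diff_derivable; exact: linear_differentiable.
Qed.

Lemma stair_mx_derive x v : mx_derive x v stair_mx (stair_mx v).
Proof.
move=> i j; split.
  rewrite stair_mx_Re; under [X in is_derive _ _ X]eq_fun do rewrite stair_mx_Re.
  exact: is_derive_linear.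
rewrite stair_mx_Im; under [X in is_derive _ _ X]eq_fun do rewrite stair_mx_Im.
exact: is_derive_linear.
Qed.

Lemma trace_powers_Ck k : Ck_on k setT trace_powers.
Proof.
apply/Ck_on_coord => [|i j]; first exact: openT.
under eq_fun do rewrite mxE.
by have [] := complex_Ck_trace_exp j.+1 (stair_mx_Ck k).
Qed.

Lemma Re_natmul m (z : R[i]) : complex.Re (m%:R * z) = m%:R * complex.Re z.
Proof.
rewrite !mulr_natl; elim: m => [|m IH]; first by rewrite !mulr0n.
by rewrite !mulrS complex_ReD IH.
Qed.

Lemma derive_trace_powers x v k :
  ('D_v trace_powers x) 0 k = k.+1%:R * complex.Re (\tr (stair_mx x ^+ k *m stair_mx v)).
Proof.
have dF : differentiable trace_powers x := Ck1_differentiable x (trace_powers_Ck 1).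
have cc : continuous (mx_coord 0 k : 'rV[R]_n -> R^o) by exact: linear_rV_continuous.
rewrite -[LHS]/(mx_coord 0 k ('D_v trace_powers x)) -(derive_linear_comp v cc dF).
rewrite (_ : (fun y => mx_coord 0 k (trace_powers y)) =
    (fun y => complex.Re (\tr (stair_mx y ^+ k.+1))) :> (_ -> R^o)).
  have [dr _] := complex_derive_trace_exp k.+1 (stair_mx_derive x v).
  by rewrite derive_val Re_natmul.
by apply/funext => y; rewrite /mx_coord mxE.
Qed.

(** The spectral theorem provides some real eigenvalues [mu]; equal power sums give equal root
    polynomials, hence the same set of values. *)
Lemma level_spectrumP x lam : simple_spectrum lam ->
  trace_powers x = power_sums lam <-> X_herm h lam (stair_pair x).
Proof.
move=> slam; pose lamC i : R[i] := (lam i)%:C%C.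
have Re_sums (mu : 'I_n -> R) k : complex.Re (\sum_i ((mu i)%:C%C : R[i]) ^+ k) = \sum_i mu i ^+ k.
  have -> : \sum_i ((mu i)%:C%C : R[i]) ^+ k = (\sum_i mu i ^+ k)%:C%C.
    by rewrite rmorph_sum; apply: eq_bigr => i _; rewrite rmorphXn.
  by [].
split=> [E|/(X_hermP h slam)[S [oS eS _]]]; last first.
  by apply/rowP => k; rewrite !mxE (trace_exp_eigbasis _ eS) Re_sums.
pose A := stair_mx x; have hA : A \is hermsymmx := stair_mx_herm x.
pose P := spectralmx A; pose mu i := complex.Re (spectral_diag A 0 i).
have sdE i : (mu i)%:C%C = spectral_diag A 0 i.
  by apply: RRe_real; apply: (mxOverP (hermitian_spectral_diag_real hA)).
have AE : A = invmx P *m diag_mx (spectral_diag A) *m P.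
  exact/orthomx_spectralP/hermitian_normalmx.
have oP : unitary P by have /unitarymxP := spectral_unitarymx A.
have eP : eigbasis (fun i => (mu i)%:C%C) 1 A P.
  split; first exact: unitary_unit.
  rewrite {1}AE !mulmxA mulmxV ?unitary_unit// mul1mx; congr (diag_mx _ *m _).
  by apply/rowP => i; rewrite mxE perm1 sdE.
have /power_sums_root_poly E' : forall k, (0 < k <= n)%N -> \sum_i mu i ^+ k = \sum_i lam i ^+ k.
  move=> [//|k] /= kn; have /rowP/(_ (Ordinal kn)) := E.
  by rewrite !mxE (trace_exp_eigbasis _ eP) Re_sums.
have mulam (a : R) : (exists i, a = mu i) <-> exists i, a = lam i.
  have := root_polyP mu a; rewrite E' root_polyP => Ea.
  split=> -[i ai].
    by have /existsP[j /eqP ->] : [exists i, a == lam i]; [rewrite Ea; apply/existsP; exists i; rewrite ai|exists j].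
  by have /existsP[j /eqP ->] : [exists i, a == mu i]; [rewrite -Ea; apply/existsP; exists i; rewrite ai|exists j].
have mu_real i : ((mu i)%:C%C : R[i]) \is Num.real by rewrite complex_real.
have [_ eA] := eigbasis_herm mu_real oP eP.
exists A; last exact: cplxK.
split; first by split=> //; apply/herm_staircase => //; exact: stair_mx_hess.
split=> //; apply/seteqP; split=> a /=.
  by move=> /eA[i ->]; have /mulam[j ->] : exists j, mu i = mu j; [exists i|exists j].
move=> [i _ <-]; apply/eA; have /mulam[j E2] : exists j, lam i = lam j by exists i.
by exists j; rewrite E2.
Qed.

(** The trace of [A *m A] is the sum of the squared moduli of all entries and is fixed by the
    spectrum; [1 + u ^+ 2] bounds the absolute value of [u] without a root. *)
Lemma level_bound x lam : simple_spectrum lam -> trace_powers x = power_sums lam ->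
  `|x| <= 1 + \sum_i lam i ^+ 2.
Proof.
move=> slam /(level_spectrumP x slam)/(X_hermP h slam)[S [_ eS _]].
have s0 : 0 <= \sum_i lam i ^+ 2 by apply: sumr_ge0 => i _; exact: sqr_ge0.
pose A := stair_mx x.
have sumE : \sum_i \sum_j (complex.Re (A i j) ^+ 2 + complex.Im (A i j) ^+ 2) = \sum_i lam i ^+ 2.
  have := trace_exp_eigbasis 2 eS; rewrite expr2 -[_ * _]/(_ *m _) => /(congr1 (@complex.Re R)).
  rewrite -/(stair_mx x) -/A /mxtrace !complex_Re_sum => E.
  transitivity (\sum_i complex.Re ((A *m A) i i)).
    apply: eq_bigr => i _; rewrite mxE complex_Re_sum; apply: eq_bigr => j _.
    have := stair_mx_herm x; rewrite hermP => /eqP/matrixP/(_ j i).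
    by rewrite -/A ctE => ->; rewrite complex_ReM complex_ReJ complex_ImJ mulrN opprK !expr2.
  rewrite E; apply: eq_bigr => i _; rewrite -rmorphXn /=.
  by [].
apply: rV_norm_le => [|a k]; first by rewrite addr_ge0.
have -> : x a k = stair_entry (enum_val k) x by rewrite ord1 -[in LHS](stair_pairK x) mxE.
case: (enum_val k) => [[i j] b].
have le_sum : complex.Re (A i j) ^+ 2 + complex.Im (A i j) ^+ 2 <= \sum_i lam i ^+ 2.
  rewrite -sumE (bigD1 i)//= (bigD1 j)//= -addrA lerDl.
  by rewrite addr_ge0// ?sumr_ge0// => l _; rewrite ?sumr_ge0 ?addr_ge0 ?sqr_ge0// => m _;
    rewrite addr_ge0 ?sqr_ge0.
have abs_le (u : R) : `|u| <= 1 + u ^+ 2.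
  by rewrite ler_norml; apply/andP; split; nra.
apply: le_trans (abs_le _) _; rewrite lerD2l; apply: le_trans le_sum.
by case: b; rewrite -?stair_mx_Re -?stair_mx_Im -/A ?lerDl ?lerDr sqr_ge0.
Qed.

Lemma level_regular x lam : simple_spectrum lam -> trace_powers x = power_sums lam ->
  row_full (jacobian_mx trace_powers x).
Proof.
move=> slam /(level_spectrumP x slam)/(X_hermP h slam)[S [oS eS _]].
rewrite /row_full -mxrank_tr -/(row_free _); apply: inj_row_free => c cJ.
(* [B] is the gradient of the combination [c] of the trace functions; the factors [k.+1] come from
   differentiating the powers. *)
pose A := stair_mx x; pose B := \sum_(k < n) (c 0 k * k.+1%:R)%:C%C *: A ^+ k.
have trB v : complex.Re (\tr (B *m stair_mx v)) = 0.
  have : (v *m jacobian_mx trace_powers x *m c^T) 0 0 = 0.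
    rewrite -mulmxA (_ : jacobian_mx trace_powers x *m c^T = 0) ?mulmx0 ?mxE//.
    by rewrite -[LHS]trmxK trmx_mul trmxK cJ trmx0.
  rewrite -(jacobian_mxE trace_powers_Ck) mxE => E.
  have -> : \tr (B *m stair_mx v) = \sum_(k < n) \tr ((c 0 k * k.+1%:R)%:C%C *: A ^+ k *m stair_mx v).
    by rewrite /B mulmx_suml raddf_sum.
  rewrite complex_Re_sum -[RHS]E.
  apply: eq_bigr => k _; rewrite -scalemxAl mxtraceZ complex_ReM /= mul0r subr0.
  rewrite derive_trace_powers [c^T k 0]mxE -/A.
  by move: (complex.Re _) (k.+1%:R) (c 0 k) => u m d; ring.
have hA : A \is hermsymmx := stair_mx_herm x.
have ctA : ct A = A by move: hA; rewrite hermP => /eqP <-.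
have ctX k : ct (A ^+ k) = A ^+ k.
  elim: k => [|k IH]; first by apply/matrixP => i j; rewrite ctE expr0 !mxE eq_sym conjC_nat.
  rewrite exprS -[A * _]/(A *m _) ctM IH ctA.
  by rewrite -[LHS]/(A ^+ k * A) -exprSr exprS.
have ctB : ct B = B.
  have ctk (k : 'I_n) : ct ((c 0 k * k.+1%:R)%:C%C *: A ^+ k) = (c 0 k * k.+1%:R)%:C%C *: A ^+ k.
    by rewrite ct_scale ctX conj_Creal ?complex_real.
  apply/matrixP => i j; rewrite ctE !summxE rmorph_sum; apply: eq_bigr => k _.
  by rewrite -[in RHS]ctk ctE.
have hB : B \is hermsymmx by rewrite hermP ctB.
(* In the real case the test matrix [Q] below must be real to come from a parameter row. *)
have rB : ~~ cx -> forall i j, complex.Im (B i j) = 0.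
  move=> ncx; have rA k i j : complex.Im ((A ^+ k) i j) = 0.
    elim: k i j => [|k IH] i j; first by rewrite expr0 mxE; case: (i == j).
    rewrite exprS mxE complex_Im_sum big1// => l _.
    rewrite complex_ImM IH mulr0 add0r stair_mx_Im -[stair_entry _ _]/((stair_pair x).2 i l).
    by rewrite stair_pair_real// mxE mul0r.
  move=> i j; rewrite summxE complex_Im_sum big1// => k _.
  by rewrite mxE complex_ImM rA mulr0 add0r /= mul0r.
(* The staircase part of [B] as test direction: [\tr (B *m Q)] is the sum of the squared moduli of
   the entries of [B] inside the staircase. *)
pose Q : 'M[R[i]]_n := \matrix_(i, j) (if (i <= h j)%N && (j <= h i)%N then B i j else 0).
have hQ : Q \is hermsymmx.
  rewrite hermP; apply/eqP/matrixP => i j; rewrite ctE !mxE andbC.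
  by case: ifP => _; rewrite ?conjC0// -[in LHS]ctB ctE.
have [v vQ] : exists v, stair_mx v = Q.
  exists (stair_row (re_im Q)); rewrite /stair_mx stair_rowK ?re_imK// => [i j ji|ncx].
    by rewrite mxE [(i <= h j)%N]leqNgt ji.
  by apply/matrixP => i j; rewrite !mxE; case: ifP => _ //; exact: rB.
have B0 (i j : 'I_n) : (i <= h j)%N -> (j <= h i)%N -> B i j = 0.
  have BQ k l : 0 <= B k l * Q l k.
    rewrite mxE; case: ifP => _; last by rewrite mulr0.
    by rewrite -[B l k]/(B l k) -{2}ctB ctE mul_conjC_ge0.
  have trBQ : \tr (B *m Q) = \sum_k \sum_l B k l * Q l k.
    by apply: eq_bigr => k _; rewrite mxE.
  have tr0 : 0 <= \tr (B *m Q).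
    by rewrite trBQ; apply: sumr_ge0 => k _; apply: sumr_ge0.
  have trE : \tr (B *m Q) = 0.
    by rewrite -[LHS](RRe_real (ger0_real tr0)) -vQ trB.
  move=> ij ji; move: trE; rewrite trBQ => /psumr_eq0P E1.
  have /psumr_eq0P E2 := E1 (fun k _ => sumr_ge0 _ (fun l _ => BQ k l)) i isT.
  have /eqP := E2 (fun l _ => BQ i l) j isT.
  by rewrite mxE ji ij /= -{2}ctB ctE mul_conjC_eq0 => /eqP.
have AB : A *m B = B *m A.
  rewrite mulmx_sumr mulmx_suml; apply: eq_bigr => k _; rewrite -scalemxAr -scalemxAl.
  by congr (_ *: _); rewrite -[LHS]/(A * A ^+ k) -[RHS]/(A ^+ k * A) -exprS exprSr.
have BE := commuting_off_staircase_eq0 hh (lamC_inj slam) hA hB (@stair_mx_hess x) eS AB B0.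
have c0 := sum_powers_eq0 (lamC_inj slam) eS BE.
apply/rowP => k; rewrite mxE; have /eqP := c0 k.
rewrite eq_complex /= eqxx andbT mulf_eq0 pnatr_eq0 orbF => /eqP; exact.
Qed.

(** One set for both cases, so that manifold structure and diffeomorphism are proved once. *)
Definition X_stair lam : set T := [set p | X_herm h lam p /\ (~~ cx -> p.2 = 0)].

Lemma X_stairE lam : simple_spectrum lam ->
  X_stair lam = stair_pair @` (trace_powers @^-1` [set power_sums lam]).
Proof.
move=> slam; apply/seteqP; split=> [p [Xp rp]|_ [x /= /(level_spectrumP x slam) Xx <-]]; last first.
  by split=> //; exact: stair_pair_real.
have E : stair_pair (stair_row p) = p.
  have [S [oS eS hp]] := (X_hermP h slam p).1 Xp.
  apply: stair_rowK => //; have [] := eigbasis_herm (lamC_real lam) oS eS; by [].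
by exists (stair_row p) => //=; apply/(level_spectrumP _ slam); rewrite E.
Qed.

Lemma X_stair_submanifold lam : simple_spectrum lam ->
  smooth_submanifold (if cx then 2 * staircase_dim h else staircase_dim h) (X_stair lam).
Proof.
move=> slam; rewrite (X_stairE slam).
apply: (smooth_submanifold_linear_embedding stair_row_continuous stair_pairK) => x /= Fx.
have [U [D [oU Ux oD dUD]]] := regular_level_chart trace_powers_Ck (level_regular slam Fx)
  (card_stair_index hh cx).
by exists U, D; split=> //; move: dUD; rewrite Fx.
Qed.

(** A convex combination of strictly increasing spectra is strictly increasing, so every level over
    the segment is regular. *)
Lemma X_stair_diffeomorphic lam mu : simple_spectrum lam -> simple_spectrum mu ->
  diffeomorphic (X_stair lam) (X_stair mu).
Proof.
move=> slam smu; rewrite (X_stairE slam) (X_stairE smu).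
apply: (diffeomorphic_linear_embedding stair_row_continuous stair_pairK).
pose nu (t : R) i := (1 - t) * lam i + t * mu i.
have snu (t : R) : 0 <= t <= 1 -> simple_spectrum (nu t).
  move=> /andP[t0 t1] i j ij; have := slam i j ij; have := smu i j ij.
  rewrite /nu; move: t1; rewrite le_eqVlt => /orP[/eqP ->|t1 d2 d1].
    by rewrite subrr !mul0r !mul1r !add0r.
  by rewrite ltr_leD// ?ltr_pM2l ?subr_gt0// ler_wpM2l// ltW.
have cnu : continuous (fun t : R => power_sums (nu t)).
  move=> t; apply: mx_continuous_at => i j.
  under [X in {for t, continuous X}]eq_fun do rewrite mxE.
  apply: (@Ck_on_sum R R^o R^o 0 setT _ (index_enum 'I_n) (fun k (t : R) => nu t k ^+ j.+1) openT _ t I).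
  move=> k {}t _.
  have cn : {for t, continuous (fun t : R => nu t k)}.
    apply: continuousD; apply: continuousM; try exact: cst_continuous; last exact: cvg_id.
    by apply: continuousB; [exact: cst_continuous|exact: cvg_id].
  exact: (continuous_comp cn (@exprn_continuous R j.+1 _)).
have E0 : power_sums (nu 0) = power_sums lam.
  by apply/rowP => k; rewrite !mxE; apply: eq_bigr => i _; rewrite /nu subr0 mul1r mul0r addr0.
have E1 : power_sums (nu 1) = power_sums mu.
  by apply/rowP => k; rewrite !mxE; apply: eq_bigr => i _; rewrite /nu subrr mul1r mul0r add0r.
rewrite -E0 -E1; apply: (level_path_diffeomorphic trace_powers_Ck
  (B := 1 + \sum_i (lam i ^+ 2 + mu i ^+ 2)) cnu) => t x t01 Fx.
split; last exact: level_regular (snu t t01) Fx.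
apply: le_trans (level_bound (snu t t01) Fx) _; rewrite lerD2l; apply: ler_sum => i _.
case/andP: t01 => t0 t1; rewrite /nu; move: (lam i) (mu i) => a b.
(* The sum of two squares minus the square of a convex combination, written as a sum of nonnegative
   terms. *)
rewrite -subr_ge0 (_ : _ - _ = t * (1 - t) * (a - b) ^+ 2 + t * a ^+ 2 + (1 - t) * b ^+ 2); last by ring.
by apply: addr_ge0; [apply: addr_ge0|]; apply: mulr_ge0; rewrite ?sqr_ge0 ?mulr_ge0 ?subr_ge0.
Qed.

End StaircaseLevels.

Section Theorem5.
Context {R : realType} {n : nat} (h : 'I_n -> 'I_n) (lam : 'I_n -> R).

Lemma X_stair_complex : X_stair h true lam = X_herm h lam.
Proof. by apply/seteqP; split=> [p []|p]. Qed.

Lemma X_stair_real : X_stair h false lam = X_real h lam.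
Proof.
have realE (z : R[i]) : (z \is Num.real) = (complex.Im z == 0).
  by rewrite realE !lecE /= eq_sym andbC andbC [_ == complex.Im z]eq_sym -andb_orr le_total andbT.
apply/seteqP; split=> p.
  move=> [[A XA Ap] /(_ isT) p0]; exists A => //; split=> // i j; rewrite /= realE.
  by move: p0; rewrite -Ap /= => /matrixP/(_ i j); rewrite !mxE => ->.
move=> [A [XA rA] <-]; split; first by exists A.
by move=> _; apply/matrixP => i j; rewrite !mxE; apply/eqP; rewrite -realE; exact: rA.
Qed.

End Theorem5.

Theorem theorem5 (R : realType) (n : nat) (h : 'I_n -> 'I_n)
    (hh : hessenberg_function h) (lam : 'I_n -> R) (hlam : simple_spectrum lam) :
  [/\ 
      smooth_submanifold (2 * staircase_dim h) (X_herm h lam) /\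
      (forall mu : 'I_n -> R, simple_spectrum mu ->
         diffeomorphic (X_herm h lam) (X_herm h mu)),
      
      smooth_submanifold (staircase_dim h) (X_real h lam) /\
      (forall mu : 'I_n -> R, simple_spectrum mu ->
         diffeomorphic (X_real h lam) (X_real h mu))
    & 
      forall j : nat, odd j ->
        forall c : singular_cohomology R (set_type (X_herm h lam)) j, c = 0].
Proof.
split.
- split=> [|mu hmu]; first by rewrite -X_stair_complex; exact: (@X_stair_submanifold R n h true hh lam hlam).
  by rewrite -!X_stair_complex; exact: X_stair_diffeomorphic.
- split=> [|mu hmu]; first by rewrite -X_stair_real; exact: (@X_stair_submanifold R n h false hh lam hlam).
  by rewrite -!X_stair_real; exact: X_stair_diffeomorphic.
- by move=> j oj; exact: odd_singular_cohomology_eq0.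
Qed.
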